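(* Let $\Lambda$ be a lattice in $\mathbb{R}^n$, $1\le p\le n$, $\alpha,\alpha',\beta,\beta'>0$ and $c\in\mathbb{R}\setminus\{0\}$. If $n\ne 2p$, then $F_{\alpha\beta,p}^{\mathbb{R}^n/\Lambda}$ and $F_{\alpha'\beta',p}^{\mathbb{R}^n/c\Lambda}$ are isospectral if and only if $(\alpha',\beta')=(c^2\alpha,c^2\beta)$. If $n=2p$, then they are isospectral if and only if $\{\alpha',\beta'\}=\{c^2\alpha,c^2\beta\}$.
   Context: A lattice in $\mathbb{R}^n$ is the $\mathbb{Z}$-span of a basis of $\mathbb{R}^n$; $c\Lambda=\{cx\mid x\in\Lambda\}$; $\mathbb{R}^n/\Lambda$ carries the flat metric induced by the standard metric of $\mathbb{R}^n$. For a compact Riemannian manifold $M$, $d$ is the exterior derivative, $\delta$ its formal $L^2$-adjoint, and $F_{\alpha\beta,p}^M:=\alpha d\delta+\beta\delta d$ on smooth $p$-forms. Its spectrum is the function assigning to each $\lambda\in\mathbb{C}$ the dimension of $\{\omega\in\Omega^p(M)\mid F_{\alpha\beta,p}^M\omega=\lambda\omega\}$. Two operators are isospectral if their spectra (with multiplicities) coincide.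
   Formalization: For p = n the operator does not involve β (every n-form is closed), so the claim fails there; the case n ≠ 2p is stated for p < n, and for p = n the criterion becomes: isospectral if and only if α' = c²α. *)

(* Defs.v *)
From HB Require Import structures.
From mathcomp Require Import all_boot all_order all_algebra.
From mathcomp Require Import all_classical all_reals all_analysis.
From mathcomp Require Import complex.

Set Implicit Arguments.
Unset Strict Implicit.
Unset Printing Implicit Defensive.

Import Order.TTheory GRing.Theory Num.Theory.
Import numFieldNormedType.Exports.

Local Open Scope classical_set_scope.
Local Open Scope ring_scope.
Local Open Scope complex_scope.

(* Vectors of R^n are row vectors; the rows of [B] are the basis. *)
Definition zspan (R : realType) (n : nat) (B : 'M[R]_n) : set 'rV[R]_n :=
  [set map_mx (fun m : int => m%:~R) z *m B | z in [set: 'rV[int]_n]].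

Definition is_lattice (R : realType) (n : nat) (L : set 'rV[R]_n) : Prop :=
  exists2 B : 'M[R]_n, B \in unitmx & L = zspan B.

Definition scale_set (R : realType) (n : nat) (c : R) (L : set 'rV[R]_n) :
  set 'rV[R]_n := [set c *: x | x in L].

Definition lattice_basis (R : realType) (n : nat) (L : set 'rV[R]_n) : 'M[R]_n :=
  xget 1%:M [set B | B \in unitmx /\ L = zspan B].

(* C^oo: every iterated partial derivative is Frechet differentiable
   everywhere (hence exists and is continuous). *)
Definition smooth (R : realType) (n : nat) (f : 'rV[R]_n -> R) : Prop :=
  forall (s : seq 'I_n) (x : 'rV[R]_n),
    differentiable
      (foldr (fun (i : 'I_n) (g : 'rV[R]_n -> R) => 'D_(delta_mx 0 i) g) f s) x.

Definition smoothC (R : realType) (n : nat) (f : 'rV[R]_n -> R[i]) : Prop :=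
  smooth (fun x => complex.Re (f x)) /\ smooth (fun x => complex.Im (f x)).

Definition deriveC (R : realType) (n : nat) (v : 'rV[R]_n)
    (f : 'rV[R]_n -> R[i]) (x : 'rV[R]_n) : R[i] :=
  ('D_v (fun y => complex.Re (f y)) x) +i* ('D_v (fun y => complex.Im (f y)) x).

(* A complex-valued [p]-form on R^n sends a point [x] and the [p] tangent
   vectors at [x] that are the rows of [v] to [w x v]. The conditions that make
   such a function a smooth form on R^n/L are those of [forms]. *)
Definition pform (R : realType) (n p : nat) : Type :=
  'rV[R]_n -> 'M[R]_(p, n) -> R[i]^o.

Definition multilinear_map (R : realType) (n p : nat) (a : 'M[R]_(p, n) -> R[i]) :=
  forall (A B C : 'M[R]_(p, n)) (k : 'I_p) (b c : R),
    row k A = b *: row k B + c *: row k C ->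
    row' k B = row' k A -> row' k C = row' k A ->
    a A = b%:C * a B + c%:C * a C.

Definition alternating_map (R : realType) (n p : nat) (a : 'M[R]_(p, n) -> R[i]) :=
  forall (A : 'M[R]_(p, n)) (k l : 'I_p), k != l -> row k A = row l A -> a A = 0.

(* Omega^p(R^n/L), complexified: pulling back along the covering map
   R^n -> R^n/L identifies smooth forms on the torus with the L-periodic smooth
   forms on R^n. *)
Definition forms (R : realType) (n : nat) (L : set 'rV[R]_n) (p : nat) :
    set (pform R n p) :=
  [set w | [/\ forall x, multilinear_map (w x),
               forall x, alternating_map (w x),
               forall v, smoothC (fun x => w x v)
             & forall l x, L l -> w (x + l) = w x]].

(* (d w)_x(v_0, .., v_p)
     = sum_k (-1)^k (D_{v_k} w)_x(v_0, .., omit v_k, .., v_p),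
   the vectors v_k being extended to constant vector fields. *)
Definition ext_der (R : realType) (n p : nat) (w : pform R n p) :
    pform R n p.+1 :=
  fun x v => \sum_(k < p.+1)
    (-1) ^+ k * deriveC (row k v) (fun y => w y (row' k v : 'M[R]_(p, n))) x.

Fixpoint cube_integral (R : realType) (n : nat) : ('rV[R]_n -> R) -> R :=
  match n return ('rV[R]_n -> R) -> R with
  | 0 => fun f => f 0
  | m.+1 => fun f =>
      Rintegral lebesgue_measure `[0, 1]
        (fun t : R => cube_integral (fun x : 'rV[R]_m =>
           f (row_mx (t%:M : 'rV[R]_1) x : 'rV[R]_(1 + m))))
  end.

(* Integral of an L-periodic function over the fundamental parallelepiped
   [0,1]^n B, by the change of variables x = t B. *)
Definition torus_integral (R : realType) (n : nat) (L : set 'rV[R]_n)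
    (f : 'rV[R]_n -> R[i]) : R[i] :=
  let B := lattice_basis L in
  `|\det B|%:C * (cube_integral (fun t => complex.Re (f (t *m B)))
                  +i* cube_integral (fun t => complex.Im (f (t *m B)))).

(* The metric on p-covectors induced by the Euclidean one: the
   dx_{i_1} /\ .. /\ dx_{i_p} with i_1 < .. < i_p are orthonormal, and the
   coefficient of such a monomial is the value on (e_{i_1}, .., e_{i_p}),
   the rows of [rowsub i 1%:M]. *)
Definition covector_dot (R : realType) (n p : nat) (a b : 'M[R]_(p, n) -> R[i]) :
    R[i] :=
  \sum_(i : {ffun 'I_p -> 'I_n} |
         [forall k : 'I_p, forall l : 'I_p, (k < l) ==> (i k < i l)]%N)
    a (rowsub i 1%:M) * conjc (b (rowsub i 1%:M)).

Definition L2_dot (R : realType) (n : nat) (L : set 'rV[R]_n) (p : nat)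
    (w eta : pform R n p) : R[i] :=
  torus_integral L (fun x => covector_dot (w x) (eta x)).

(* delta w is the smooth form characterized by
   <d theta, w> = <theta, delta w> for all smooth theta. *)
Definition codifferential (R : realType) (n : nat) (L : set 'rV[R]_n) (p : nat)
    (w : pform R n p.+1) : pform R n p :=
  xget 0 [set eta | forms L eta /\
    forall theta, forms L theta ->
      L2_dot L (ext_der theta) w = L2_dot L theta eta].

(* On functions (p = 0) delta vanishes, hence so does the term d delta. *)
Definition F_op (R : realType) (n : nat) (L : set 'rV[R]_n) (alpha beta : R)
    (p : nat) : pform R n p -> pform R n p :=
  match p return pform R n p -> pform R n p with
  | 0 => fun w => beta%:C *: codifferential L (ext_der w)
  | q.+1 => fun w => alpha%:C *: ext_der (codifferential L w)
                     + beta%:C *: codifferential L (ext_der w)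
  end.

Definition is_basis (K : fieldType) (V : lmodType K) (E : set V) (k : nat)
    (e : 'I_k -> V) : Prop :=
  [/\ forall i, E (e i),
      forall a : 'I_k -> K, \sum_i a i *: e i = 0 -> forall i, a i = 0
    & forall v, E v -> exists a : 'I_k -> K, v = \sum_i a i *: e i].

(* [None] stands for infinite dimension. *)
Definition dimension (K : fieldType) (V : lmodType K) (E : set V) : option nat :=
  xget None (Some @` [set k | exists e : 'I_k -> V, is_basis E e]).

Definition spectrum (R : realType) (n : nat) (L : set 'rV[R]_n) (p : nat)
    (F : pform R n p -> pform R n p) (lambda : R[i]) : option nat :=
  dimension [set w : pform R n p | forms L w /\ F w = lambda *: w].

Definition isospectral_F (R : realType) (n p : nat)
    (L : set 'rV[R]_n) (alpha beta : R) (L' : set 'rV[R]_n) (alpha' beta' : R) :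
    Prop :=
  spectrum L (@F_op R n L alpha beta p) = spectrum L' (@F_op R n L' alpha' beta' p).

(* Main.v *)
Require Import Defs.
From mathcomp Require Import all_boot all_order all_algebra all_fingroup finmap.
From mathcomp Require Import all_classical all_reals all_analysis.
From mathcomp Require Import complex ring lra zify.

(** Why the theorem holds. On the flat torus R^n / L every operator in sight has
constant coefficients, so Fourier analysis diagonalizes F. For a dual vector u
(an element of the dual lattice L^* ) and a constant p-covector a, with chi_u(x) =
exp(2 pi i u.x), one has d(chi_u a) = 2 pi i chi_u (u /\ a) and delta(chi_u a) =
- 2 pi i chi_u (u _| a). Hence F acts on the Fourier coefficient at u as
4 pi^2 (alpha T + beta (|u|^2 - T)) with T a = u /\ (u _| a)  ([coef_flatF]). In an
orthonormal frame whose first vector is parallel to u, the monomial covectors that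
contain the first covector satisfy T a = |u|^2 a, and the others T a = 0
([parallel_eps]). There are C(n-1,p-1) of the former and C(n-1,p) of the latter,
whatever u is, zero included. As a smooth periodic form is determined by its Fourier
coefficients ([form_eq]), the eigenspace of lambda has the plane waves of eigenvalue
lambda as a basis, and its dimension is

  C(n-1,p-1) #{u in L^* | 4 pi^2 alpha |u|^2 = lambda}
    + C(n-1,p) #{u in L^* | 4 pi^2 beta |u|^2 = lambda}       ([spectrumE]).

The dual of c L is c^-1 L^*, so replacing L by c L amounts to dividing alpha and beta
by c^2 ([mult_scale]); this gives the implications from right to left, since the two
binomial coefficients agree exactly when n = 2p. Conversely, let m(r) be the number of
dual vectors of squared length r, and r0 the smallest positive r with m(r) > 0. Then the
function s |-> A m(s/alpha) + B m(s/beta) determines min(alpha, beta), as r0 times it is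
the first positive argument where the function does not vanish; the value there tells
which of the two coefficients A and B comes with the minimum, and cancelling that
term determines the other number ([dilation_pair]).

Two analytic facts carry the Fourier analysis. First, the codifferential, which is
specified by adjointness, has to be identified with minus the divergence: this needs
integration by parts, i.e. that derivatives of periodic functions have mean zero
([mean_deriveC]), and that a continuous nonnegative function of mean zero vanishes
([mean_ge0_eq0]). Second, a continuous periodic function all of whose Fourier
coefficients vanish is zero ([mean_fourier]); iterating integrals reduces this to the
circle, where it follows by integrating against powers of a trigonometric polynomial
with a single peak ([peak_orthogonal_le0]). *)

Set Implicit Arguments.
Unset Strict Implicit.
Unset Printing Implicit Defensive.

Import Order.TTheory GRing.Theory Num.Theory.
Import numFieldNormedType.Exports.

Local Open Scope classical_set_scope.
Local Open Scope ring_scope.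
Local Open Scope complex_scope.

(** * Integration over the unit interval *)

Definition int01 (R : realType) (g : R -> R) : R :=
  Rintegral lebesgue_measure `[0, 1] g.

Section UnitIntervalIntegral.
Context {R : realType}.
Implicit Types g h : R -> R.

Lemma integrable01 g : continuous g ->
  lebesgue_measure.-integrable `[0, 1] (EFin \o g).
Proof.
move=> cg; apply: continuous_compact_integrable; first exact: segment_compact.
exact: continuous_subspaceT.
Qed.

Lemma int01D g h : continuous g -> continuous h ->
  int01 (fun t => g t + h t) = int01 g + int01 h.
Proof.
by move=> cg ch; rewrite /int01 RintegralD//; exact: integrable01.
Qed.

Lemma int01Z (a : R) g : continuous g ->
  int01 (fun t => a * g t) = a * int01 g.
Proof. by move=> cg; rewrite /int01 RintegralZl//; exact: integrable01. Qed.

Lemma int01_cst (a : R) : int01 (fun=> a) = a.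
Proof.
rewrite /int01 Rintegral_cst//= lebesgue_measure_itv/= lte_fin ltr01.
by rewrite sube0 /= mulr1.
Qed.

Lemma le_int01 g h : continuous g -> continuous h ->
  (forall t, t \in `[0, 1] -> g t <= h t) -> int01 g <= int01 h.
Proof. by move=> cg ch gh; apply: le_Rintegral => //; exact: integrable01. Qed.

Lemma eq_int01 g h : g =1 h -> int01 g = int01 h.
Proof. by move=> gh; rewrite /int01; congr Rintegral; exact/funext. Qed.

(** By compactness of [0,1], [G (u, s)] tends to [G (t, s)] uniformly in [s] when
  [u] tends to [t]. *)
Lemma int01_param_continuous (T : topologicalType) (G : T * R -> R) :
  continuous G -> continuous (fun t => int01 (fun s => G (t, s))).
Proof.
move=> cG t.
have cGt u : continuous (fun s => G (u, s)).
  move=> s; apply: (@continuous_comp _ _ _ (fun s => (u, s)) G); last exact: cG.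
  exact: (cvg_pair (cvg_cst u) cvg_id).
apply/cvgrPdist_le => e e0.
have /compact_near_coveringP cpt : compact (`[0, 1]%classic : set R).
  exact: segment_compact.
have : \forall u \near t, `[0, 1]%classic `<=` (fun s => `|G (t, s) - G (u, s)| <= e).
  apply: cpt => s _.
  have e20 : 0 < e / 2 by rewrite divr_gt0.
  have /cvgrPdist_le /(_ _ e20) [[A B] /= [nA nB] AB] := cG (t, s).
  exists (B, A) => //= -[s' u] /= [Bs' Au].
  have H1 := AB (u, s') (conj Au Bs').
  have H2 := AB (t, s') (conj (nbhs_singleton nA) Bs').
  move: H1 H2; rewrite /= (distrC (G (t, s)) (G (t, s'))) => H1 H2.
  have -> : G (t, s') - G (u, s') = (G (t, s') - G (t, s)) + (G (t, s) - G (u, s')) by ring.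
  by rewrite (le_trans (ler_normD _ _))// [leRHS]splitr lerD.
apply: filterS => u Hu.
have leD h1 h2 : continuous h1 -> continuous h2 ->
    (forall s, s \in `[0, 1] -> h1 s <= h2 s + e) -> int01 h1 <= int01 h2 + e.
  move=> c1 c2 h12; rewrite -[X in _ + X](int01_cst e) -int01D//; last exact: cst_continuous.
  by apply: le_int01 => // s; apply: continuousD; [exact: c2|exact: cst_continuous].
have : int01 (fun s => G (u, s)) <= int01 (fun s => G (t, s)) + e.
  by apply: leD => // s /Hu; rewrite ler_norml => /andP[]; lra.
have : int01 (fun s => G (t, s)) <= int01 (fun s => G (u, s)) + e.
  by apply: leD => // s /Hu; rewrite ler_norml => /andP[]; lra.
by rewrite ler_norml; lra.
Qed.

Lemma primitive_itv g (a b : R) : continuous g ->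
  exists P : R -> R, forall x : R, a < x < b -> is_derive x 1 P (g x).
Proof.
move=> cg; exists (fun x => Rintegral lebesgue_measure `[a, x] g) => x /andP[ax xb].
have [] := @continuous_FTC1_closed R g a x b xb _ ax (cg x).
  apply: continuous_compact_integrable; first exact: segment_compact.
  exact: continuous_subspaceT.
by move=> dP P1; apply: DeriveDef; [exact: dP|rewrite -derive1E; exact: P1].
Qed.

Lemma int01_FTC g (P : R -> R) : continuous g ->
  (forall x : R, 0 <= x <= 1 -> is_derive x 1 P (g x)) -> int01 g = P 1 - P 0.
Proof.
move=> cg dP; rewrite /int01 /Rintegral.
have cP (x : R) : 0 <= x <= 1 -> {for x, continuous P}.
  move=> /dP [dPx _]; exact/differentiable_continuous/derivable1_diffP.
rewrite (@continuous_FTC2 R g P 0 1)//.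
- exact: continuous_subspaceT.
- split.
  + move=> x; rewrite in_itv/= => /andP[x0 x1].
    by have [] : is_derive x 1 P (g x) by apply: dP; rewrite !ltW.
  + apply: cvg_at_right_filter; apply: cP; lra.
  + apply: cvg_at_left_filter; apply: cP; lra.
- move=> x; rewrite in_itv/= => /andP[x0 x1].
  have dPx : is_derive x 1 P (g x) by apply: dP; rewrite !ltW.
  by rewrite derive1E derive_val.
Qed.

(** A primitive of [g] is nondecreasing and takes the same value at 0 and 1, so it
  is constant in between. *)
Lemma int01_eq0 g : continuous g -> (forall t, 0 <= g t) -> int01 g = 0 ->
  forall t, 0 < t < 1 -> g t = 0.
Proof.
move=> cg g0 Ig t /andP[t0 t1].
have [P dP] := @primitive_itv g (-1) 2 cg.
have P01 : P 1 = P 0.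
  suff : int01 g = P 1 - P 0 by rewrite Ig; lra.
  by apply: (@int01_FTC g P cg) => x ?; apply: dP; lra.
have P_nd x y : 0 <= x -> x <= y -> y <= 1 -> P x <= P y.
  move=> x0 xy y1.
  have [] := @MVT_segment R P g x y xy.
  - by move=> z; rewrite in_itv/= => ?; apply: dP; lra.
  - apply: continuous_in_subspaceT => z; rewrite inE/= in_itv/= => zxy.
    have [dPz _] : is_derive z 1 P (g z) by apply: dP; lra.
    exact/differentiable_continuous/derivable1_diffP.
  - by move=> z _ E; rewrite -subr_ge0 E mulr_ge0// subr_ge0.
have PE x : 0 < x < 1 -> P x = P 0.
  move=> /andP[x0 x1]; apply/le_anti; rewrite -{1}P01.
  by rewrite !P_nd// ltW.
have dPt : is_derive t 1 P (g t) by apply: dP; lra.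
have <- : 'D_1 P t = g t by rewrite derive_val.
rewrite (@near_eq_derive _ _ _ _ (cst (P 0))) ?derive_cst ?oner_eq0//.
have tI : t \in `]0, 1[ by rewrite in_itv/= t0 t1.
have := near_in_itvoo tI; apply: filterS => x; rewrite in_itv/=; exact: PE.
Qed.

(** For a primitive [P] of the periodic function [g], the difference
  [P (x + 1) - P x] has derivative zero. *)
Lemma int01_shift_ge0 g (a : R) : 0 <= a ->
  continuous g -> (forall t, g (t + 1) = g t) ->
  int01 (fun t => g (t + a)) = int01 g.
Proof.
move=> a0 cg g1; have [P dP] := @primitive_itv g (-1) (a + 2) cg.
have dPs (b x : R) : -1 < x + b < a + 2 -> is_derive x 1 (fun y => P (y + b)) (g (x + b)).
  move=> xb; have dPxb := dP _ xb.
  have := @is_derive1_comp R P (shift b) x (g (x + b)) 1 dPxb (is_derive_shift _ _ _).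
  by rewrite mulr1.
have -> : int01 (fun t => g (t + a)) = P (1 + a) - P (0 + a).
  apply: (@int01_FTC (fun t => g (t + a)) (fun x => P (x + a))).
    move=> x; apply: (@continuous_comp _ _ _ (shift a) g); last exact: cg.
    by apply: continuousD; [exact: cvg_id|exact: cst_continuous].
  by move=> x ?; apply: dPs; lra.
have -> : int01 g = P 1 - P 0.
  by apply: (@int01_FTC g P cg) => x ?; apply: dP; lra.
have dD x : 0 <= x <= a -> is_derive x 1 (fun y => P (y + 1) - P y) 0.
  move=> xa; have -> : 0 = g (x + 1) - g x :> R by rewrite g1 subrr.
  by apply: is_deriveB; [apply: dPs|apply: dP]; lra.
have [] := @MVT_segment R (fun y => P (y + 1) - P y) (cst 0) 0 a a0.
- by move=> z; rewrite in_itv/= => ?; apply: dD; lra.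
- apply: continuous_in_subspaceT => z; rewrite inE/= in_itv/= => zxy.
  have [dPz _] : is_derive z 1 (fun y => P (y + 1) - P y) 0 by apply: dD; lra.
  exact/differentiable_continuous/derivable1_diffP.
- by move=> z _; rewrite /= !add0r (addrC a) mul0r; lra.
Qed.

Lemma int01_shift g (a : R) : continuous g -> (forall t, g (t + 1) = g t) ->
  int01 (fun t => g (t + a)) = int01 g.
Proof.
move=> cg g1; have [a0|/ltW a0] := leP 0 a; first exact: int01_shift_ge0.
rewrite -(@int01_shift_ge0 (fun t => g (t + a)) (- a)).
- by apply: eq_int01 => t; rewrite subrK.
- by rewrite oppr_ge0.
- move=> x; apply: (@continuous_comp _ _ _ (shift a) g); last exact: cg.
  by apply: continuousD; [exact: cvg_id|exact: cst_continuous].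
- by move=> t; rewrite addrAC g1.
Qed.

End UnitIntervalIntegral.

(** * Iterated integrals over the unit cube *)

Local Notation intv R z := (map_mx (fun k : int => k%:~R : R) z).

Lemma continuous_mx (R : realType) (T : topologicalType) m n (f : T -> 'M[R]_(m, n)) :
  (forall i j, continuous (fun t => f t i j)) -> continuous f.
Proof.
move=> cf t A [P Pf PA].
have : \forall u \near t, forall i j, P i j (f u i j).
  apply: filter_forall => i; apply: filter_forall => j.
  by apply: (cf i j t); exact: Pf.
by apply: filterS => u Pu; apply: PA.
Qed.

Lemma continuous_pair (T U V : topologicalType) (f : T -> U) (g : T -> V) :
  continuous f -> continuous g -> continuous (fun t => (f t, g t)).
Proof. by move=> cf cg t; apply: cvg_pair; [exact: cf|exact: cg]. Qed.

Lemma ord_split_ind m (P : 'I_(1 + m) -> Prop) :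
  P (lshift m 0) -> (forall k, P (rshift 1 k)) -> forall j, P j.
Proof.
move=> P0 PS j; rewrite -(fintype.splitK j); case: (fintype.split j) => k //=.
by rewrite ord1.
Qed.

(** The slicing of R^(1+m) along which [cube_integral] is iterated. *)
Definition row_cons (R : realType) m (t : R) (x : 'rV[R]_m) : 'rV[R]_(1 + m) :=
  row_mx (t%:M : 'rV[R]_1) x.

Section CubeIntegral.
Context {R : realType}.

Lemma row_cons0 m (t : R) (x : 'rV[R]_m) : row_cons t x 0 (lshift m 0) = t.
Proof. by rewrite /row_cons row_mxEl mxE eqxx. Qed.

Lemma row_consS m (t : R) (x : 'rV[R]_m) j : row_cons t x 0 (rshift 1 j) = x 0 j.
Proof. by rewrite /row_cons row_mxEr. Qed.

Lemma row_consD m (s t : R) (x y : 'rV[R]_m) :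
  row_cons (s + t) (x + y) = row_cons s x + row_cons t y.
Proof. by rewrite /row_cons add_row_mx -raddfD. Qed.

Lemma row_cons_split m (x : 'rV[R]_(1 + m)) :
  x = row_cons (x 0 (lshift m 0)) (rsubmx x).
Proof.
rewrite -[LHS]hsubmxK /row_cons; congr row_mx.
by apply/matrixP => i j; rewrite !ord1 !mxE eqxx.
Qed.

Lemma row_cons_continuous m (T : topologicalType) (s : T -> R) (y : T -> 'rV[R]_m) :
  continuous s -> continuous y -> continuous (fun t => row_cons (s t) (y t)).
Proof.
move=> cs cy; apply: continuous_mx => i j; rewrite ord1; elim/ord_split_ind: j => [|k].
- by under eq_fun do rewrite row_cons0.
- under eq_fun do rewrite row_consS.
  move=> t.
  apply: (@continuous_comp _ _ _ y (fun x : 'rV[R]_m => x 0 k)); first exact: cy.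
  exact: coord_continuous.
Qed.

Lemma cube_integralS m (f : 'rV[R]_m.+1 -> R) :
  cube_integral f =
  int01 (fun t => cube_integral (fun x : 'rV[R]_m => f (row_cons t x))).
Proof. by []. Qed.

Lemma eq_cube m (f g : 'rV[R]_m -> R) : f =1 g -> cube_integral f = cube_integral g.
Proof. by move=> /funext ->. Qed.

(** The parameter space is arbitrary so that, in the induction on the dimension,
  it can absorb the first coordinate. *)
Lemma cube_param_continuous m (T : topologicalType) (F : T * 'rV[R]_m -> R) :
  continuous F -> continuous (fun t => cube_integral (fun x => F (t, x))).
Proof.
elim: m T F => [|m IH] T F cF.
  move=> t /=; apply: (@continuous_comp _ _ _ (fun t => (t, 0 : 'rV[R]_0)) F); last exact: cF.
  by apply: continuous_pair => {}t; [exact: cvg_id|exact: cvg_cst].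
apply: (@int01_param_continuous _ _ (fun z : T * R =>
   cube_integral (fun x => F (z.1, row_cons z.2 x)))).
apply: (@IH (T * R)%type (fun z => F (z.1.1, row_cons z.1.2 z.2))) => z.
apply: (@continuous_comp _ _ _ (fun z : T * R * 'rV[R]_m => (z.1.1, row_cons z.1.2 z.2)) F);
  last exact: cF.
apply: continuous_pair => {}z.
- by apply: (@continuous_comp _ _ _ fst fst); exact: cvg_fst.
- apply: (@row_cons_continuous m _ (fun z : T * R * 'rV[R]_m => z.1.2) snd) => {}z.
  + apply: (@continuous_comp _ _ _ fst snd); [exact: cvg_fst|exact: cvg_snd].
  + exact: cvg_snd.
Qed.

Lemma slice_continuous m (f : 'rV[R]_m.+1 -> R) (t : R) : continuous f ->
  continuous (fun x : 'rV[R]_m => f (row_cons t x)).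
Proof.
move=> cf x; apply: (@continuous_comp _ _ _ (fun x => row_cons t x) f); last exact: cf.
by apply: row_cons_continuous => {}x; [exact: cst_continuous|exact: cvg_id].
Qed.

Lemma slice_integral_continuous m (f : 'rV[R]_m.+1 -> R) : continuous f ->
  continuous (fun t => cube_integral (fun x : 'rV[R]_m => f (row_cons t x))).
Proof.
move=> cf; apply: (@cube_param_continuous m _ (fun z => f (row_cons z.1 z.2))) => z.
apply: (@continuous_comp _ _ _ (fun z : R * 'rV[R]_m => row_cons z.1 z.2) f); last exact: cf.
by apply: row_cons_continuous => {}z; [exact: cvg_fst|exact: cvg_snd].
Qed.

Lemma cubeD m (f g : 'rV[R]_m -> R) : continuous f -> continuous g ->
  cube_integral (fun x => f x + g x) = cube_integral f + cube_integral g.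
Proof.
elim: m f g => [//|m IH] f g cf cg; rewrite !cube_integralS -int01D;
  try exact: slice_integral_continuous.
by apply: eq_int01 => t; rewrite IH//; exact: slice_continuous.
Qed.

Lemma cubeZ m (a : R) (f : 'rV[R]_m -> R) : continuous f ->
  cube_integral (fun x => a * f x) = a * cube_integral f.
Proof.
elim: m f => [//|m IH] f cf; rewrite !cube_integralS -int01Z;
  try exact: slice_integral_continuous.
by apply: eq_int01 => t; rewrite IH//; exact: slice_continuous.
Qed.

Lemma cube_cst m (a : R) : cube_integral (fun _ : 'rV[R]_m => a) = a.
Proof.
elim: m => [//|m IH]; rewrite cube_integralS -[RHS]int01_cst.
by apply: eq_int01 => t.
Qed.

Lemma cube_ge0 m (f : 'rV[R]_m -> R) : continuous f -> (forall x, 0 <= f x) ->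
  0 <= cube_integral f.
Proof.
elim: m f => [|m IH] f cf f0; first exact: f0.
rewrite cube_integralS -(int01_cst 0).
apply: le_int01; first exact: cst_continuous.
  exact: slice_integral_continuous.
by move=> t _; apply: IH => //; exact: slice_continuous.
Qed.

(** The conclusion is at the centre of the cube because [int01_eq0] only speaks of
  interior points; [cube_shift] moves it elsewhere. *)
Lemma cube_eq0 m (f : 'rV[R]_m -> R) : continuous f -> (forall x, 0 <= f x) ->
  cube_integral f = 0 -> f (const_mx 2^-1) = 0.
Proof.
elim: m f => [|m IH] f cf f0 If.
  by rewrite -[RHS]If /=; congr f; apply/matrixP => i [].
have -> : const_mx 2^-1 = row_cons 2^-1 (const_mx 2^-1) :> 'rV[R]_(1 + m).
  apply/matrixP => i j; rewrite ord1; elim/ord_split_ind: j => [|k].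
    by rewrite row_cons0 mxE.
  by rewrite row_consS !mxE.
apply: (IH (fun x => f (row_cons 2^-1 x))) => //; first exact: slice_continuous.
apply: (int01_eq0 (slice_integral_continuous cf) _ If).
- by move=> t; apply: cube_ge0 => //; exact: slice_continuous.
- by rewrite invr_gt0 ltr0n invf_lt1// ltr1n.
Qed.

Definition unit_periodic m (f : 'rV[R]_m -> R) :=
  forall (z : 'rV[int]_m) x, f (x + intv R z) = f x.

Lemma row_cons_int m (k : int) (z : 'rV[int]_m) :
  map_mx (fun k : int => k%:~R : R) (row_mx (k%:M : 'rV_1) z) = row_cons k%:~R (intv R z).
Proof.
apply/matrixP => i j; rewrite ord1; elim/ord_split_ind: j => [|l].
  by rewrite row_cons0 mxE row_mxEl mxE eqxx.
by rewrite row_consS mxE row_mxEr [RHS]mxE.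
Qed.

Lemma unit_periodic_row_cons m (f : 'rV[R]_(1 + m) -> R) : unit_periodic f ->
  forall (k : int) (z : 'rV[int]_m) t x,
    f (row_cons (t + k%:~R) (x + intv R z)) = f (row_cons t x).
Proof.
by move=> pf k z t x; rewrite -[RHS](pf (row_mx (k%:M : 'rV_1) z)) row_cons_int row_consD.
Qed.

(** Coordinate by coordinate, this is [int01_shift]. *)
Lemma cube_shift m (f : 'rV[R]_m -> R) a : continuous f -> unit_periodic f ->
  cube_integral (fun x => f (x + a)) = cube_integral f.
Proof.
elim: m f a => [|m IH] f a cf pf.
  by rewrite /=; congr f; apply/matrixP => i [].
rewrite !cube_integralS; have [a0 [a1 aE]] : exists a0 a1, a = row_cons a0 a1.
  exact: ex_intro (ex_intro _ _ (row_cons_split (a : 'rV_(1 + m)))).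
transitivity (int01 (fun t => cube_integral (fun x : 'rV[R]_m => f (row_cons (t + a0) x)))).
  apply: eq_int01 => t; rewrite -(IH (fun x => f (row_cons (t + a0) x)) a1).
  - by apply: eq_cube => x; congr f; rewrite aE; exact/esym/row_consD.
  - exact: slice_continuous.
  - by move=> z x; rewrite -[RHS](unit_periodic_row_cons pf 0 z) addr0.
apply: (@int01_shift _ (fun t => cube_integral (fun x : 'rV[R]_m => f (row_cons t x)))).
  exact: slice_integral_continuous.
move=> t; apply: eq_cube => x.
by rewrite -[RHS](unit_periodic_row_cons pf 1 0) map_mx0 addr0.
Qed.

End CubeIntegral.

(** * A peaked trigonometric polynomial *)

Section PeakedKernel.
Context {R : realType}.

(** On [0,1] this trigonometric polynomial has its maximum [1 + k] at 1/2 only, and it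
  is at most 1 where [k <= cos (pi t) ^+ 2]. *)
Definition peak (k t : R) : R := 1 + k - cos (pi * t) ^+ 2.

Lemma continuousM_fun (T : topologicalType) (f g : T -> R) :
  continuous f -> continuous g -> continuous (fun t => f t * g t).
Proof. by move=> cf cg t; apply: continuousM; [exact: cf|exact: cg]. Qed.

Lemma continuousD_fun (T : topologicalType) (f g : T -> R) :
  continuous f -> continuous g -> continuous (fun t => f t + g t).
Proof. by move=> cf cg t; apply: continuousD; [exact: cf|exact: cg]. Qed.

Lemma continuousN_fun (T : topologicalType) (f : T -> R) :
  continuous f -> continuous (fun t => - f t).
Proof. by move=> cf t; apply: continuousN; exact: cf. Qed.

Lemma continuousX_fun (T : topologicalType) (f : T -> R) N :
  continuous f -> continuous (fun t => f t ^+ N).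
Proof.
move=> cf; elim: N => [|N IH]; first by under eq_fun do rewrite expr0; exact: cst_continuous.
by under eq_fun do rewrite exprS; exact: continuousM_fun.
Qed.

Lemma cospi_continuous : continuous (fun t : R => cos (pi * t)).
Proof.
move=> t; apply: (@continuous_comp _ _ _ (fun t => pi * t) cos); last exact: continuous_cos.
by apply: continuousM_fun => {}t; [exact: cst_continuous|exact: cvg_id].
Qed.

Lemma peak_continuous k : continuous (peak k).
Proof.
apply: continuousD_fun; first exact: cst_continuous.
exact/continuousN_fun/continuousX_fun/cospi_continuous.
Qed.

Lemma peak_half k : peak k 2^-1 = 1 + k.
Proof. by rewrite /peak cos_pihalf expr0n subr0. Qed.

Lemma cospi_neq0 (t : R) : 0 <= t <= 1 -> t != 2^-1 -> 0 < cos (pi * t) ^+ 2.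
Proof.
move=> /andP[t0 t1] tn; rewrite lt_def sqr_ge0 andbT sqrf_eq0 -cos_pihalf.
apply: contra_neq tn => /cos_inj.
have p0 := @pi_gt0 R.
rewrite !in_itv/= mulr_ge0 ?(ltW p0)//= ler_piMr ?(ltW p0)// => /(_ isT).
rewrite divr_ge0 ?(ltW p0)//= ler_pdivrMr// ler_pMr// ler1n => /(_ isT).
by move/(mulfI (lt0r_neq0 p0)).
Qed.

(** If [G 2^-1 > 0], choose [c > 0] and [k > 0] such that [c <= G t] wherever
  [peak k t > 1], and let [- M] be a lower bound of [G]. Then
  [c * peak k ^+ N <= G * peak k ^+ N + (M + c)] on [0,1], so that the integrals of
  [c * peak k ^+ N] are bounded by [M + c]. But they grow at least linearly in [N],
  by Bernoulli's inequality where [peak k > 1 + k / 2]. *)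
Lemma peak_orthogonal_le0 (G : R -> R) : continuous G ->
  (forall k N, int01 (fun t => G t * peak k t ^+ N) = 0) -> G 2^-1 <= 0.
Proof.
move=> cG G_orth; rewrite leNgt; apply/negP => G0.
pose c := G 2^-1 / 2; have c0 : 0 < c by rewrite divr_gt0.
have [k k0 [k1 Gk]] : exists2 k : R, 0 < k & k <= 1 /\
    forall t, t \in `[0, 1] -> c <= G t \/ k <= cos (pi * t) ^+ 2.
  have /compact_near_coveringP cpt : compact (`[0, 1]%classic : set R).
    exact: segment_compact.
  have : \forall k \near 0^'+, `[0, 1]%classic `<=`
      (fun t : R => c <= G t \/ (k : R) <= cos (pi * t) ^+ 2).
    apply: cpt => t; rewrite /= in_itv/= => t01.
    have [->|tn] := eqVneq t 2^-1.
      have : \forall t' \near (2^-1 : R), c < G t'.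
        by apply: (cvgr_gt _ (cG 2^-1)); rewrite /c; move: G0; lra.
      move=> H; near=> t' k => /=; left; apply: ltW.
      by near: t'.
    have := cospi_neq0 t01 tn; set d := cos (pi * t) ^+ 2 => d0.
    have H : \forall t' \near t, d / 2 < cos (pi * t') ^+ 2.
      have Hc : (fun t' : R => cos (pi * t') ^+ 2) @ t --> d.
        have H := @continuousX_fun R (fun t : R => cos (pi * t)) 2 cospi_continuous t.
        exact: H.
      by apply: (cvgr_gt _ Hc); lra.
    near=> t' k => /=; right; apply: (@le_trans _ _ (d / 2)); last first.
      by apply: ltW; near: t'.
    by near: k; apply: nbhs_right_le; rewrite divr_gt0.
  move=> H; near (0 : R)^'+ => k; exists k; first by [].
  split; first by near: k; apply: nbhs_right_le.
  move=> t t01; suff : `[0, 1]%classic `<=`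
      (fun t : R => c <= G t \/ (k : R) <= cos (pi * t) ^+ 2) by apply.
  by near: k.
have [M M0 GM] : exists2 M : R, 0 <= M & forall t, t \in `[0, 1] -> - M <= G t.
  have [t0 _ Ht0] := @EVT_min R G 0 1 ler01 (continuous_subspaceT cG).
  exists `|G t0| => // t t01; apply: le_trans (Ht0 t t01).
  by rewrite lerNl (le_trans (ler_norm _))// normrN.
(* A continuous function supported where Bernoulli's inequality is used. *)
pose psi t := Num.max 0 (peak k t - 1 - k / 2).
have cpsi : continuous psi.
  move=> t; apply: (@continuous_max R R (cst 0) (fun t => peak k t - 1 - k / 2)).
    exact: cst_continuous.
  move: t.
  by do 2 (apply: continuousD_fun; last exact: cst_continuous); exact: peak_continuous.
have psi0 : 0 < int01 psi.
  rewrite lt_def; apply/andP; split; last first.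
    rewrite -(int01_cst 0); apply: le_int01 => //; first exact: cst_continuous.
    by move=> t _; rewrite le_max lexx.
  apply/negP => /eqP /(int01_eq0 cpsi) H.
  have : psi 2^-1 = 0 by apply: H => [t|]; rewrite ?le_max ?lexx//; lra.
  rewrite /psi peak_half; have -> : 1 + k - 1 - k / 2 = k / 2 by lra.
  by rewrite max_r; lra.
have cP N : continuous (fun t => peak k t ^+ N) by exact/continuousX_fun/peak_continuous.
have key N : c * ((1 + (k / 2) *+ N) * int01 psi) <= M + c.
  have : int01 (fun t => (c * (1 + (k / 2) *+ N)) * psi t) <=
      int01 (fun t => G t * peak k t ^+ N + (M + c)).
    apply: le_int01.
    - by apply: continuousM_fun => //; exact: cst_continuous.
    - by apply: continuousD_fun; [exact: continuousM_fun|exact: cst_continuous].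
    move=> t t01; have cos1 : 0 <= cos (pi * t) ^+ 2 <= 1.
      by rewrite sqr_ge0 -(cos2Dsin2 (pi * t)) lerDl sqr_ge0.
    have P0 : 0 <= peak k t by rewrite /peak; lra.
    have PN0 : 0 <= peak k t ^+ N by exact: exprn_ge0.
    have /(ler_wpM2l (ltW c0)) : (1 + (k / 2) *+ N) * psi t <= peak k t ^+ N.
      rewrite /psi; case: (leP (peak k t - 1 - k / 2) 0) => Hp; first by rewrite mulr0.
      apply: (@le_trans _ _ (1 + (k / 2) *+ N)).
        rewrite ler_piMr//; first by rewrite addr_ge0// mulrn_wge0// divr_ge0// ltW.
        by rewrite /peak in Hp *; lra.
      have Hb : 1 + k / 2 <= peak k t by lra.
      apply: (@le_trans _ _ ((1 + k / 2) ^+ N)).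
        elim: (N) => [|j IH]; first by rewrite mulr0n addr0 expr0.
        rewrite exprSr mulrSr; apply: le_trans (ler_wpM2r _ IH); last by lra.
        have : 0 <= (k / 2) *+ j by rewrite mulrn_wge0// divr_ge0// ltW.
        move: ((k / 2) *+ j) => x x0; nra.
      by apply: lerXn2r; rewrite ?nnegrE//; lra.
    rewrite mulrA => /le_trans; apply.
    have [cGt|kcos] := Gk t t01.
      by rewrite (le_trans (ler_wpM2r PN0 cGt))// lerDl; lra.
    have : peak k t ^+ N <= 1 by apply: exprn_ile1 => //; rewrite /peak; lra.
    have := GM t t01; move: PN0; move: (peak k t ^+ N) => P PN0 G1 P1; nra.
  rewrite int01Z// int01D//; [|exact: continuousM_fun|exact: cst_continuous].
  by rewrite G_orth int01_cst add0r -mulrA.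
have x0 : 0 < c * (k / 2 * int01 psi) by rewrite !mulr_gt0// divr_gt0.
have := key (Num.bound ((M + c) / (c * (k / 2 * int01 psi)))).
set N := Num.bound _.
have : (M + c) / (c * (k / 2 * int01 psi)) < N%:R.
  by apply: archi_boundP; rewrite divr_ge0 ?(ltW x0)//; lra.
rewrite ltr_pdivrMr// => H1; rewrite leNgt => /negP; apply.
apply: (lt_trans H1); rewrite -[(k / 2) *+ _]mulr_natr; move: (N%:R) => y.
rewrite -subr_gt0 (_ : _ - _ = c * int01 psi); last by ring.
exact: mulr_gt0.
Unshelve. all: by end_near. Qed.

Lemma peak_orthogonal_eq0 (G : R -> R) : continuous G ->
  (forall k N, int01 (fun t => G t * peak k t ^+ N) = 0) -> G 2^-1 = 0.
Proof.
move=> cG G_orth; apply/le_anti; rewrite peak_orthogonal_le0//= -oppr_le0.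
apply: (@peak_orthogonal_le0 (fun t => - G t)); first exact: continuousN_fun.
move=> k N; rewrite -[RHS](mulr0 (-1)) -(G_orth k N) -int01Z.
  by apply: eq_int01 => t; rewrite mulN1r mulNr.
by apply: continuousM_fun => //; exact/continuousX_fun/peak_continuous.
Qed.

End PeakedKernel.

(** * Complex-valued integrals and Fourier coefficients on the circle *)

Section ComplexIntegral.
Context {R : realType}.

Lemma Re_mulc (x y : R[i]) : complex.Re (x * y) =
  complex.Re x * complex.Re y - complex.Im x * complex.Im y.
Proof. by case: x y => [a b] [c d]. Qed.

Lemma Im_mulc (x y : R[i]) : complex.Im (x * y) =
  complex.Re x * complex.Im y + complex.Im x * complex.Re y.
Proof. by case: x y => [a b] [c d]. Qed.

Lemma Re_addc (x y : R[i]) : complex.Re (x + y) = complex.Re x + complex.Re y.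
Proof. by case: x y => [a b] [c d]. Qed.

Lemma Im_addc (x y : R[i]) : complex.Im (x + y) = complex.Im x + complex.Im y.
Proof. by case: x y => [a b] [c d]. Qed.

Lemma eq_ReIm (x y : R[i]) : complex.Re x = complex.Re y ->
  complex.Im x = complex.Im y -> x = y.
Proof. by case: x y => [a b] [c d] /= -> ->. Qed.

Definition contC (T : topologicalType) (f : T -> R[i]) :=
  continuous (fun t => complex.Re (f t)) /\ continuous (fun t => complex.Im (f t)).

Lemma contC_cst (T : topologicalType) (a : R[i]) : contC (fun _ : T => a).
Proof. by split; exact: cst_continuous. Qed.

Lemma contCD (T : topologicalType) (f g : T -> R[i]) :
  contC f -> contC g -> contC (fun t => f t + g t).
Proof.
move=> [f1 f2] [g1 g2]; split.
- by under eq_fun do rewrite Re_addc; exact: continuousD_fun.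
- by under eq_fun do rewrite Im_addc; exact: continuousD_fun.
Qed.

Lemma contCM (T : topologicalType) (f g : T -> R[i]) :
  contC f -> contC g -> contC (fun t => f t * g t).
Proof.
move=> [f1 f2] [g1 g2]; split.
- under eq_fun do rewrite Re_mulc.
  by apply: continuousD_fun; [|apply: continuousN_fun]; exact: continuousM_fun.
- under eq_fun do rewrite Im_mulc.
  by apply: continuousD_fun; exact: continuousM_fun.
Qed.

Lemma contC_conj (T : topologicalType) (f : T -> R[i]) :
  contC f -> contC (fun t => conjc (f t)).
Proof.
move=> [f1 f2]; split.
- rewrite (_ : (fun t => _) = (fun t => complex.Re (f t)))//.
  by apply/funext => t; case: (f t).
- rewrite (_ : (fun t => _) = (fun t => - complex.Im (f t))).
    exact: continuousN_fun.
  by apply/funext => t; case: (f t).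
Qed.

Lemma contC_sum (T : topologicalType) I (r : seq I) (P : pred I) (F : I -> T -> R[i]) :
  (forall i, P i -> contC (F i)) -> contC (fun t => \sum_(i <- r | P i) F i t).
Proof.
move=> cF; elim: r => [|i r IH].
  by under eq_fun do rewrite big_nil; exact: contC_cst.
under eq_fun do rewrite big_cons.
by have [Pi|//] := boolP (P i); apply: contCD => //; exact: cF.
Qed.

Lemma contC_comp (T U : topologicalType) (g : T -> U) (f : U -> R[i]) :
  continuous g -> contC f -> contC (fun t => f (g t)).
Proof.
move=> cg [f1 f2]; split=> t.
- by apply: (@continuous_comp _ _ _ g (fun u => complex.Re (f u))); [exact: cg|exact: f1].
- by apply: (@continuous_comp _ _ _ g (fun u => complex.Im (f u))); [exact: cg|exact: f2].
Qed.

(** [exp(i x)]. *)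
Definition expi (x : R) : R[i] := cos x +i* sin x.

Lemma expiD x y : expi (x + y) = expi x * expi y.
Proof. by apply: eq_ReIm; rewrite /= ?cosD ?sinD//; ring. Qed.

Lemma expi0 : expi 0 = 1.
Proof. by rewrite /expi cos0 sin0. Qed.

Lemma conj_expi x : conjc (expi x) = expi (- x).
Proof. by rewrite /expi/= cosN sinN. Qed.

Lemma expi2pi (k : int) : expi (2 * pi * k%:~R) = 1.
Proof.
have expi_nat (m : nat) : expi (2 * pi * m%:R) = 1.
  elim: m => [|m IH]; first by rewrite mulr0 expi0.
  rewrite -[m.+1]addn1 natrD mulrDr expiD IH mul1r mulr1.
  by rewrite mulr_natl /expi cos2pi sin2pi.
case: k => m; first exact: expi_nat.
rewrite NegzE mulrNz mulrN -conj_expi.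
by have := expi_nat m.+1; rewrite -pmulrn => ->; rewrite conjc1.
Qed.

Lemma contC_expi (T : topologicalType) (f : T -> R) :
  continuous f -> contC (fun t => expi (f t)).
Proof.
move=> cf; split=> t.
- by apply: (@continuous_comp _ _ _ f cos); [exact: cf|exact: continuous_cos].
- by apply: (@continuous_comp _ _ _ f sin); [exact: cf|exact: continuous_sin].
Qed.

Definition int01C (g : R -> R[i]) : R[i] :=
  int01 (fun t => complex.Re (g t)) +i* int01 (fun t => complex.Im (g t)).

Definition cubeC m (f : 'rV[R]_m -> R[i]) : R[i] :=
  cube_integral (fun t => complex.Re (f t)) +i* cube_integral (fun t => complex.Im (f t)).

Lemma int01CD g h : contC g -> contC h ->
  int01C (fun t => g t + h t) = int01C g + int01C h.
Proof.
move=> [g1 g2] [h1 h2]; apply: eq_ReIm; rewrite ?Re_addc ?Im_addc /= -int01D//.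
- by apply: eq_int01 => t; rewrite Re_addc.
- by apply: eq_int01 => t; rewrite Im_addc.
Qed.

Lemma int01CZ a g : contC g -> int01C (fun t => a * g t) = a * int01C g.
Proof.
move=> [g1 g2]; have cM b (h : R -> R) : continuous h -> continuous (fun t => b * h t).
  by move=> ch; apply: continuousM_fun => //; exact: cst_continuous.
apply: eq_ReIm; rewrite ?Re_mulc ?Im_mulc /=.
- rewrite -int01Z// -mulNr -int01Z// -int01D//; try exact: cM.
  by apply: eq_int01 => t; rewrite Re_mulc mulNr.
- rewrite -int01Z// -int01Z// -int01D//; try exact: cM.
  by apply: eq_int01 => t; rewrite Im_mulc.
Qed.

Lemma cubeCD m (g h : 'rV[R]_m -> R[i]) : contC g -> contC h ->
  cubeC (fun t => g t + h t) = cubeC g + cubeC h.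
Proof.
move=> [g1 g2] [h1 h2]; apply: eq_ReIm; rewrite ?Re_addc ?Im_addc /= -cubeD//.
- by apply: eq_cube => t; rewrite Re_addc.
- by apply: eq_cube => t; rewrite Im_addc.
Qed.

Lemma cubeCZ m a (g : 'rV[R]_m -> R[i]) : contC g ->
  cubeC (fun t => a * g t) = a * cubeC g.
Proof.
move=> [g1 g2].
have cM b (h : 'rV[R]_m -> R) : continuous h -> continuous (fun t => b * h t).
  by move=> ch; apply: continuousM_fun => //; exact: cst_continuous.
apply: eq_ReIm; rewrite ?Re_mulc ?Im_mulc /=.
- rewrite -cubeZ// -mulNr -cubeZ// -cubeD//; try exact: cM.
  by apply: eq_cube => t; rewrite Re_mulc mulNr.
- rewrite -cubeZ// -cubeZ// -cubeD//; try exact: cM.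
  by apply: eq_cube => t; rewrite Im_mulc.
Qed.

Lemma eq_cubeC m (f g : 'rV[R]_m -> R[i]) : f =1 g -> cubeC f = cubeC g.
Proof. by move=> /funext ->. Qed.

Lemma cubeC_cst m a : cubeC (fun _ : 'rV[R]_m => a) = a.
Proof. by apply: eq_ReIm; rewrite /= cube_cst. Qed.

Lemma cubeC_sum m I (r : seq I) (P : pred I) (F : I -> 'rV[R]_m -> R[i]) :
  (forall i, P i -> contC (F i)) ->
  cubeC (fun t => \sum_(i <- r | P i) F i t) = \sum_(i <- r | P i) cubeC (F i).
Proof.
move=> cF; elim: r => [|i r IH].
  by rewrite big_nil -[RHS](cubeC_cst m); apply: eq_cubeC => t; rewrite big_nil.
rewrite big_cons; case: ifPn => Pi; last first.
  by rewrite -IH; apply: eq_cubeC => t; rewrite big_cons (negbTE Pi).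
rewrite -IH -cubeCD; [|exact: cF|exact: contC_sum].
by apply: eq_cubeC => t; rewrite big_cons Pi.
Qed.

Lemma cubeC_shift m (f : 'rV[R]_m -> R[i]) a : contC f ->
  (forall (z : 'rV[int]_m) x, f (x + intv R z) = f x) ->
  cubeC (fun x => f (x + a)) = cubeC f.
Proof.
move=> [f1 f2] pf; apply: eq_ReIm => /=.
- by apply: (cube_shift a f1) => z x; rewrite pf.
- by apply: (cube_shift a f2) => z x; rewrite pf.
Qed.

Lemma contC_slice m (f : 'rV[R]_m.+1 -> R[i]) (t : R) : contC f ->
  contC (fun x : 'rV[R]_m => f (row_cons t x)).
Proof. move=> [f1 f2]; split.
- exact (@slice_continuous R m (fun x => complex.Re (f x)) t f1).
- exact (@slice_continuous R m (fun x => complex.Im (f x)) t f2). Qed.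

Lemma contC_slice_integral m (f : 'rV[R]_m.+1 -> R[i]) : contC f ->
  contC (fun t => cubeC (fun x : 'rV[R]_m => f (row_cons t x))).
Proof. move=> [f1 f2]; split.
- exact (@slice_integral_continuous R m (fun x => complex.Re (f x)) f1).
- exact (@slice_integral_continuous R m (fun x => complex.Im (f x)) f2). Qed.

(** The square of the cosine has frequencies -1, 0 and 1. *)
Lemma peakE k t : (peak k t)%:C = (2^-1 + k)%:C +
  (- 4^-1)%:C * (expi (2 * pi * (1 : int)%:~R * t) + expi (2 * pi * (-1 : int)%:~R * t)) :> R[i].
Proof.
have -> : (-1 : int)%:~R = -1 :> R by rewrite mulrNz.
rewrite !mulrN !mulr1 mulNr -conj_expi.
apply: eq_ReIm; rewrite /= !(mul0r, subr0, addr0); last first.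
  by rewrite subrr mulr0 addr0.
have -> : 2 * pi * t = (pi * t) *+ 2 by rewrite -mulrA mulr_natl.
by rewrite /peak cos_mulr2n [_ ^+ 2 *+ 2]mulr2n; lra.
Qed.

(** After a translation the point under consideration is 1/2. By [peakE] and
  induction on [N], the translated function is orthogonal to [peak k ^+ N] times any
  character, so [peak_orthogonal_eq0] applies to its real and imaginary parts. *)
Lemma fourier_circle (f : R -> R[i]) : contC f -> (forall t, f (t + 1) = f t) ->
  (forall k : int, int01C (fun t => f t * expi (2 * pi * k%:~R * t)) = 0) ->
  forall t, f t = 0.
Proof.
move=> cf pf f_orth a.
have ce (k : int) : contC (fun t : R => expi (2 * pi * k%:~R * t)).
  by apply: contC_expi; apply: continuousM_fun => t; [exact: cst_continuous|exact: cvg_id].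
pose b := a - 2^-1; pose g t := f (t + b).
have cg : contC g.
  apply: contC_comp cf; apply: continuousD_fun => t; [exact: cvg_id|exact: cst_continuous].
have g_orth (k : int) : int01C (fun t => g t * expi (2 * pi * k%:~R * t)) = 0.
  pose h t := expi (- (2 * pi * k%:~R * b)) * (f t * expi (2 * pi * k%:~R * t)).
  have ch : contC h by apply: contCM; [exact: contC_cst|exact: contCM].
  have ph t : h (t + 1) = h t.
    by rewrite /h pf [_ * (t + 1)]mulrDr expiD mulr1 expi2pi mulr1.
  have hE : (fun t => g t * expi (2 * pi * k%:~R * t)) = (fun t => h (t + b)).
    apply/funext => t; rewrite /h /g [RHS]mulrCA -expiD; congr (_ * expi _); ring.
  rewrite hE -[RHS](mulr0 (expi (- (2 * pi * k%:~R * b)))) -(f_orth k) -int01CZ; last exact: contCM.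
  by apply: eq_ReIm => /=; rewrite (@int01_shift _ (fun t => _ (h t)))//;
    case: ch => // ? ? t; rewrite ph.
have cP k N : contC (fun t => ((peak k t) ^+ N)%:C : R[i]).
  by split => /=; [exact/continuousX_fun/peak_continuous|exact: cst_continuous].
have gP k N : forall j : int,
    int01C (fun t => g t * ((peak k t) ^+ N)%:C * expi (2 * pi * j%:~R * t)) = 0.
  elim: N => [|N IH] j.
    rewrite -[RHS](g_orth j); congr int01C; apply/funext => t.
    by rewrite expr0 mulr1.
  pose u j t := g t * ((peak k t) ^+ N)%:C * expi (2 * pi * j%:~R * t).
  have cu i : contC (u i) by apply: contCM => //; exact: contCM.
  have -> : (fun t => g t * ((peak k t) ^+ N.+1)%:C * expi (2 * pi * j%:~R * t)) =
     (fun t => (2^-1 + k)%:C * u j t + (- 4^-1)%:C * (u (1 + j) t + u (-1 + j) t)).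
    apply/funext => t; rewrite exprS rmorphM/= peakE /u !intrD !mulrDr !mulrDl !expiD; ring.
  rewrite int01CD; last 2 first.
  - by apply: contCM => //; exact: contC_cst.
  - by apply: contCM; [exact: contC_cst|exact: contCD].
  by rewrite !int01CZ ?int01CD ?IH ?addr0 ?mulr0 ?addr0//; exact: contCD.
have gP0 k N : int01C (fun t => g t * ((peak k t) ^+ N)%:C) = 0.
  rewrite -(gP k N 0); congr int01C; apply/funext => t.
  by rewrite mulr0 mul0r expi0 mulr1.
have -> : f a = g 2^-1 by rewrite /g /b addrC subrK.
case: (cg) => c1 c2; apply: eq_ReIm; apply: (@peak_orthogonal_eq0 R (fun t => _ (g t))) => // k N.
- have /(congr1 (@complex.Re R)) /= := gP0 k N; apply: etrans.
  by apply: eq_int01 => t; rewrite Re_mulc/= mulr0 subr0.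
- have /(congr1 (@complex.Im R)) /= := gP0 k N; apply: etrans.
  by apply: eq_int01 => t; rewrite Im_mulc/= mulr0 add0r.
Qed.

End ComplexIntegral.

(** * Characters and Fourier coefficients on the unit cube *)

Section Characters.
Context {R : realType}.

Definition dot n (u v : 'rV[R]_n) : R := (u *m v^T) 0 0.

Lemma dotE n (u v : 'rV[R]_n) : dot u v = \sum_j u 0 j * v 0 j.
Proof. by rewrite /dot mxE; apply: eq_bigr => j _; rewrite mxE. Qed.

Lemma dotC n (u v : 'rV[R]_n) : dot u v = dot v u.
Proof. by rewrite !dotE; apply: eq_bigr => j _; rewrite mulrC. Qed.

Lemma dotDl n (u u' v : 'rV[R]_n) : dot (u + u') v = dot u v + dot u' v.
Proof. by rewrite /dot mulmxDl mxE. Qed.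

Lemma dotDr n (u v v' : 'rV[R]_n) : dot u (v + v') = dot u v + dot u v'.
Proof. by rewrite dotC dotDl !(dotC u). Qed.

Lemma dotZl n a (u v : 'rV[R]_n) : dot (a *: u) v = a * dot u v.
Proof. by rewrite /dot -scalemxAl mxE. Qed.

Lemma dotZr n a (u v : 'rV[R]_n) : dot u (a *: v) = a * dot u v.
Proof. by rewrite dotC dotZl dotC. Qed.

Lemma dotNl n (u v : 'rV[R]_n) : dot (- u) v = - dot u v.
Proof. by rewrite -scaleN1r dotZl mulN1r. Qed.

Lemma dot0l n (v : 'rV[R]_n) : dot 0 v = 0.
Proof. by rewrite -(scale0r 0) dotZl mul0r. Qed.

Lemma dot_ge0 n (u : 'rV[R]_n) : 0 <= dot u u.
Proof. by rewrite dotE sumr_ge0// => j _; rewrite -expr2 sqr_ge0. Qed.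

Lemma dot_eq0 n (u : 'rV[R]_n) : (dot u u == 0) = (u == 0).
Proof.
apply/idP/eqP => [|->]; last by rewrite dot0l.
rewrite dotE psumr_eq0 => [/allP H|j _]; last by rewrite -expr2 sqr_ge0.
apply/rowP => j; rewrite mxE.
by have := H j (mem_index_enum j); rewrite /= mulf_eq0 orbb => /eqP.
Qed.

Lemma dot_row_cons n s t (u v : 'rV[R]_n) :
  dot (row_cons s u) (row_cons t v) = s * t + dot u v.
Proof.
rewrite /dot /row_cons tr_row_mx mul_row_col mxE; congr (_ + _).
by rewrite mxE big_ord1 !mxE eqxx mulr1n.
Qed.

Lemma dot_mulmx n (u v : 'rV[R]_n) (A : 'M[R]_n) : dot u (v *m A) = dot (u *m A^T) v.
Proof. by rewrite /dot trmx_mul mulmxA. Qed.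

Lemma dot_continuous n (u : 'rV[R]_n) : continuous (dot u).
Proof.
have -> : dot u = (fun v => \sum_j u 0 j * v 0 j) by apply/funext => v; exact: dotE.
elim: (index_enum _) => [|j r IH].
  by under eq_fun do rewrite big_nil; exact: cst_continuous.
under eq_fun do rewrite big_cons; apply: continuousD_fun => //.
by apply: continuousM_fun; [exact: cst_continuous|exact: coord_continuous].
Qed.

(** The character of R^n with frequency [u]. *)
Definition chi n (u x : 'rV[R]_n) : R[i] := expi (2 * pi * dot u x).

Lemma contC_chi n (u : 'rV[R]_n) : contC (chi u).
Proof.
apply: contC_expi; apply: continuousM_fun; [exact: cst_continuous|exact: dot_continuous].
Qed.

Lemma chiDl n (u v x : 'rV[R]_n) : chi (u + v) x = chi u x * chi v x.
Proof. by rewrite /chi dotDl mulrDr expiD. Qed.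

Lemma chiDr n (u x y : 'rV[R]_n) : chi u (x + y) = chi u x * chi u y.
Proof. by rewrite /chi dotDr mulrDr expiD. Qed.

Lemma chi0 n (x : 'rV[R]_n) : chi 0 x = 1.
Proof. by rewrite /chi dot0l mulr0 expi0. Qed.

(** Integrating [f] against a character in all coordinates but the first leaves a
  function on the circle with vanishing Fourier coefficients. It is zero, so the
  slices of [f] have vanishing Fourier coefficients too. *)
Lemma fourier_cube m (f : 'rV[R]_m -> R[i]) : contC f ->
  (forall (z : 'rV[int]_m) x, f (x + intv R z) = f x) ->
  (forall z : 'rV[int]_m, cubeC (fun x => f x * chi (intv R z) x) = 0) ->
  forall x, f x = 0.
Proof.
elim: m f => [|m IH] f cf pf f_orth x.
  have -> : x = 0 by apply/matrixP => i [].
  have := f_orth 0; rewrite /cubeC /=; have -> : intv R (0 : 'rV[int]_0) = 0 by apply/matrixP => i [].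
  by rewrite chi0 mulr1; case: (f 0).
have pfc (k : int) (z : 'rV[int]_m) t y :
    f (row_cons (t + k%:~R) (y + intv R z)) = f (row_cons t y).
  by rewrite -[RHS](pf (row_mx (k%:M : 'rV_1) z)) row_cons_int row_consD.
have [t [y ->]] : exists t y, x = row_cons t y.
  exact: ex_intro (ex_intro _ _ (row_cons_split (x : 'rV_(1 + m)))).
apply: (IH (fun y => f (row_cons t y))) => [|z {}y|z].
- exact: contC_slice.
- by rewrite -[RHS](pfc 0 z) addr0.
pose h t := cubeC (fun y : 'rV[R]_m => f (row_cons t y) * chi (intv R z) y).
have cF : contC (fun x : 'rV[R]_(1 + m) => f x * chi (intv R (row_mx (0%:M : 'rV[int]_1) z)) x).
  by apply: contCM => //; exact: contC_chi.
have hE : h = fun t => cubeC (fun y : 'rV[R]_m =>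
    (fun x : 'rV[R]_(1 + m) => f x * chi (intv R (row_mx (0%:M : 'rV[int]_1) z)) x) (row_cons t y)).
  apply/funext => s; apply: eq_cubeC => {}y /=.
  by rewrite row_cons_int /chi dot_row_cons mul0r add0r.
have ch : contC h by rewrite hE; exact (contC_slice_integral cF).
apply: (fourier_circle ch) => [s|k].
  apply: eq_cubeC => {}y; congr (_ * _).
  by rewrite -[RHS](pfc 1 0) map_mx0 addr0.
rewrite -[RHS](f_orth (row_mx (k%:M : 'rV_1) z)).
have -> : (fun s => h s * expi (2 * pi * k%:~R * s)) =
  fun s => cubeC (fun y : 'rV[R]_m => f (row_cons s y) * chi (intv R (row_mx (k%:M : 'rV_1) z)) (row_cons s y)).
  apply/funext => s; rewrite mulrC /h -cubeCZ; last first.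
    apply: contCM; [exact: contC_slice|exact: contC_chi].
  apply: eq_cubeC => {}y; rewrite row_cons_int /chi dot_row_cons [2 * pi * (_ + _)]mulrDr expiD [2 * pi * (_ * _)]mulrA; ring.
by [].
Qed.

End Characters.

(** * Smooth functions *)

Section SmoothFunctions.
Context {R : realType} {n : nat}.
Implicit Types f g : 'rV[R]_n -> R.

(** Iterated partial derivatives of a member of [C] stay in [C]. *)
Lemma smooth_coind (C : ('rV[R]_n -> R) -> Prop) :
  (forall f, C f -> (forall x, differentiable f x) /\
     forall i, C ('D_(delta_mx 0 i) f)) ->
  forall f, C f -> smooth f.
Proof.
move=> HC f Cf s; elim/last_ind: s f Cf => [|s i IH] f Cf x; first by case: (HC f Cf).
by rewrite foldr_rcons; apply: IH; case: (HC f Cf).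
Qed.

Lemma smooth_differentiable f x : smooth f -> differentiable f x.
Proof. by move=> /(_ [::] x). Qed.

Lemma smooth_partial f i : smooth f -> smooth ('D_(delta_mx 0 i) f).
Proof. by move=> sf s x; have := sf (rcons s i) x; rewrite foldr_rcons. Qed.

Lemma smooth_continuous f : smooth f -> continuous f.
Proof. by move=> sf x; exact/differentiable_continuous/smooth_differentiable. Qed.

Lemma smooth_derivable f x v : smooth f -> derivable f x v.
Proof. by move=> sf; exact/diff_derivable/smooth_differentiable. Qed.

(** The algebra generated by the smooth functions is stable under partial
  derivatives, by the Leibniz rule; so it consists of smooth functions. *)
Inductive smooth_alg : ('rV[R]_n -> R) -> Prop :=
| SmoothGen f of smooth f : smooth_alg f
| SmoothAdd f g of smooth_alg f & smooth_alg g : smooth_alg (fun x => f x + g x)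
| SmoothMul f g of smooth_alg f & smooth_alg g : smooth_alg (fun x => f x * g x).

Lemma smooth_alg_smooth f : smooth_alg f -> smooth f.
Proof.
apply: smooth_coind => {}f; elim=>
  {f} [f sf|f g sf [df IHf] sg [dg IHg]|f g sf [df IHf] sg [dg IHg]].
- split=> [x|i]; first exact: smooth_differentiable.
  by constructor; exact: smooth_partial.
- split=> [x|i]; first exact: differentiableD.
  rewrite (_ : 'D__ _ = fun x => 'D_(delta_mx 0 i) f x + 'D_(delta_mx 0 i) g x).
    exact: SmoothAdd.
  by apply/funext => x; rewrite [LHS]deriveD//; exact: diff_derivable.
- split=> [x|i]; first exact: differentiableM.
  rewrite (_ : 'D__ _ = fun x => f x * 'D_(delta_mx 0 i) g x + g x * 'D_(delta_mx 0 i) f x).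
    by apply: SmoothAdd; exact: SmoothMul.
  by apply/funext => x; rewrite [LHS]deriveM//; exact: diff_derivable.
Qed.

Lemma smooth_cst (a : R) : smooth (fun _ : 'rV[R]_n => a).
Proof.
apply: (@smooth_coind (fun f => exists a, f = cst a)); last by exists a.
move=> _ [b ->]; split=> [x|i]; first exact: differentiable_cst.
by exists 0; apply/funext => x; rewrite derive_cst.
Qed.

Lemma smoothD f g : smooth f -> smooth g -> smooth (fun x => f x + g x).
Proof. by move=> sf sg; apply: smooth_alg_smooth; apply: SmoothAdd; exact: SmoothGen. Qed.

Lemma smoothM f g : smooth f -> smooth g -> smooth (fun x => f x * g x).
Proof. by move=> sf sg; apply: smooth_alg_smooth; apply: SmoothMul; exact: SmoothGen. Qed.

Lemma smoothN f : smooth f -> smooth (fun x => - f x).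
Proof.
move=> sf; under eq_fun do rewrite -mulN1r.
by apply: smoothM => //; exact: smooth_cst.
Qed.

Lemma derive_partials f (v x : 'rV[R]_n) : smooth f ->
  'D_v f x = \sum_i v 0 i * 'D_(delta_mx 0 i) f x.
Proof.
move=> sf; have df := smooth_differentiable x sf.
rewrite deriveE// [in LHS](row_sum_delta v) linear_sum; apply: eq_bigr => i _.
by rewrite linearZ deriveE.
Qed.

Lemma smooth_sum I (r : seq I) (P : pred I) (F : I -> 'rV[R]_n -> R) :
  (forall i, P i -> smooth (F i)) -> smooth (fun x => \sum_(i <- r | P i) F i x).
Proof.
move=> sF; elim: r => [|i r IH].
  by under eq_fun do rewrite big_nil; exact: smooth_cst.
under eq_fun do rewrite big_cons.
by have [Pi|//] := boolP (P i); apply: smoothD => //; exact: sF.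
Qed.

Lemma smooth_derive f v : smooth f -> smooth ('D_v f).
Proof.
move=> sf; rewrite (_ : 'D_v f = fun x => \sum_i v 0 i * 'D_(delta_mx 0 i) f x).
  by apply: smooth_sum => i _; apply: smoothM; [exact: smooth_cst|exact: smooth_partial].
by apply/funext => x; exact: derive_partials.
Qed.

Lemma derive_periodic f (l v x : 'rV[R]_n) : (forall y, f (y + l) = f y) ->
  'D_v f (x + l) = 'D_v f x.
Proof.
move=> pf; rewrite /derive.
have -> : (fun h : R => h^-1 *: ((f \o shift (x + l)) (h *: v) - f (x + l))) =
  (fun h : R => h^-1 *: ((f \o shift x) (h *: v) - f x)); last by [].
by apply/funext => h /=; rewrite addrA !pf.
Qed.

Lemma differentiable_dot (u x : 'rV[R]_n) : differentiable (dot u) x.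
Proof.
have -> : dot u = (fun v => \sum_j u 0 j * v 0 j) by apply/funext => v; exact: dotE.
elim: (index_enum _) => [|j r IH].
  by under eq_fun do rewrite big_nil; exact: differentiable_cst.
under eq_fun do rewrite big_cons; apply: differentiableD => //.
by apply: differentiableZ; exact: differentiable_coord.
Qed.

Lemma derive_dot (u v x : 'rV[R]_n) : 'D_v (dot u) x = dot u v.
Proof.
rewrite /derive; apply: cvg_lim => //.
apply: (@cvg_trans _ ((cst (dot u v)) h @[h --> 0^'])); last exact: cvg_cst.
apply: near_eq_cvg; near=> h => /=.
have h0 : h != 0 by near: h; exact: nbhs_dnbhs_neq.
by rewrite dotDr addrK dotZr [_ *: _]mulrA mulVf// mul1r.
Unshelve. all: by end_near. Qed.

(** These combinations are stable under partial derivatives, unlike the cosine or the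
  sine alone. *)
Definition wave (u : 'rV[R]_n) (a b : R) x := a * cos (dot u x) + b * sin (dot u x).

Lemma differentiable_comp_dot (h : R -> R) (u x : 'rV[R]_n) :
  (forall t, derivable h t 1) -> differentiable (fun x => h (dot u x)) x.
Proof.
move=> dh; apply: (@differentiable_comp _ _ _ _ (dot u) h).
  exact: differentiable_dot.
exact/derivable1_diffP.
Qed.

Lemma derive_comp_dot (h : R -> R) (u v x : 'rV[R]_n) :
  (forall t, derivable h t 1) ->
  'D_v (fun x => h (dot u x)) x = 'D_1 h (dot u x) * dot u v.
Proof.
move=> dh; have hd t : differentiable h t by exact/derivable1_diffP.
rewrite deriveE; last exact: differentiable_comp_dot.
rewrite (@diff_comp _ _ _ _ (dot u) h)//; last exact: differentiable_dot.
rewrite /= -(@deriveE _ _ _ (dot u)); last exact: differentiable_dot.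
rewrite derive_dot.
have -> : 'd h (dot u x) (dot u v) = dot u v *: 'd h (dot u x) 1.
  by rewrite -linearZ; congr ('d h _ _); rewrite [RHS]mulr1.
by rewrite -deriveE// mulrC.
Qed.

Lemma derive_wave u a b v x :
  'D_v (wave u a b) x = wave u (b * dot u v) (- (a * dot u v)) x.
Proof.
have dc t : derivable (fun x => cos (dot u x)) t v.
  by apply: diff_derivable; apply: differentiable_comp_dot => ?; exact: derivable_cos.
have ds t : derivable (fun x => sin (dot u x)) t v.
  by apply: diff_derivable; apply: differentiable_comp_dot => ?; exact: derivable_sin.
rewrite /wave [LHS]deriveD; try exact: derivableZ.
rewrite !deriveZ// !derive_comp_dot//; try exact: derivable_cos; try exact: derivable_sin.
by rewrite !derive_val /GRing.scale/=; ring.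
Qed.

Lemma smooth_wave u a b : smooth (wave u a b).
Proof.
apply: (@smooth_coind (fun f => exists a b, f = wave u a b)); last by exists a, b.
move=> _ [c [d ->]]; split=> [x|i].
  apply: differentiableD; apply: differentiableZ; apply: differentiable_comp_dot => t.
  - exact: derivable_cos.
  - exact: derivable_sin.
by eexists; eexists; apply/funext => x; exact: derive_wave.
Qed.

End SmoothFunctions.

(** * Complex-valued smooth functions *)

Section ComplexSmoothFunctions.
Context {R : realType} {n : nat}.
Implicit Types f g : 'rV[R]_n -> R[i].

Lemma smoothC_contC f : smoothC f -> contC f.
Proof. by move=> [f1 f2]; split; apply: smooth_continuous. Qed.

Lemma smoothC_cst (a : R[i]) : smoothC (fun _ : 'rV[R]_n => a).
Proof. by split; exact: smooth_cst. Qed.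

Lemma smoothCD f g : smoothC f -> smoothC g -> smoothC (fun x => f x + g x).
Proof.
move=> [f1 f2] [g1 g2]; split.
- by under eq_fun do rewrite Re_addc; exact: smoothD.
- by under eq_fun do rewrite Im_addc; exact: smoothD.
Qed.

Lemma smoothCM f g : smoothC f -> smoothC g -> smoothC (fun x => f x * g x).
Proof.
move=> [f1 f2] [g1 g2]; split.
- under eq_fun do rewrite Re_mulc.
  by apply: smoothD; [|apply: smoothN]; exact: smoothM.
- under eq_fun do rewrite Im_mulc.
  by apply: smoothD; exact: smoothM.
Qed.

Lemma smoothCN f : smoothC f -> smoothC (fun x => - f x).
Proof.
move=> sf; under eq_fun do rewrite -mulN1r.
by apply: smoothCM => //; exact: smoothC_cst.
Qed.

Lemma smoothC_conj f : smoothC f -> smoothC (fun x => conjc (f x)).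
Proof.
move=> [f1 f2]; split.
- rewrite (_ : (fun x => _) = (fun x => complex.Re (f x)))//.
  by apply/funext => x; case: (f x).
- rewrite (_ : (fun x => _) = (fun x => - complex.Im (f x))).
    exact: smoothN.
  by apply/funext => x; case: (f x).
Qed.

Lemma smoothC_sum I (r : seq I) (P : pred I) (F : I -> 'rV[R]_n -> R[i]) :
  (forall i, P i -> smoothC (F i)) -> smoothC (fun x => \sum_(i <- r | P i) F i x).
Proof.
move=> sF; elim: r => [|i r IH].
  by under eq_fun do rewrite big_nil; exact: smoothC_cst.
under eq_fun do rewrite big_cons.
by have [Pi|//] := boolP (P i); apply: smoothCD => //; exact: sF.
Qed.

Lemma smoothC_deriveC f v : smoothC f -> smoothC (deriveC v f).
Proof. by move=> [f1 f2]; split; apply: smooth_derive. Qed.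

Lemma smoothC_chi u : smoothC (@chi R n u).
Proof.
split; rewrite /chi /expi /=.
- have -> : (fun x => cos (2 * pi * dot u x)) = wave ((2 * pi) *: u) 1 0.
    by apply/funext => x; rewrite /wave dotZl; lra.
  exact: smooth_wave.
- have -> : (fun x => sin (2 * pi * dot u x)) = wave ((2 * pi) *: u) 0 1.
    by apply/funext => x; rewrite /wave dotZl; lra.
  exact: smooth_wave.
Qed.

Lemma deriveC_cst v (a : R[i]) x : deriveC v (fun _ : 'rV[R]_n => a) x = 0.
Proof. by rewrite /deriveC !derive_cst. Qed.

Lemma deriveCD v f g x : smoothC f -> smoothC g ->
  deriveC v (fun x => f x + g x) x = deriveC v f x + deriveC v g x.
Proof.
move=> [f1 f2] [g1 g2]; apply: eq_ReIm; rewrite ?Re_addc ?Im_addc /=.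
- by under eq_fun do rewrite Re_addc; rewrite [LHS]deriveD//; exact: smooth_derivable.
- by under eq_fun do rewrite Im_addc; rewrite [LHS]deriveD//; exact: smooth_derivable.
Qed.

Lemma deriveCM v f g x : smoothC f -> smoothC g ->
  deriveC v (fun x => f x * g x) x = deriveC v f x * g x + f x * deriveC v g x.
Proof.
move=> [f1 f2] [g1 g2].
have D (h k : 'rV[R]_n -> R) : smooth h -> smooth k ->
    'D_v (fun x : 'rV[R]_n => h x * k x) x = h x * 'D_v k x + k x * 'D_v h x.
  by move=> sf sg; rewrite [LHS]deriveM//; exact: smooth_derivable.
have DN (h : 'rV[R]_n -> R) : smooth h ->
    'D_v (fun x : 'rV[R]_n => - h x) x = - 'D_v h x.
  by move=> sh; rewrite [LHS]deriveN//; exact: smooth_derivable.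
apply: eq_ReIm; rewrite ?Re_addc ?Im_addc ?Re_mulc ?Im_mulc /=.
- under eq_fun do rewrite Re_mulc -mulNr.
  rewrite [LHS]deriveD; try by apply: smooth_derivable; apply: smoothM => //; exact: smoothN.
  rewrite !D//; last exact: smoothN.
  by rewrite DN//; ring.
- under eq_fun do rewrite Im_mulc.
  rewrite [LHS]deriveD; try by apply: smooth_derivable; apply: smoothM => //; exact: smoothN.
  by rewrite !D//; ring.
Qed.

Lemma deriveCZ v a f x : smoothC f ->
  deriveC v (fun x => a * f x) x = a * deriveC v f x.
Proof.
by move=> sf; rewrite deriveCM ?deriveC_cst ?mul0r ?add0r//; exact: smoothC_cst.
Qed.

Lemma deriveC_conj v f x : smoothC f ->
  deriveC v (fun x => conjc (f x)) x = conjc (deriveC v f x).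
Proof.
move=> [f1 f2]; apply: eq_ReIm => /=.
- have -> : (fun y => complex.Re (conjc (f y))) = (fun y => complex.Re (f y)); last by [].
  by apply/funext => y; case: (f y).
- rewrite -deriveN; last exact: smooth_derivable.
  have -> : (fun y => complex.Im (conjc (f y))) = - (fun y => complex.Im (f y)); last by [].
  by apply/funext => y; rewrite [RHS]/(- _); case: (f y).
Qed.

Lemma deriveC_partials v f x : smoothC f ->
  deriveC v f x = \sum_i (v 0 i)%:C * deriveC (delta_mx 0 i) f x.
Proof.
move=> [f1 f2]; rewrite /deriveC (derive_partials v x f1) (derive_partials v x f2).
elim/big_rec3: _ => [//|i a b c _ <-].
by apply: eq_ReIm; rewrite ?Re_addc ?Im_addc ?Re_mulc ?Im_mulc /= ?mul0r ?subr0 ?addr0.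
Qed.

Lemma deriveC_chi (u v x : 'rV[R]_n) :
  deriveC v (chi u) x = (0 +i* (2 * pi * dot u v)) * chi u x.
Proof.
apply: eq_ReIm; rewrite ?Re_mulc ?Im_mulc /=.
- have -> : (fun x => cos (2 * pi * dot u x)) = wave ((2 * pi) *: u) 1 0.
    by apply/funext => y; rewrite /wave dotZl; lra.
  by rewrite derive_wave /wave !dotZl; ring.
- have -> : (fun x => sin (2 * pi * dot u x)) = wave ((2 * pi) *: u) 0 1.
    by apply/funext => y; rewrite /wave dotZl; lra.
  by rewrite derive_wave /wave !dotZl; ring.
Qed.

Lemma deriveC_periodic f (l v x : 'rV[R]_n) : (forall y, f (y + l) = f y) ->
  deriveC v f (x + l) = deriveC v f x.
Proof.
by move=> pf; rewrite /deriveC !(derive_periodic (l := l))// => y; rewrite pf.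
Qed.

End ComplexSmoothFunctions.

(** * Periodic functions and their mean over a torus *)

Section TorusMean.
Context {R : realType} {n : nat} (B : 'M[R]_n).
Hypothesis Bu : B \in unitmx.

Definition periodic (T : Type) (L : set 'rV[R]_n) (f : 'rV[R]_n -> T) :=
  forall l x, L l -> f (x + l) = f x.

(** The dual lattice. *)
Definition dual (L : set 'rV[R]_n) (u : 'rV[R]_n) :=
  forall l, L l -> exists k : int, dot u l = k%:~R.

(** The mean over the torus R^n / zspan B, when [f] is periodic. *)
Definition mean (f : 'rV[R]_n -> R[i]) : R[i] := cubeC (fun t => f (t *m B)).

Local Notation L := (zspan B).

Lemma mulmx_continuous (T : topologicalType) (f : T -> 'rV[R]_n) :
  continuous f -> continuous (fun t => f t *m B).
Proof.
move=> cf; apply: continuous_mx => i j; rewrite ord1.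
have -> : (fun t => (f t *m B) 0 j) = (fun t => dot (row j B^T) (f t)).
  by apply/funext => t; rewrite mxE dotE; apply: eq_bigr => k _; rewrite !mxE mulrC.
by move=> t; apply: (@continuous_comp _ _ _ f (dot (row j B^T))); [exact: cf|exact: dot_continuous].
Qed.

Lemma affine_continuous (w : 'rV[R]_n) : continuous (fun t : 'rV[R]_n => t *m B + w).
Proof.
apply: continuous_mx => i j; under eq_fun do rewrite mxE.
apply: continuousD_fun; last exact: cst_continuous.
move=> t; apply: (@continuous_comp _ _ _ (fun t : 'rV[R]_n => t *m B) (fun x : 'rV[R]_n => x i j)).
  by apply: (@mulmx_continuous _ id) => {}t; exact: cvg_id.
exact: coord_continuous.
Qed.

Lemma contC_mulmx (f : 'rV[R]_n -> R[i]) : contC f -> contC (fun t : 'rV[R]_n => f (t *m B)).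
Proof.
move=> cf; apply: (@contC_comp R 'rV[R]_n 'rV[R]_n (fun t => t *m B) f) => //.
by apply: (@mulmx_continuous _ id) => t; exact: cvg_id.
Qed.

Lemma periodic_mulmx (T : Type) (f : 'rV[R]_n -> T) : periodic L f ->
  forall (z : 'rV[int]_n) (x : 'rV[R]_n), f ((x + intv R z) *m B) = f (x *m B).
Proof. by move=> pf z x; rewrite mulmxDl pf//; exists z. Qed.

Lemma eq_mean f g : f =1 g -> mean f = mean g.
Proof. by move=> /funext ->. Qed.

Lemma meanD f g : contC f -> contC g -> mean (fun x => f x + g x) = mean f + mean g.
Proof. by move=> cf cg; rewrite /mean cubeCD//; exact: contC_mulmx. Qed.

Lemma meanZ a f : contC f -> mean (fun x => a * f x) = a * mean f.
Proof. by move=> cf; rewrite /mean cubeCZ//; exact: contC_mulmx. Qed.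

Lemma mean_cst a : mean (fun=> a) = a.
Proof. exact: cubeC_cst. Qed.

Lemma mean_sum I (r : seq I) (P : pred I) (F : I -> 'rV[R]_n -> R[i]) :
  (forall i, P i -> contC (F i)) ->
  mean (fun x => \sum_(i <- r | P i) F i x) = \sum_(i <- r | P i) mean (F i).
Proof.
by move=> cF; rewrite /mean cubeC_sum// => i Pi; apply: contC_mulmx; exact: cF.
Qed.

Lemma mean_shift f v : contC f -> periodic L f -> mean (fun x => f (x + v)) = mean f.
Proof.
move=> cf pf; rewrite /mean -[RHS](@cubeC_shift _ _ _ (v *m invmx B)).
- by apply: eq_cubeC => t; rewrite mulmxDl mulmxKV.
- exact: contC_mulmx.
- by move=> z x; rewrite periodic_mulmx.
Qed.

(** A translation brings any point to the centre of the fundamental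
  parallelepiped, where [cube_eq0] applies. *)
Lemma mean_ge0_eq0 f : contC f -> periodic L f -> (forall x, 0 <= f x) -> mean f = 0 ->
  forall x, f x = 0.
Proof.
move=> cf pf f0 mf x; pose v := x - const_mx 2^-1 *m B.
have Im0 y : complex.Im (f y) = 0 by have := f0 y; rewrite lecE => /andP[/eqP].
have [cg1 cg2] : contC (fun t : 'rV[R]_n => f (t *m B + v)).
  apply: (@contC_comp R 'rV[R]_n 'rV[R]_n (fun t => t *m B + v) f) => //.
  exact: affine_continuous.
have -> : x = const_mx 2^-1 *m B + v by rewrite /v addrC subrK.
apply: eq_ReIm; rewrite ?Im0//.
apply: (cube_eq0 cg1) => [y|].
  by have := f0 (y *m B + v); rewrite lecE => /andP[].
have := @mean_shift f v cf pf; rewrite mf => /(congr1 (@complex.Re R)).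
by [].
Qed.

Lemma derive_ray (f : 'rV[R]_n -> R) (x v : 'rV[R]_n) (s : R) : smooth f ->
  is_derive s 1 (fun s => f (x + s *: v)) ('D_v f (x + s *: v)).
Proof.
move=> sf; have E :
    (fun h : R => h^-1 *: (((fun s => f (x + s *: v)) \o shift s) (h *: 1) - f (x + s *: v))) =
    (fun h => h^-1 *: ((f \o shift (x + s *: v)) (h *: v) - f (x + s *: v))).
  apply/funext => h /=; congr (_ *: (f _ - _)).
  by rewrite scalerDl [h *: 1]mulr1 addrCA.
apply: DeriveDef; last by rewrite /derive E.
by rewrite /derivable E; exact: smooth_derivable.
Qed.

(** The mean of [f (x + h v)] does not depend on [h]. By the fundamental theorem
  of calculus the difference quotient at [h] is the mean over s in [0,1] of the
  derivative at [x + s h v], which is continuous in [h]. *)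
Lemma cube_integral_derive (f : 'rV[R]_n -> R) (v : 'rV[R]_n) :
  smooth f -> periodic L f -> cube_integral (fun t => 'D_v f (t *m B)) = 0.
Proof.
move=> sf pf; have sdf := smooth_derive v sf.
pose G (z : R * 'rV[R]_n * R) := 'D_v f (z.1.2 *m B + z.2 *: (z.1.1 *: v)).
have cG : continuous G.
  move=> z; apply: (@continuous_comp _ _ _
    (fun z : R * 'rV[R]_n * R => z.1.2 *m B + z.2 *: (z.1.1 *: v)) ('D_v f));
    last exact: smooth_continuous.
  move: z; apply: continuous_mx => i j; rewrite ord1.
  have -> : (fun t : R * 'rV[R]_n * R => (t.1.2 *m B + t.2 *: (t.1.1 *: v)) 0 j) =
            (fun t => (t.1.2 *m B) 0 j + t.2 * (t.1.1 * v 0 j)).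
    by apply/funext => t; rewrite !mxE.
  have c12 : continuous (fun z : R * 'rV[R]_n * R => z.1.2).
    by move=> z; apply: (@continuous_comp _ _ _ fst snd); [exact: cvg_fst|exact: cvg_snd].
  have c11 : continuous (fun z : R * 'rV[R]_n * R => z.1.1).
    by move=> z; apply: (@continuous_comp _ _ _ fst fst); exact: cvg_fst.
  apply: continuousD_fun.
    move=> z; apply: (@continuous_comp _ _ _ (fun z : R * 'rV[R]_n * R => z.1.2 *m B)
      (fun x : 'rV[R]_n => x 0 j)); last exact: coord_continuous.
    exact: mulmx_continuous.
  apply: continuousM_fun; first by move=> z; exact: cvg_snd.
  by apply: continuousM_fun => //; exact: cst_continuous.
pose F (z : R * 'rV[R]_n) := int01 (fun s => G (z, s)).
have cF : continuous F by exact: int01_param_continuous.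
pose q h := cube_integral (fun t => F (h, t)).
have cq : continuous q by exact: cube_param_continuous.
have Fq h t : h * F (h, t) = f (t *m B + h *: v) - f (t *m B).
  rewrite /F -int01Z; last first.
    move=> s; apply: (@continuous_comp _ _ _ (fun s => ((h, t), s)) G); last exact: cG.
    by apply: continuous_pair => {}s; [exact: cst_continuous|exact: cvg_id].
  have dF (s : R) : is_derive s 1 (fun s => f (t *m B + s *: (h *: v))) (h * G (h, t, s)).
    apply: is_derive_eq (derive_ray _ _ _ sf) _; rewrite /G /=.
    rewrite !derive_partials// mulr_sumr; apply: eq_bigr => i _.
    by rewrite mxE mulrA.
  rewrite (@int01_FTC _ _ (fun s => f (t *m B + s *: (h *: v)))).
  - by rewrite scale1r scale0r addr0.
  - apply: continuousM_fun; first exact: cst_continuous.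
    move=> s; apply: (@continuous_comp _ _ _ (fun s => ((h, t), s)) G); last exact: cG.
    by apply: continuous_pair => {}s; [exact: cst_continuous|exact: cvg_id].
have cfB (w : 'rV[R]_n) : continuous (fun t : 'rV[R]_n => f (t *m B + w)).
  move=> t; apply: (@continuous_comp _ _ _ (fun t : 'rV[R]_n => t *m B + w) f);
    last exact: smooth_continuous.
  exact: affine_continuous.
have cfB0 : continuous (fun t : 'rV[R]_n => f (t *m B)).
  by have := cfB 0; under eq_fun do rewrite addr0.
have qh h : h * q h = 0.
  rewrite -cubeZ; last first.
    move=> t; apply: (@continuous_comp _ _ _ (fun t => (h, t)) F); last exact: cF.
    by apply: continuous_pair => {}t; [exact: cst_continuous|exact: cvg_id].
  under eq_cube do rewrite Fq -mulN1r.
  rewrite cubeD//; last by apply: continuousM_fun => //; exact: cst_continuous.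
  rewrite cubeZ//.
  have -> : cube_integral (fun t => f (t *m B + h *: v)) = cube_integral (fun t => f (t *m B)).
    rewrite -[RHS](@cube_shift _ _ _ (h *: v *m invmx B))//.
    - by apply: eq_cube => t; rewrite mulmxDl mulmxKV.
    - by move=> z x; rewrite periodic_mulmx.
  by rewrite mulN1r subrr.
have -> : cube_integral (fun t => 'D_v f (t *m B)) = q 0.
  apply: eq_cube => t; rewrite /F /G/= -[LHS]int01_cst; apply: eq_int01 => s.
  by rewrite scale0r scaler0 addr0.
have q0 : q h @[h --> 0^'] --> q 0.
  by apply: cvg_within_filter; exact: cq.
apply/esym/(cvg_unique _ _ q0) => //.
apply: (@cvg_trans _ ((cst 0) h @[h --> (0 : R)^'])); last exact: cvg_cst.
apply: near_eq_cvg; near=> h => /=.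
have h0 : h != 0 by near: h; exact: nbhs_dnbhs_neq.
by apply/esym/eqP; have /eqP := qh h; rewrite mulf_eq0 (negbTE h0).
Unshelve. all: by end_near. Qed.

Lemma mean_deriveC f v : smoothC f -> periodic L f -> mean (deriveC v f) = 0.
Proof.
move=> [f1 f2] pf; apply: eq_ReIm; apply: cube_integral_derive => //.
- by move=> l x Ll; rewrite pf.
- by move=> l x Ll; rewrite pf.
Qed.

Lemma chi_periodic u : dual L u -> periodic L (chi u).
Proof. by move=> du l x /du [k E]; rewrite chiDr {2}/chi E expi2pi mulr1. Qed.

Lemma dual_zspan (z : 'rV[int]_n) : dual L (intv R z *m (invmx B)^T).
Proof.
move=> _ [y _ <-]; exists ((y *m z^T) 0 0).
rewrite dotC dot_mulmx trmxK mulmxK// /dot.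
rewrite !mxE rmorph_sum/=; apply: eq_bigr => j _; by rewrite !mxE rmorphM.
Qed.

Lemma dualP (u : 'rV[R]_n) : dual L u -> exists z : 'rV[int]_n, u = intv R z *m (invmx B)^T.
Proof.
move=> du.
have dk j : exists k : int, (u *m B^T) 0 j = k%:~R.
  have [|k Ek] := du (row j B).
    exists (delta_mx 0 j) => //; rewrite rowE; congr (_ *m _).
    by apply/matrixP => a b; rewrite !mxE; case: eqP => //; case: eqP.
  exists k; rewrite -Ek mxE dotE; apply: eq_bigr => i _; by rewrite !mxE.
have [z Hz] := choice dk; exists (\row_j z j).
have -> : intv R (\row_j z j) = u *m B^T by apply/rowP => j; rewrite Hz [LHS]mxE mxE.
by rewrite -mulmxA -trmx_mul mulVmx// trmx1 mulmx1.
Qed.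

(** In the coordinates given by [B], the dual vectors are the integral vectors. *)
Lemma mean_fourier f : contC f -> periodic L f ->
  (forall u, dual L u -> mean (fun x => f x * chi u x) = 0) -> forall x, f x = 0.
Proof.
move=> cf pf f_orth x; rewrite -(mulmxKV Bu x).
apply: (@fourier_cube R n (fun t => f (t *m B))).
- exact: contC_mulmx.
- exact: periodic_mulmx.
move=> z; rewrite -[RHS](f_orth _ (dual_zspan z)); apply: eq_cubeC => t.
congr (_ * _); rewrite /chi dot_mulmx -mulmxA -trmx_mul mulmxV//.
by rewrite trmx1 mulmx1.
Qed.

(** The derivative of [chi u] in the direction [u] has mean zero, and it is a nonzero
  multiple of [chi u]. *)
Lemma mean_chi u : dual L u -> u != 0 -> mean (chi u) = 0.
Proof.
move=> du u0.
have := @mean_deriveC _ u (smoothC_chi u) (chi_periodic du).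
under eq_mean do rewrite deriveC_chi.
rewrite meanZ; last exact: contC_chi.
move/eqP; rewrite mulf_eq0 => /orP[|/eqP //].
rewrite eq_complex/= eqxx/= !mulf_eq0 pnatr_eq0/= (gt_eqF (@pi_gt0 R))/=.
by rewrite dot_eq0 (negbTE u0).
Qed.

End TorusMean.

(** * Increasing families of indices *)

Definition incr p m (f : 'I_p -> 'I_m) := 
  [forall k : 'I_p, forall l : 'I_p, (k < l)%N ==> (f k < f l)%N].

Lemma incrP p m (f : 'I_p -> 'I_m) :
  reflect (forall k l : 'I_p, (k < l)%N -> (f k < f l)%N) (incr f).
Proof.
apply: (iffP forallP) => [H k l kl|H k].
  by have /forallP /(_ l) /implyP := H k; apply.
by apply/forallP => l; apply/implyP; exact: H.
Qed.

Arguments incrP {p m f}.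

Lemma incr_inj p m (f : 'I_p -> 'I_m) : incr f -> injective f.
Proof.
move=> fi k l E; case: (ltngtP k l) => [kl|lk|]; last exact: val_inj.
- by have := incrP fi _ _ kl; rewrite E ltnn.
- by have := incrP fi _ _ lk; rewrite E ltnn.
Qed.

Lemma rearrangement (k l x y : nat) : (k < l)%N -> (y < x)%N ->
  (k * x + l * y < k * y + l * x)%N.
Proof.
move=> /subnKC <- /subnKC <-; move: (l - _)%N (x - _)%N => d e.
rewrite !(mulnDl, mulnDr, mulSn, mulnS); lia.
Qed.

(** Among the rearrangements of an injective [f], the one maximizing
  the sum of [k * f (s k)] is increasing. *)
Lemma sort_inj p m (f : 'I_p -> 'I_m) : injective f -> exists s : 'S_p, incr (f \o s).
Proof.
move=> fi; pose w (s : 'S_p) := (\sum_(k < p) k * f (s k))%N.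
have [s _ smax] := @arg_maxnP _ (1%g : 'S_p) xpredT w isT.
exists s; apply/incrP => k l kl /=; rewrite ltnNge leq_eqVlt negb_or.
have lk : l != k by rewrite neq_ltn kl orbT.
apply/andP; split; first by apply: contra_neq lk => /val_inj /fi /perm_inj.
apply/negP => fkl; have := smax (tperm k l * s)%g isT; apply/negP; rewrite -ltnNge.
rewrite /w (bigD1 k)//= (bigD1 l)//= [X in (_ < X)%N](bigD1 k)//= [X in (_ < _ + X)%N](bigD1 l)//=.
rewrite !permM tpermL tpermR !addnA.
rewrite [X in (_ < _ + X)%N](eq_bigr (fun i : 'I_p => i * f (s i)))%N; last first.
  by move=> i /andP[ik il]; rewrite permM tpermD// eq_sym.
by rewrite ltn_add2r rearrangement.
Qed.

(** Counting from 0, [k <= s k]; counting down from the last index, [s k <= k]. *)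
Lemma incr_ord_id p (s : 'I_p -> 'I_p) : incr s -> forall k, s k = k.
Proof.
move=> /incrP si.
have ge : forall m (k : 'I_p), k = m :> nat -> (m <= s k)%N.
  elim=> [//|m IH] k km; have mp : (m < p)%N by rewrite ltnW// -km.
  by apply: leq_ltn_trans (IH (Ordinal mp) erefl) _; apply: si; rewrite /= km.
have le : forall m (k : 'I_p), (k + m.+1)%N = p -> (s k <= k)%N.
  elim=> [|m IH] k km; first by have := ltn_ord (s k); rewrite -[X in (_ < X)%N -> _]km addn1.
  have kp : (k.+1 < p)%N by move: km; clear; lia.
  rewrite -ltnS; apply: leq_trans (IH (Ordinal kp) _); last by rewrite /= addSnnS.
  exact: si.
move=> k; apply/val_inj/eqP; rewrite eqn_leq (ge _ _ erefl) andbT.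
by apply: (le (p - k).-1); rewrite prednK ?subnKC ?subn_gt0// ltnW.
Qed.

(** An increasing family is determined by its set of values. *)
Lemma incr_factor p m (f g : 'I_p -> 'I_m) : incr f -> incr g ->
  (forall i, exists k, g i = f k) -> g =1 f.
Proof.
move=> fi gi gf; have [s Hs] := choice gf.
suff si : incr s by move=> i; rewrite Hs (incr_ord_id si).
apply/incrP => k l kl; rewrite ltnNge leq_eqVlt; apply/negP => /orP[/eqP /val_inj E|sl].
  by have := incrP gi k l kl; rewrite !Hs E ltnn.
have := incrP fi _ _ sl; rewrite -!Hs ltnNge => /negP; apply.
exact/ltnW/(incrP gi).
Qed.

(** * Alternating maps *)

Section AlternatingMaps.
Context {R : realType} {n : nat}.

Definition altmap p (a : 'M[R]_(p, n) -> R[i]) :=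
  multilinear_map a /\ alternating_map a.

Lemma row'_eqP m (A B : 'M[R]_(m, n)) k :
  (forall l, l != k -> row l A = row l B) -> row' k A = row' k B.
Proof.
move=> AB; apply/matrixP => i j; rewrite !mxE.
have ki : lift k i != k by rewrite eq_sym neq_lift.
by have /rowP /(_ j) := AB _ ki; rewrite !mxE.
Qed.

Section Rows.
Context {p : nat}.
Implicit Types (A : 'M[R]_(p, n)) (a : 'M[R]_(p, n) -> R[i]).

Definition set_row (k : 'I_p) (v : 'rV[R]_n) A : 'M[R]_(p, n) :=
  \matrix_(i, j) if i == k then v 0 j else A i j.

Lemma row_set_row k v A : row k (set_row k v A) = v.
Proof. by apply/rowP => j; rewrite !mxE eqxx. Qed.

Lemma row_set_row_neq k l v A : l != k -> row l (set_row k v A) = row l A.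
Proof. by move=> /negbTE lk; apply/rowP => j; rewrite !mxE lk. Qed.

Lemma set_row_row k A : set_row k (row k A) A = A.
Proof. by apply/matrixP => i j; rewrite !mxE; case: eqP => [->|]. Qed.

Lemma set_rowC k l u v A : k != l -> set_row k u (set_row l v A) = set_row l v (set_row k u A).
Proof.
by move=> kl; apply/matrixP => i j; rewrite !mxE; case: eqP => // ->; rewrite (negbTE kl).
Qed.

Lemma set_row_lin a k b c u v A : multilinear_map a ->
  a (set_row k (b *: u + c *: v) A) = b%:C * a (set_row k u A) + c%:C * a (set_row k v A).
Proof.
move=> am; apply: (am _ _ _ k); first by rewrite !row_set_row.
all: by apply: row'_eqP => l lk; rewrite !row_set_row_neq.
Qed.

Lemma set_row0 a k A : multilinear_map a -> a (set_row k 0 A) = 0.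
Proof.
move=> am; have := set_row_lin k 0 0 0 0 A am.
by rewrite !scale0r addr0 !mul0r addr0.
Qed.

Lemma set_rowD a k u v A : multilinear_map a ->
  a (set_row k (u + v) A) = a (set_row k u A) + a (set_row k v A).
Proof.
by move=> am; have := set_row_lin k 1 1 u v A am; rewrite !scale1r !mul1r.
Qed.

Lemma set_rowZ a k b u A : multilinear_map a ->
  a (set_row k (b *: u) A) = b%:C * a (set_row k u A).
Proof.
by move=> am; have := set_row_lin k b 0 u 0 A am; rewrite scaler0 addr0 mul0r addr0.
Qed.

Lemma set_row_sum a k I (r : seq I) (c : I -> R) (v : I -> 'rV[R]_n) A : multilinear_map a ->
  a (set_row k (\sum_(i <- r) c i *: v i) A) = \sum_(i <- r) (c i)%:C * a (set_row k (v i) A).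
Proof.
move=> am; elim: r => [|i r IH]; first by rewrite !big_nil set_row0.
by rewrite !big_cons set_rowD// set_rowZ// IH.
Qed.

(** Polarization: the map vanishes when rows [k] and [l] are both equal to the sum of
  the two given rows. *)
Lemma altmap_xrow a k l A : altmap a -> k != l -> a (xrow k l A) = - a A.
Proof.
move=> [am aa] kl; set u := row k A; set v := row l A.
have lk : l != k by rewrite eq_sym.
pose b x y := a (set_row k x (set_row l y A)).
have b0 x : b x x = 0.
  by apply: (aa _ k l kl); rewrite row_set_row row_set_row_neq// row_set_row.
have bD x : b (u + v) x = b u x + b v x by exact: set_rowD.
have bD' x : b x (u + v) = b x u + b x v.
  by rewrite /b !(set_rowC _ _ _ kl) set_rowD.
have -> : a (xrow k l A) = b v u.
  congr a; apply/matrixP => i j; rewrite mxE.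
  case: tpermP => [->|->|/eqP ik /eqP il]; rewrite !mxE.
  - by rewrite eqxx.
  - by rewrite (negbTE lk) eqxx.
  - by rewrite (negbTE ik) (negbTE il).
have -> : a A = b u v by rewrite /b set_rowC// !set_row_row.
by have := b0 (u + v); rewrite bD !bD' !b0 add0r addr0 addrC => /eqP; rewrite addr_eq0 => /eqP.
Qed.

Lemma altmap_row_perm a (s : 'S_p) A : altmap a -> a (row_perm s A) = (-1) ^+ s * a A.
Proof.
move=> aa; have [ts -> dts] := prod_tpermP s.
elim: ts dts => [_|t ts IH /= /andP[dt /IH E]].
  by rewrite big_nil row_perm1 odd_perm1 mul1r.
rewrite big_cons row_permM -[row_perm (tperm _ _) _]/(xrow _ _ _) altmap_xrow// E.
by rewrite odd_permM odd_tperm (dt : t.1 != t.2) signr_addb expr1 mulN1r mulNr.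
Qed.

End Rows.

(** The alternating map dx_(f 0) /\ .. /\ dx_(f (p - 1)). *)
Definition eps p (f : 'I_p -> 'I_n) (A : 'M[R]_(p, n)) : R[i] := (\det (colsub f A))%:C.

Lemma altmap_eps p (f : 'I_p -> 'I_n) (Q : 'M[R]_n) : altmap (fun A => eps f (A *m Q)).
Proof.
split=> [A B C k b c rA rB rC|A k l kl rkl].
- rewrite /eps -!rmorphM -rmorphD/=; congr (_%:C).
  apply: (@determinant_multilinear _ _ _ _ _ k).
  + apply/rowP => j; rewrite !mxE !mulr_sumr -big_split/=.
    apply: eq_bigr => i _; have /rowP /(_ i) := rA; rewrite !mxE => ->; ring.
  + apply/matrixP => i j; rewrite !mxE; apply: eq_bigr => l _.
    by have /matrixP /(_ i l) := rB; rewrite !mxE => ->.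
  + apply/matrixP => i j; rewrite !mxE; apply: eq_bigr => l _.
    by have /matrixP /(_ i l) := rC; rewrite !mxE => ->.
- rewrite /eps (determinant_alternate kl)// => j; rewrite !mxE.
  by apply: eq_bigr => i _; have /rowP /(_ i) := rkl; rewrite !mxE => ->.
Qed.

Lemma eps_basis p (f g : {ffun 'I_p -> 'I_n}) : incr f -> incr g ->
  eps f (rowsub g 1%:M) = (f == g)%:R.
Proof.
move=> fi gi; rewrite /eps; case: eqP => [<-|E].
  rewrite (_ : colsub _ _ = 1%:M) ?det1//.
  by apply/matrixP => i j; rewrite !mxE (inj_eq (incr_inj fi)).
have [i Hi] : exists i, forall k, g i != f k.
  apply: contrapT => /forallNP H; apply: E; apply/ffunP => i.
  apply/esym/(incr_factor fi gi) => {}i; apply: contrapT => /forallNP H2.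
  by apply: (H i) => k; apply/eqP; exact: H2.
rewrite (expand_det_row _ i) big1// => j _; rewrite !mxE.
by rewrite (negbTE (Hi j)) mul0r.
Qed.

Lemma rowsub_row_perm p (f : 'I_p -> 'I_n) (s : 'S_p) (P : 'M[R]_n) :
  rowsub (f \o s) P = row_perm s (rowsub f P).
Proof. by apply/matrixP => i j; rewrite !mxE. Qed.

(** Expanding every row in the basis formed by the rows of [P] reduces to the
  matrices [rowsub f P]. There [a] vanishes if [f] is not injective, and otherwise a
  permutation makes [f] increasing. *)
Lemma altmap_eq0 p (a : 'M[R]_(p, n) -> R[i]) (P : 'M[R]_n) : altmap a -> P \in unitmx ->
  (forall f : {ffun 'I_p -> 'I_n}, incr f -> a (rowsub f P) = 0) -> forall A, a A = 0.
Proof.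
move=> aalt Pu aP; have [am aa] := aalt.
have aP' (f : 'I_p -> 'I_n) : a (rowsub f P) = 0.
  have [/injectiveP fi|/injectivePn [k [l kl E]]] := boolP (injectiveb f).
    have [s fs] := sort_inj fi.
    have : a (rowsub (f \o s) P) = 0.
      rewrite -(@eq_rowsub _ _ _ _ (finfun (f \o s))) => [|i]; last by rewrite ffunE.
      by apply: aP; apply/incrP => k l kl; rewrite !ffunE; exact: (incrP fs).
    rewrite rowsub_row_perm altmap_row_perm// => /eqP.
    by rewrite mulf_eq0 signr_eq0 => /eqP.
  by apply: (aa _ k l kl); rewrite !row_rowsub E.
have key : forall m A, (forall i : 'I_p, (m <= i)%N -> exists j, row i A = row j P) -> a A = 0.
  elim=> [|m IH] A HA.
    have [f Hf] := choice (fun i => HA i (leq0n _)).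
    rewrite (_ : A = rowsub f P) ?aP'//; apply/row_matrixP => i.
    by rewrite Hf row_rowsub.
  have [mp|pm] := ltnP m p; last first.
    by apply: IH => i mi; have := leq_trans (ltn_ord i) (leq_trans pm mi); rewrite ltnn.
  pose k := Ordinal mp; rewrite -(set_row_row k A).
  have -> : row k A = \sum_j (row k A *m invmx P) 0 j *: row j P.
    by rewrite -mulmx_sum_row mulmxKV.
  rewrite set_row_sum// big1// => j _; rewrite IH ?mulr0// => i mi.
  have [->|ik] := eqVneq i k; first by exists j; rewrite row_set_row.
  rewrite row_set_row_neq//; apply: HA; rewrite ltn_neqAle mi andbT.
  by rewrite eq_sym.
by move=> A; apply: (key p) => i; rewrite leqNgt ltn_ord.
Qed.

Lemma altmapD p (a b : 'M[R]_(p, n) -> R[i]) : altmap a -> altmap b ->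
  altmap (fun A => a A + b A).
Proof.
move=> [am aa] [bm ba]; split=> [A B C k x y rA rB rC|A k l kl E].
  by rewrite (am A B C k x y)// (bm A B C k x y)//; ring.
by rewrite (aa A k l)// (ba A k l)// addr0.
Qed.

Lemma altmapZ p (c : R[i]) (a : 'M[R]_(p, n) -> R[i]) : altmap a ->
  altmap (fun A => c * a A).
Proof.
move=> [am aa]; split=> [A B C k x y rA rB rC|A k l kl E].
  by rewrite (am A B C k x y)//; ring.
by rewrite (aa A k l)// mulr0.
Qed.

Lemma altmap0 p : altmap (fun _ : 'M[R]_(p, n) => 0 : R[i]).
Proof. by split=> [A B C k b c _ _ _|]//; rewrite !mulr0 addr0. Qed.

Lemma altmap_sum p I (r : seq I) (P : pred I) (F : I -> 'M[R]_(p, n) -> R[i]) :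
  (forall i, P i -> altmap (F i)) -> altmap (fun A => \sum_(i <- r | P i) F i A).
Proof.
move=> aF; elim: r => [|i r IH].
  by under eq_fun do rewrite big_nil; exact: altmap0.
under eq_fun do rewrite big_cons.
by have [Pi|//] := boolP (P i); apply: altmapD => //; exact: aF.
Qed.

(** Both sides are alternating and agree on increasing families of rows of [P]. *)
Lemma altmap_expand p (a : 'M[R]_(p, n) -> R[i]) (P Q : 'M[R]_n) : altmap a ->
  P *m Q = 1%:M ->
  forall A, a A = \sum_(f : {ffun 'I_p -> 'I_n} | incr f) a (rowsub f P) * eps f (A *m Q).
Proof.
move=> aalt PQ A; apply/eqP; rewrite -subr_eq0; apply/eqP.
have Pu : P \in unitmx by have [] := mulmx1_unit PQ.
pose b A := a A - \sum_(f : {ffun 'I_p -> 'I_n} | incr f) a (rowsub f P) * eps f (A *m Q).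
rewrite -[LHS]/(b A); apply: (@altmap_eq0 _ b P) => // [|g gi].
  rewrite /b; under eq_fun do rewrite -mulN1r.
  apply: altmapD => //; apply: altmapZ; apply: altmap_sum => f _; apply: altmapZ.
  exact: altmap_eps.
rewrite /b; have -> : rowsub g P *m Q = rowsub g 1%:M by rewrite mul_rowsub_mx PQ.
rewrite (bigD1 g)//= big1 ?addr0 => [|f /andP[fi fg]].
  by rewrite eps_basis// eqxx mulr1 subrr.
by rewrite eps_basis// (negbTE fg) mulr0.
Qed.

End AlternatingMaps.

(** * Sums over increasing families *)

Section SumOverIncreasing.

(** An injective family is, in exactly one way, an increasing family composed with a
  permutation. *)
Lemma sum_incr (V : zmodType) p m (F : {ffun 'I_p -> 'I_m} -> V) :
  (forall f : {ffun 'I_p -> 'I_m}, ~~ injectiveb f -> F f = 0) ->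
  (forall (f : {ffun 'I_p -> 'I_m}) (s : 'S_p), F [ffun i => f (s i)] = F f) ->
  \sum_f F f = (\sum_(f : {ffun 'I_p -> 'I_m} | incr f) F f) *+ p`!.
Proof.
move=> F0 Fs.
pose h (u : {ffun 'I_p -> 'I_m} * 'S_p) := [ffun i => u.1 (u.2 i)] : {ffun 'I_p -> 'I_m}.
pose D := finset (fun u : {ffun 'I_p -> 'I_m} * 'S_p => incr u.1).
have hinj : {in D &, injective h}.
  move=> [f s] [g t]; rewrite !finset.in_set /= => fi gi /ffunP E.
  have fg : f = g.
    apply/ffunP; apply: (incr_factor gi fi) => i; exists (t (s^-1%g i)).
    by have := E (s^-1%g i); rewrite !ffunE /= permKV.
  congr pair => //; apply/permP => i; have := E i; rewrite !ffunE /= fg.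
  exact: (incr_inj gi).
transitivity (\sum_(f in h @: D) F f).
  rewrite [LHS](bigID (fun f => f \in h @: D))/=.
  rewrite [X in _ + X]big1 ?addr0// => f fh; apply: F0; apply/negP => /injectiveP finj.
  have [s fs] := sort_inj finj; move/negP: fh; apply; apply/imsetP.
  exists ([ffun i => f (s i)], s^-1%g).
    rewrite finset.in_set/=; apply/incrP => k l kl; rewrite /= !ffunE.
    by have := incrP fs k l kl.
  by apply/ffunP => i; rewrite !ffunE /= permKV.
rewrite (big_imset _ hinj)/=.
transitivity (\sum_(f : {ffun 'I_p -> 'I_m} | incr f) \sum_(s : 'S_p) F f).
  rewrite pair_big; apply: eq_big => [[f s]|[f s] _]; first by rewrite finset.in_set andbT.
  exact: Fs.
rewrite -sumrMnl; apply: eq_bigr => f _.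
by rewrite sumr_const -card_Sn cardE enumT.
Qed.

End SumOverIncreasing.

(** * Exterior and interior products *)

Section Exterior.
Context {R : realType} {n : nat}.

(** [u] stacked on top of [v]. The definition by [unlift] gives access to the rows
  through [ord0] and [lift ord0 k], in accordance with [row']. *)
Definition mcons p (u : 'rV[R]_n) (v : 'M[R]_(p, n)) : 'M[R]_(p.+1, n) :=
  \matrix_(i, j) if unlift ord0 i is Some k then v k j else u 0 j.

Lemma mcons0E p (u : 'rV[R]_n) (v : 'M[R]_(p, n)) j : mcons u v ord0 j = u 0 j.
Proof. by rewrite mxE unlift_none. Qed.

Lemma mconsSE p (u : 'rV[R]_n) (v : 'M[R]_(p, n)) k j : mcons u v (lift ord0 k) j = v k j.
Proof. by rewrite mxE liftK. Qed.

Lemma row0_mcons p (u : 'rV[R]_n) (v : 'M[R]_(p, n)) : row ord0 (mcons u v) = u.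
Proof. by apply/rowP => j; rewrite mxE mcons0E. Qed.

Lemma rowS_mcons p (u : 'rV[R]_n) (v : 'M[R]_(p, n)) k : row (lift ord0 k) (mcons u v) = row k v.
Proof. by apply/rowP => j; rewrite !mxE liftK. Qed.

Lemma row'0_mcons p (u : 'rV[R]_n) (v : 'M[R]_(p, n)) : row' ord0 (mcons u v) = v.
Proof. by apply/matrixP => i j; rewrite mxE mconsSE. Qed.

Lemma row'S_mcons p (u : 'rV[R]_n) (v : 'M[R]_(p.+1, n)) k :
  row' (lift ord0 k) (mcons u v) = mcons u (row' k v).
Proof.
apply/row_matrixP => i; rewrite [LHS]row_rowsub.
case: (unliftP ord0 i) => [i' ->|->].
- rewrite rowS_mcons row_rowsub -(rowS_mcons u v); congr (row _ _).
  by apply/val_inj; rewrite /= /bump; lia.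
- rewrite row0_mcons -[RHS](row0_mcons u v); congr (row _ _); exact/val_inj.
Qed.

Lemma altmap_mcons p u (a : 'M[R]_(p.+1, n) -> R[i]) : altmap a ->
  altmap (fun v => a (mcons u v)).
Proof.
move=> [am aa]; split=> [A B C k b c rA rB rC|A k l kl rkl].
- apply: (am _ _ _ (lift ord0 k)); first by rewrite !rowS_mcons.
  + case: p a am aa A B C k rA rB rC => [a _ _ A B C []//|p a am aa A B C k rA rB rC].
    by rewrite !row'S_mcons rB.
  + case: p a am aa A B C k rA rB rC => [a _ _ A B C []//|p a am aa A B C k rA rB rC].
    by rewrite !row'S_mcons rC.
- by apply: (aa _ (lift ord0 k) (lift ord0 l)); rewrite ?(inj_eq (@lift_inj _ _))// !rowS_mcons.
Qed.

(** The alternating map [sum_j dx_j /\ a j]. *)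
Definition wedge p (a : 'I_n -> 'M[R]_(p, n) -> R[i]) (v : 'M[R]_(p.+1, n)) : R[i] :=
  \sum_(k < p.+1) (-1) ^+ k * \sum_j (v k j)%:C * a j (row' k v).

Definition fcons p (j : 'I_n) (f : 'I_p -> 'I_n) (k : 'I_p.+1) : 'I_n :=
  if unlift ord0 k is Some l then f l else j.

Lemma det_col0 p (M : 'M[R]_p.+1) :
  \det M = \sum_(k < p.+1) (-1) ^+ k * (M k ord0 * \det (row' k (col' ord0 M))).
Proof.
by rewrite (expand_det_col _ ord0); apply: eq_bigr => k _; rewrite /cofactor addn0 mulrCA.
Qed.

Lemma eps_fcons p j (f : 'I_p -> 'I_n) (v : 'M[R]_(p.+1, n)) :
  eps (fcons j f) v = \sum_(k < p.+1) (-1) ^+ k * ((v k j)%:C * eps f (row' k v)).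
Proof.
rewrite /eps det_col0 rmorph_sum/=; apply: eq_bigr => k _.
rewrite !rmorphM rmorph_sign/=; congr (_ * (_ * _)).
- by rewrite mxE /fcons unlift_none.
- congr ((\det _)%:C); apply/matrixP => i l; rewrite !mxE; congr (v _ _).
  by rewrite /fcons liftK.
Qed.

(** If [a j] is a combination of the maps [eps f], then [wedge a] is a combination
  of the maps [eps (fcons j f)], by Laplace expansion along the first column. *)
Lemma altmap_wedge p (a : 'I_n -> 'M[R]_(p, n) -> R[i]) : (forall j, altmap (a j)) ->
  altmap (wedge a).
Proof.
move=> aa.
have -> : wedge a = fun v => \sum_j \sum_(f : {ffun 'I_p -> 'I_n} | incr f)
    a j (rowsub f 1%:M) * eps (fcons j f) (v *m 1%:M).
  apply/funext => v; rewrite /wedge.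
  under eq_bigr do rewrite mulr_sumr; rewrite exchange_big/=; apply: eq_bigr => j _.
  transitivity (\sum_(k < p.+1) \sum_(f : {ffun 'I_p -> 'I_n} | incr f)
    a j (rowsub f 1%:M) * ((-1) ^+ k * ((v k j)%:C * eps f (row' k v)))).
    apply: eq_bigr => k _.
    rewrite [in LHS](@altmap_expand _ _ _ (a j) 1%:M 1%:M (aa j)) ?mulmx1// !mulr_sumr.
    by apply: eq_bigr => f _; rewrite ?mulmx1; ring.
  rewrite exchange_big/=; apply: eq_bigr => f _.
  by rewrite mulmx1 eps_fcons mulr_sumr.
apply: altmap_sum => j _; apply: altmap_sum => f _; apply: altmapZ.
exact: altmap_eps.
Qed.

(** The exterior product of the covector [dot xi] with [a]. *)
Definition wedge1 p (xi : 'rV[R]_n) (a : 'M[R]_(p, n) -> R[i]) (v : 'M[R]_(p.+1, n)) : R[i] :=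
  \sum_(k < p.+1) (-1) ^+ k * ((dot xi (row k v))%:C * a (row' k v)).

(** [xi /\ (xi _| a)]. Up to the factor [dot xi xi], this is the orthogonal projection of
  [a] onto the covectors divisible by [dot xi]. *)
Definition parallel p (xi : 'rV[R]_n) (a : 'M[R]_(p.+1, n) -> R[i]) : 'M[R]_(p.+1, n) -> R[i] :=
  wedge1 xi (fun v => a (mcons xi v)).

Lemma wedge1_mcons p (xi : 'rV[R]_n) (a : 'M[R]_(p.+1, n) -> R[i]) v :
  wedge1 xi a (mcons xi v) = (dot xi xi)%:C * a v - parallel xi a v.
Proof.
rewrite /wedge1 big_ord_recl expr0 mul1r row0_mcons row'0_mcons; congr (_ + _).
rewrite /parallel /wedge1 -sumrN; apply: eq_bigr => k _.
by rewrite rowS_mcons row'S_mcons /= /bump/= add1n exprS mulN1r mulNr.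
Qed.

(** Column [j0] of [Q] is a covector parallel to [xi]. A monomial in the columns of [Q]
  is annihilated by the interior product with [xi] unless it contains that column. If
  it does, its determinant is expanded along the row
  [xi *m Q], which has one nonzero entry, and the sum defining [parallel] is then the
  expansion of a determinant along the first column. *)
Lemma parallel_eps p (f : 'I_p.+1 -> 'I_n) (j0 : 'I_n) (Q : 'M[R]_n) (xi : 'rV[R]_n) (c : R) :
  incr f -> (forall j : 'I_n, (j0 <= j)%N) -> xi *m Q = c *: delta_mx 0 j0 ->
  (forall v, dot xi v = c * (v *m Q) 0 j0) ->
  forall v, parallel xi (fun A => eps f (A *m Q)) v =
    (f ord0 == j0)%:R * ((c ^+ 2)%:C * eps f (v *m Q)).
Proof.
move=> fi j0min xiQ dotQ v.
have f0 k : f k = j0 -> k = ord0.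
  move=> fk; have [//|] := eqVneq k ord0; rewrite -val_eqE /= -lt0n => k0.
  by have := incrP fi ord0 k k0; rewrite fk ltnNge j0min.
have mQ (w : 'M[R]_(p, n)) : mcons xi w *m Q = mcons (c *: delta_mx 0 j0) (w *m Q).
  apply/row_matrixP => i; rewrite row_mul; case: (unliftP ord0 i) => [k ->|->].
  - by rewrite !rowS_mcons row_mul.
  - by rewrite !row0_mcons.
rewrite /parallel /wedge1; have [E|NE] := eqVneq (f ord0) j0; last first.
  rewrite mul0r big1// => k _; rewrite mQ /eps (expand_det_row _ ord0) big1 ?mulr0// => l _.
  rewrite mxE mcons0E !mxE eqxx/=; case: eqP => [H|]; last by rewrite mulr0 mul0r.
  by case/eqP: NE; rewrite -(f0 _ H).
rewrite mul1r /eps [in RHS]det_col0 -rmorphM/= mulr_sumr rmorph_sum/=.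
apply: eq_bigr => k _; rewrite -!rmorphM -(rmorph_sign (real_complex R)) -rmorphM/=; congr (_%:C).
rewrite mQ (expand_det_row _ ord0) (bigD1 ord0)//= big1 ?addr0 => [|l l0]; last first.
  rewrite mxE mcons0E !mxE eqxx/=; case: eqP => [H|]; last by rewrite mulr0 mul0r.
  by rewrite (f0 _ H) eqxx in l0.
rewrite mxE mcons0E !mxE eqxx E eqxx/= mulr1 /cofactor addn0 expr0 mul1r.
rewrite dotQ -row_mul mxE.
rewrite (_ : row' ord0 (col' ord0 (colsub f (mcons (c *: delta_mx 0 j0) (row' k v *m Q)))) =
  row' k (col' ord0 (colsub f (v *m Q)))); last first.
  apply/matrixP => i j; rewrite [LHS]mxE [LHS]mxE [LHS]mxE mconsSE !mxE.
  by apply: eq_bigr => l _; rewrite mxE.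
by rewrite !mxE; ring.
Qed.

(** Reflect in the hyperplane that exchanges the coordinate vector [delta_mx 0 j0] with
  the unit vector in the direction of [xi], if there is one and the two differ. *)
Lemma householder (j0 : 'I_n) (xi : 'rV[R]_n) : exists (Q : 'M[R]_n) (c : R),
  [/\ Q *m Q = 1%:M, xi *m Q = c *: delta_mx 0 j0,
      (forall v, dot xi v = c * (v *m Q) 0 j0) & c ^+ 2 = dot xi xi].
Proof.
have dotd (v : 'rV[R]_n) : dot (delta_mx 0 j0) v = v 0 j0.
  rewrite dotE (bigD1 j0)//= big1 ?addr0 => [|j jj0]; first by rewrite mxE !eqxx mul1r.
  by rewrite mxE (negbTE jj0) andbF mul0r.
have [->|xi0] := eqVneq xi 0.
  exists 1%:M, 0; rewrite !mulmx1 scale0r expr0n dot0l; split=> // v.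
  by rewrite dot0l mul0r.
pose c := Num.sqrt (dot xi xi).
have c2 : c ^+ 2 = dot xi xi by rewrite sqr_sqrtr// dot_ge0.
have c0 : c != 0 by rewrite -sqrf_eq0 c2 dot_eq0.
pose u := c^-1 *: xi; have xiu : xi = c *: u by rewrite scalerA divff// scale1r.
have uu : dot u u = 1 by rewrite dotZl dotZr -c2; field.
pose e : 'rV[R]_n := delta_mx 0 j0; have ee : dot e e = 1 by rewrite dotd mxE !eqxx.
suff [Q [QQ uQ uv]] : exists Q : 'M[R]_n,
    [/\ Q *m Q = 1%:M, u *m Q = e & forall v, dot u v = (v *m Q) 0 j0].
  exists Q, c; split=> //; first by rewrite xiu -scalemxAl uQ.
  by move=> v; rewrite xiu dotZl uv.
pose w := u - e.
have [/eqP|w0] := eqVneq w 0.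
  rewrite subr_eq0 => /eqP ue; exists 1%:M; rewrite !mulmx1; split=> // v.
  by rewrite ue dotd mulmx1.
have ww0 : dot w w != 0 by rewrite dot_eq0.
pose Q := 1%:M - (2 / dot w w) *: (w^T *m w).
have vQ v : v *m Q = v - (2 * dot v w / dot w w) *: w.
  rewrite /Q mulmxBr mulmx1 -scalemxAr mulmxA [v *m w^T]mx11_scalar mul_scalar_mx scalerA.
  by congr (_ - _ *: _); rewrite -/(dot v w); ring.
have wwE : dot w w = 2 - 2 * dot u e.
  by rewrite {1}/w dotDl dotNl dotC [X in _ - X]dotC !dotDl !dotNl uu ee (dotC e u); ring.
have uwE : 2 * dot u w = dot w w.
  by rewrite wwE dotC dotDl dotNl uu (dotC e); ring.
have uQ : u *m Q = e.
  by rewrite vQ uwE divff// scale1r /w opprB addrCA subrr addr0.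
have wQ : w *m Q = - w.
  by rewrite vQ mulfK// scaler_nat mulr2n opprD addNKr.
have QQv (v : 'rV[R]_n) : v *m Q *m Q = v.
  by rewrite [X in X *m Q]vQ mulmxBl -scalemxAl wQ scalerN opprK vQ subrK.
have QT : Q^T = Q by rewrite /Q linearB linearZ/= trmx1 trmx_mul trmxK.
exists Q; split=> //.
  by apply/row_matrixP => i; rewrite !rowE mulmxA QQv mulmx1.
by move=> v; rewrite -dotd dot_mulmx QT -/e -uQ QQv.
Qed.

End Exterior.

(** * Counting increasing families *)

Section CountIncreasing.

(** By [sum_incr] applied to the indicator function of injectivity, the number of
  injective families is [p`!] times the number of increasing ones. *)
Lemma card_incr p m : #|finset (fun f : {ffun 'I_p -> 'I_m} => incr f)| = 'C(m, p).
Proof.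
pose F (f : {ffun 'I_p -> 'I_m}) : int := if injectiveb f then 1 else 0.
have := @sum_incr int p m F.
have -> : \sum_f F f = (m ^_ p)%:R.
  have <- : #|finset (fun f : {ffun 'I_p -> 'I_m} => injectiveb f)| = (m ^_ p)%N.
    by rewrite card_inj_ffuns !card_ord.
  rewrite -big_mkcond/= -sumr_const.
  by apply: eq_bigl => f; rewrite finset.in_set.
have -> : \sum_(f : {ffun 'I_p -> 'I_m} | incr f) F f =
    #|finset (fun f : {ffun 'I_p -> 'I_m} => incr f)|%:R.
  rewrite -sumr_const; apply: eq_big => [f|f fi]; first by rewrite finset.in_set.
  by rewrite /F; case: ifPn => // /injectiveP; case; exact: incr_inj.
rewrite -mulrnA -bin_ffact => H; apply/eqP; rewrite eq_sym -(eqn_pmul2r (fact_gt0 p)).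
rewrite -(eqr_nat int) H// => [f|f s]; first by rewrite /F => /negbTE ->.
rewrite /F; congr (if _ then _ else _); apply/injectiveP/injectiveP => fi k l E.
  by apply: (@perm_inj _ s^-1%g); apply: fi; rewrite !ffunE !permKV.
by move: E; rewrite !ffunE => /fi /perm_inj.
Qed.

(** An increasing family avoids [ord0] if and only if it does not start with it; such a
  family comes from one with values in ['I_m]. *)
Lemma card_incr_pos q m :
  #|finset (fun f : {ffun 'I_q.+1 -> 'I_m.+1} => incr f && (f ord0 != ord0))| = 'C(m, q.+1).
Proof.
rewrite -card_incr.
pose h (g : {ffun 'I_q.+1 -> 'I_m}) := [ffun i => lift ord0 (g i)] : {ffun 'I_q.+1 -> 'I_m.+1}.
have hinj : injective h.
  by move=> g g' /ffunP E; apply/ffunP => i; have := E i; rewrite !ffunE => /lift_inj.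
rewrite -(card_imset _ hinj); apply: eq_card => f; rewrite finset.in_set.
apply/idP/imsetP => [/andP[fi f0]|[g gi ->]].
  have fpos i : ord0 != f i.
    rewrite -val_eqE /= eq_sym -lt0n; have [->|i0] := eqVneq i ord0.
      by rewrite lt0n; move: f0; rewrite -val_eqE.
    apply: leq_ltn_trans (leq0n (f ord0)) _; apply: (incrP fi).
    by rewrite lt0n; move: i0; rewrite -val_eqE.
  have fE i : exists j, f i = lift ord0 j by have [j ->] := unlift_some (fpos i); exists j.
  have [g Hg] := choice fE; exists (finfun g); last by apply/ffunP => i; rewrite !ffunE.
  rewrite finset.in_set; apply/incrP => k l kl; rewrite !ffunE.
  by have := incrP fi k l kl; rewrite !Hg.
rewrite ffunE eq_sym neq_lift andbT; apply/incrP => k l kl; rewrite !ffunE /= /bump/= !add1n ltnS.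
by move: gi; rewrite finset.in_set => /incrP; apply.
Qed.

Lemma card_incr_zero q m :
  #|finset (fun f : {ffun 'I_q.+1 -> 'I_m.+1} => incr f && (f ord0 == ord0))| = 'C(m, q).
Proof.
apply/eqP; rewrite -(eqn_add2l 'C(m, q.+1)) -binS -card_incr_pos -card_incr.
rewrite addnC -(cardsID (finset (fun f : {ffun 'I_q.+1 -> 'I_m.+1} => f ord0 == ord0))
  (finset (fun f : {ffun 'I_q.+1 -> 'I_m.+1} => incr f))); apply/eqP; congr (_ + _)%N; apply: eq_card => f;
  by rewrite !finset.in_set// andbC.
Qed.

End CountIncreasing.

(** * Forms on a flat torus *)

Section FlatForms.
Context {R : realType} {n : nat} (B : 'M[R]_n).
Hypothesis Bu : B \in unitmx.
Local Notation L := (zspan B).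

Lemma formsP p (w : pform R n p) : forms L w <->
  [/\ forall x, altmap (w x), forall v, smoothC (fun x => w x v) & periodic L w].
Proof.
split=> [[w1 w2 w3 w4]|[w1 w2 w3]].
- by split=> // x; split.
- by split=> // x; case: (w1 x).
Qed.

Definition partial p (w : pform R n p) (u : 'rV[R]_n) : pform R n p :=
  fun x v => deriveC u (fun y => w y v) x.

Lemma forms_partial p (w : pform R n p) u : forms L w -> forms L (partial w u).
Proof.
move=> /formsP[wa ws wp]; apply/formsP; split=> [x|v|l x Ll].
- split=> [M C D k b c rM rC rD|M k l kl rkl]; rewrite /partial.
  + have -> : (fun y => w y M) = (fun y => b%:C * w y C + c%:C * w y D).
      by apply/funext => y; have [wm _] := wa y; exact: (wm M C D k b c).
    rewrite deriveCD; [|apply: smoothCM => //; exact: smoothC_cst..].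
    by rewrite !deriveCZ.
  + have -> : (fun y => w y M) = (fun y => 0).
      by apply/funext => y; have [_ wal] := wa y; exact: (wal M k l).
    exact: deriveC_cst.
- exact: smoothC_deriveC.
- apply/funext => v; rewrite /partial (deriveC_periodic (l := l))// => y.
  by rewrite wp.
Qed.

Lemma ext_derE p (w : pform R n p) : forms L w ->
  ext_der w = fun x => wedge (fun j => partial w (delta_mx 0 j) x).
Proof.
move=> /formsP[_ ws _]; apply/funext => x; apply/funext => v.
rewrite /ext_der /wedge; apply: eq_bigr => k _; congr (_ * _).
by rewrite deriveC_partials//; apply: eq_bigr => j _; rewrite mxE.
Qed.

Lemma forms_ext_der p (w : pform R n p) : forms L w -> forms L (ext_der w).
Proof.
move=> fw; have dw u := forms_partial u fw.
apply/formsP; rewrite ext_derE//; split=> [x|v|l x Ll].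
- by apply: altmap_wedge => j; have /formsP[] := dw (delta_mx 0 j).
- apply: smoothC_sum => k _; apply: smoothCM; first exact: smoothC_cst.
  apply: smoothC_sum => j _; apply: smoothCM; first exact: smoothC_cst.
  by have /formsP[] := dw (delta_mx 0 j).
- congr wedge; apply/funext => j; have /formsP[_ _ H] := dw (delta_mx 0 j).
  exact: H.
Qed.

(** The flat codifferential, minus the divergence in the first argument. *)
Definition cod p (w : pform R n p.+1) : pform R n p :=
  fun x v => - \sum_j partial w (delta_mx 0 j) x (mcons (delta_mx 0 j) v).

Lemma forms_cod p (w : pform R n p.+1) : forms L w -> forms L (cod w).
Proof.
move=> fw; have dw u := forms_partial u fw.
apply/formsP; split=> [x|v|l x Ll].
- rewrite /cod; under eq_fun do rewrite -mulN1r.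
  apply: altmapZ; apply: altmap_sum => j _; apply: altmap_mcons.
  by have /formsP[] := dw (delta_mx 0 j).
- apply: smoothCN; apply: smoothC_sum => j _.
  by have /formsP[_ H _] := dw (delta_mx 0 j); exact: H.
- apply/funext => v; rewrite /cod; congr (- _); apply: eq_bigr => j _.
  by have /formsP[_ _ H] := dw (delta_mx 0 j); rewrite H.
Qed.

Lemma formsZ p (a : R[i]) (w : pform R n p) : forms L w -> forms L (a *: w : pform R n p).
Proof.
move=> /formsP[wa ws wp]; apply/formsP; split=> [x|v|l x Ll].
- exact: altmapZ.
- by apply: smoothCM => //; exact: smoothC_cst.
- by apply/funext => v; rewrite !fctE wp.
Qed.

Lemma formsD p (w w' : pform R n p) : forms L w -> forms L w' ->
  forms L (w + w' : pform R n p).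
Proof.
move=> /formsP[wa ws wp] /formsP[wa' ws' wp']; apply/formsP; split=> [x|v|l x Ll].
- exact: altmapD.
- exact: smoothCD.
- by apply/funext => v; rewrite !fctE wp// wp'.
Qed.

Lemma forms0 p : forms L (0 : pform R n p).
Proof.
by apply/formsP; split=> [x|v|l x Ll]//; [exact: altmap0|exact: smoothC_cst].
Qed.

Lemma forms_sum p I (r : seq I) (P : pred I) (F : I -> pform R n p) :
  (forall i, P i -> forms L (F i)) -> forms L (\sum_(i <- r | P i) F i : pform R n p).
Proof. by move=> fF; elim/big_ind: _ => //; [exact: forms0|exact: formsD]. Qed.

Lemma contC_form p (w : pform R n p) v : forms L w -> contC (fun x => w x v).
Proof. by move=> /formsP[_ ws _]; exact: smoothC_contC. Qed.

Local Notation mean := (mean B).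

(** The derivative of [f * conjc g] has mean zero. *)
Lemma mean_by_parts (f g : 'rV[R]_n -> R[i]) u :
  smoothC f -> smoothC g -> periodic L f -> periodic L g ->
  mean (fun x => deriveC u f x * conjc (g x)) = mean (fun x => f x * conjc (- deriveC u g x)).
Proof.
move=> sf sg pf pg.
have sgc : smoothC (fun x => conjc (g x)) by exact: smoothC_conj.
have sfg : smoothC (fun x => f x * conjc (g x)) by exact: smoothCM.
have := @mean_deriveC _ _ _ Bu _ u sfg _.
have E x : deriveC u (fun x => f x * conjc (g x)) x =
    deriveC u f x * conjc (g x) + (-1) * (f x * conjc (- deriveC u g x)).
  rewrite deriveCM// deriveC_conj// rmorphN mulrN mulN1r opprK; ring.
rewrite (eq_mean B E) meanD; last 2 first.
- by apply: smoothC_contC; apply: smoothCM => //; exact: smoothC_deriveC.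
- apply: contCM; first exact: contC_cst.
  apply: smoothC_contC; apply: smoothCM => //; apply: smoothC_conj.
  exact/smoothCN/smoothC_deriveC.
rewrite meanZ; last first.
  apply: smoothC_contC; apply: smoothCM => //; apply: smoothC_conj.
  exact/smoothCN/smoothC_deriveC.
move=> H; apply/eqP; rewrite -subr_eq0 -mulN1r; apply/eqP; apply: H.
by move=> l x Ll; rewrite pf// pg.
Qed.

Lemma covector_dotE p (a b : 'M[R]_(p, n) -> R[i]) : altmap a -> altmap b ->
  \sum_(f : {ffun 'I_p -> 'I_n}) a (rowsub f 1%:M) * conjc (b (rowsub f 1%:M)) =
  covector_dot a b *+ p`!.
Proof.
move=> aa ba; apply: sum_incr => [f /injectivePn[k [l kl E]]|f s].
  have [_ aalt] := aa; rewrite (aalt _ k l) ?mul0r//.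
  by rewrite !row_rowsub E.
have -> : rowsub [ffun i => f (s i)] 1%:M = row_perm s (rowsub f 1%:M) :> 'M[R]_(p, n).
  by apply/matrixP => i j; rewrite !mxE ffunE.
rewrite !altmap_row_perm// rmorphM rmorph_sign mulrACA -signr_addb addbb.
by rewrite mul1r.
Qed.

(** Moving row [k] to the top is a cyclic permutation of [k + 1] rows. *)
Lemma altmap_cycle p (a : 'M[R]_(p.+1, n) -> R[i]) (k : 'I_p.+1) M : altmap a ->
  a M = (-1) ^+ k * a (mcons (row k M) (row' k M)).
Proof.
move=> aa; pose s := lift_perm ord0 k (1%g : 'S_p).
have -> : mcons (row k M) (row' k M) = row_perm s M.
  apply/row_matrixP => i; case: (unliftP ord0 i) => [i' ->|->].
  - by rewrite rowS_mcons; apply/rowP => j; rewrite !mxE lift_perm_lift perm1.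
  - by rewrite row0_mcons; apply/rowP => j; rewrite !mxE lift_perm_id.
rewrite altmap_row_perm// odd_lift_perm/= odd_perm1 addbF signr_odd mulrA.
by rewrite -exprD addnn -signr_odd odd_double mul1r.
Qed.

Lemma sum_ffunS p (k : 'I_p.+1) (V : zmodType) (G : 'I_n -> {ffun 'I_p -> 'I_n} -> V) :
  \sum_(f : {ffun 'I_p.+1 -> 'I_n}) G (f k) [ffun i => f (lift k i)] =
  \sum_j \sum_(g : {ffun 'I_p -> 'I_n}) G j g.
Proof.
rewrite pair_big /=; symmetry.
pose h (u : 'I_n * {ffun 'I_p -> 'I_n}) : {ffun 'I_p.+1 -> 'I_n} :=
  [ffun i => if unlift k i is Some l then u.2 l else u.1].
rewrite [RHS](reindex h)/=.
  apply: eq_bigr => [[j g] _]; rewrite /h ffunE unlift_none /=; congr (G _ _).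
  by apply/ffunP => i; rewrite !ffunE liftK.
exists (fun f : {ffun 'I_p.+1 -> 'I_n} => (f k, [ffun i => f (lift k i)])) => [[j g] _|f _] /=.
- rewrite /h ffunE unlift_none /=; congr pair; by apply/ffunP => i; rewrite !ffunE liftK.
- by apply/ffunP => i; rewrite ffunE /=; case: unliftP => [l ->|->//]; rewrite ffunE.
Qed.

(** Multiplied by [p.+1`!], the left-hand side becomes a sum over all families [f] of
  indices and all positions [k], where the derivative in the direction [f k] is moved
  to [w] by parts. Moving row [k] of the argument of [w] to the top cancels the sign
  of the exterior derivative, so that every [k] contributes the same sum, over an
  index [j] and a family of [p] indices, which is [p`!] times the right-hand side. *)
Lemma ext_der_adjoint p (theta : pform R n p) (w : pform R n p.+1) :
  forms L theta -> forms L w ->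
  mean (fun x => covector_dot (ext_der theta x) (w x)) =
  mean (fun x => covector_dot (theta x) (cod w x)).
Proof.
move=> fth fw; have fdth := forms_ext_der fth; have fcw := forms_cod fw.
have cpair q (a b : pform R n q) (g : {ffun 'I_q -> 'I_n}) : forms L a -> forms L b ->
    contC (fun x => a x (rowsub g 1%:M) * conjc (b x (rowsub g 1%:M))).
  by move=> fa fb; apply: contCM; [|apply: contC_conj]; exact: contC_form.
have ccov q (a b : pform R n q) : forms L a -> forms L b ->
    contC (fun x => covector_dot (a x) (b x)).
  by move=> fa fb; apply: contC_sum => g _; exact: cpair.
have meanE q (a b : pform R n q) : forms L a -> forms L b ->
    mean (fun x => covector_dot (a x) (b x)) *+ q`! =
    \sum_(f : {ffun 'I_q -> 'I_n})
      mean (fun x => a x (rowsub f 1%:M) * conjc (b x (rowsub f 1%:M))).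
  move=> fa fb; rewrite -mulr_natl -meanZ; last exact: ccov.
  rewrite -mean_sum => [|g _]; last exact: cpair.
  apply: eq_mean => x; rewrite mulr_natl -covector_dotE//.
  - by have /formsP[] := fa.
  - by have /formsP[] := fb.
have nz q : (q`!%:R : R[i]) != 0 by rewrite pnatr_eq0 -lt0n fact_gt0.
apply: (mulfI (nz p.+1)); rewrite !mulr_natl meanE//.
rewrite factS mulnC mulrnA meanE//.
have /formsP[_ ths thp] := fth; have /formsP[wa ws wp] := fw.
pose T (j : 'I_n) (g : {ffun 'I_p -> 'I_n}) := mean (fun x => theta x (rowsub g 1%:M) *
  conjc (- partial w (delta_mx 0 j) x (mcons (delta_mx 0 j) (rowsub g 1%:M)))).
have rhsE : \sum_(f : {ffun 'I_p -> 'I_n})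
    mean (fun x => theta x (rowsub f 1%:M) * conjc (cod w x (rowsub f 1%:M))) =
    \sum_j \sum_(g : {ffun 'I_p -> 'I_n}) T j g.
  rewrite exchange_big/=; apply: eq_bigr => g _; rewrite -mean_sum => [|j _]; last first.
    apply: contCM; first exact: contC_form.
    apply: contC_conj; apply: smoothC_contC; apply: smoothCN.
    by have /formsP[_ H _] := forms_partial (delta_mx 0 j) fw; exact: H.
  by apply: eq_mean => x; rewrite -mulr_sumr -rmorph_sum sumrN.
rewrite rhsE.
transitivity (\sum_(k < p.+1) \sum_j \sum_(g : {ffun 'I_p -> 'I_n}) T j g); last first.
  by rewrite sumr_const card_ord.
under [RHS]eq_bigr => k _ do rewrite -(sum_ffunS k T).
rewrite exchange_big/=; apply: eq_bigr => f _.
have rowE1 (k : 'I_p.+1) : row k (rowsub f 1%:M) = delta_mx 0 (f k) :> 'rV[R]_n.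
  by rewrite row_rowsub rowE mulmx1.
have row'E1 (k : 'I_p.+1) :
    row' k (rowsub f 1%:M) = rowsub [ffun i => f (lift k i)] 1%:M :> 'M[R]_(p, n).
  by apply/matrixP => i j; rewrite !mxE ffunE.
under eq_mean do rewrite mulr_suml.
rewrite mean_sum => [|k _]; last first.
  apply: smoothC_contC; apply: smoothCM; last exact: smoothC_conj.
  by apply: smoothCM; [exact: smoothC_cst|exact: smoothC_deriveC].
apply: eq_bigr => k _; rewrite rowE1 row'E1 /T -mean_by_parts; last 4 first.
- exact: ths.
- exact: ws.
- by move=> l x Ll; rewrite thp.
- by move=> l x Ll; rewrite wp.
apply: eq_mean => x; rewrite (altmap_cycle k (rowsub f 1%:M) (wa x)) rowE1 row'E1.
rewrite rmorphM rmorph_sign/= mulrACA -signr_odd -signr_addb addbb.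
by rewrite mul1r.
Qed.

Lemma covector_dotBr p (a b c : 'M[R]_(p, n) -> R[i]) :
  covector_dot a (fun v => b v - c v) = covector_dot a b - covector_dot a c.
Proof.
rewrite /covector_dot -sumrB; apply: eq_bigr => f _.
by rewrite rmorphB mulrBr.
Qed.

Lemma formsB p (w w' : pform R n p) : forms L w -> forms L w' ->
  forms L (w - w' : pform R n p).
Proof.
by move=> fw fw'; rewrite -scaleN1r; apply: formsD => //; exact: formsZ.
Qed.

Lemma covector_dot_definite p (w : pform R n p) : forms L w ->
  mean (fun x => covector_dot (w x) (w x)) = 0 -> w = 0.
Proof.
move=> fw mw; have /formsP[wa ws wp] := fw.
have c0 : forall x, covector_dot (w x) (w x) = 0.
  apply: (@mean_ge0_eq0 _ _ _ Bu) => //.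
  - apply: contC_sum => f _; apply: contCM; [|apply: contC_conj]; exact: contC_form.
  - by move=> l x Ll; rewrite wp.
  - by move=> x; apply: sumr_ge0 => f _; exact: mulcJ_ge0.
apply/funext => x; apply/funext => v.
apply: (altmap_eq0 (wa x) (unitmx1 _ _)) => f fi.
have := c0 x; rewrite /covector_dot => /eqP; rewrite psumr_eq0 => [|g _]; last exact: mulcJ_ge0.
move=> /allP /(_ f (mem_index_enum f)) /implyP /(_ fi).
by rewrite mulf_eq0 conjc_eq0 orbb => /eqP.
Qed.

End FlatForms.

(** * The codifferential *)

Section Codifferential.
Context {R : realType} {n : nat} (L : set 'rV[R]_n).
Hypothesis hL : is_lattice L.
Local Notation B := (lattice_basis L).

Lemma lattice_basisP : B \in unitmx /\ L = zspan B.
Proof.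
have [B0 B0u LE] := hL.
by apply: (@xgetPex _ 1%:M [set B | B \in unitmx /\ L = zspan B]); exists B0.
Qed.

Lemma L2_dotE p (w eta : pform R n p) :
  L2_dot L w eta = `|\det B|%:C * mean B (fun x => covector_dot (w x) (eta x)).
Proof. by []. Qed.

(** [cod w] has the defining property by [ext_der_adjoint]. If [eta] has it too, then
  testing against [eta - cod w] shows that this difference has norm zero. *)
Lemma codifferentialE p (w : pform R n p.+1) : forms L w -> codifferential L w = cod w.
Proof.
have [Bu LE] := lattice_basisP; rewrite LE => fw; rewrite -LE.
apply: xget_unique.
  split=> [|theta fth]; first by rewrite LE; exact: forms_cod.
  by rewrite !L2_dotE ext_der_adjoint// -LE.
move=> eta [feta Heta].
have fcw := forms_cod fw.
rewrite LE in feta.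
apply/eqP; rewrite -subr_eq0; apply/eqP.
have fth := formsB feta fcw.
apply: (covector_dot_definite Bu fth).
have dB0 : `|\det B|%:C != 0 :> R[i].
  by rewrite -(rmorph0 (real_complex R)) (inj_eq (@complexI R)) normr_eq0 -unitfE -unitmxE.
have cc (a b : pform R n p) : forms (zspan B) a -> forms (zspan B) b ->
    contC (fun x => covector_dot (a x) (b x)).
  move=> fa fb; apply: contC_sum => g _.
  by apply: contCM; [exact: (contC_form _ fa)|apply: contC_conj; exact: (contC_form _ fb)].
have := Heta (eta - cod w) _; rewrite LE => /(_ fth).
rewrite -LE !L2_dotE (ext_der_adjoint Bu fth fw) => /(mulfI dB0) H.
under eq_mean => x do rewrite [X in covector_dot _ X]
  (_ : _ = (fun v => eta x v - cod w x v))// covector_dotBr -[X in _ + X]mulN1r.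
rewrite meanD; [|exact: cc|apply: contCM; [exact: contC_cst|exact: cc]].
by rewrite meanZ; [rewrite H mulN1r subrr|exact: cc].
Qed.

Lemma F_opE p (w : pform R n p.+1) alpha beta : forms L w ->
  F_op L alpha beta w = alpha%:C *: ext_der (cod w) + beta%:C *: cod (ext_der w).
Proof.
move=> fw; have [Bu LE] := lattice_basisP; rewrite /= !codifferentialE//.
by rewrite LE; apply: forms_ext_der => //; rewrite -LE.
Qed.

End Codifferential.

(** * Dimension *)

Section Dimension.
Context {K : fieldType} {V : lmodType K}.

(** The change of basis matrices [MM] and [NN] satisfy [MM *m NN = 1%:M]. *)
Lemma is_basis_leq (E : set V) k l (e : 'I_k -> V) (f : 'I_l -> V) :
  is_basis E e -> is_basis E f -> (k <= l)%N.
Proof.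
move=> [eE eI eS] [fE fI fS].
have [M HM] := choice (fun i => fS _ (eE i)).
have [N HN] := choice (fun j => eS _ (fE j)).
pose MM := \matrix_(i, j) M i j : 'M[K]_(k, l).
pose NN := \matrix_(j, i) N j i : 'M[K]_(l, k).
apply: (@mulmx1_min _ _ _ MM NN); apply/matrixP => i i'; rewrite !mxE.
pose a i' := \sum_j M i j * N j i' - (i == i')%:R.
suff : a i' = 0.
  move/eqP; rewrite subr_eq0 => /eqP <-; apply: eq_bigr => j _; by rewrite !mxE.
apply: (eI a); rewrite /a; under eq_bigr do rewrite scalerBl scaler_suml.
rewrite sumrB exchange_big/= [X in _ - X](bigD1 i)//= eqxx scale1r.
rewrite [X in _ - (_ + X)]big1 => [|t ti]; last by rewrite eq_sym (negbTE ti) scale0r.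
rewrite addr0 [X in _ - X]HM -sumrB big1// => j _.
under eq_bigr do rewrite -scalerA; rewrite -scaler_sumr -HN.
by rewrite subrr.
Qed.

Lemma dimensionE (E : set V) k (e : 'I_k -> V) : is_basis E e -> dimension E = Some k.
Proof.
move=> Ee; apply: xget_unique; first by exists k => //; exists e.
move=> _ [l [f Ef] <-]; congr Some; apply/eqP.
by rewrite eqn_leq (is_basis_leq Ef Ee) (is_basis_leq Ee Ef).
Qed.

Lemma dimension_fin (E : set V) (T : finType) (e : T -> V) :
  (forall t, E (e t)) ->
  (forall a : T -> K, \sum_t a t *: e t = 0 -> forall t, a t = 0) ->
  (forall v, E v -> exists a : T -> K, v = \sum_t a t *: e t) ->
  dimension E = Some #|T|.
Proof.
move=> eE eI eS; apply: (@dimensionE _ _ (fun i => e (enum_val i))); split=> [i|a a0 i|v].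
- exact: eE.
- have := eI (fun t => a (enum_rank t)) _ (enum_val i); rewrite enum_valK; apply.
  rewrite -[RHS]a0 (reindex _ (onW_bij _ (@enum_val_bij T)))/=.
  by apply: eq_bigr => j _; rewrite enum_valK.
- move=> /eS [a ->]; exists (fun i => a (enum_val i)).
  by rewrite (reindex _ (onW_bij _ (@enum_val_bij T))).
Qed.

End Dimension.

(** * Fourier coefficients of forms *)

Section FourierCoefficients.
Context {R : realType} {n : nat} (B : 'M[R]_n).
Hypothesis Bu : B \in unitmx.
Local Notation L := (zspan B).
Local Notation mean := (mean B).

Lemma dualN u : dual L u -> dual L (- u).
Proof. by move=> du l /du [k E]; exists (- k); rewrite dotNl E rmorphN. Qed.

Lemma dualD u v : dual L u -> dual L v -> dual L (u + v).
Proof.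
by move=> du dv l Ll; have [k E] := du l Ll; have [j E'] := dv l Ll;
  exists (k + j); rewrite dotDl E E' rmorphD.
Qed.

(** The Fourier coefficient of [w] at the frequency [u] is a constant covector. *)
Definition coef p (u : 'rV[R]_n) (w : pform R n p) (v : 'M[R]_(p, n)) : R[i] :=
  mean (fun x => w x v * chi (- u) x).

Lemma contC_coef p (w : pform R n p) u v : forms L w -> contC (fun x => w x v * chi u x).
Proof. by move=> fw; apply: contCM; [exact: (contC_form _ fw)|exact: contC_chi]. Qed.

Lemma altmap_coef p (w : pform R n p) u : forms L w -> altmap (coef u w).
Proof.
move=> fw; have /formsP[wa _ _] := fw; split=> [M C D k b c rM rC rD|M k l kl rkl].
- rewrite /coef -!meanZ; try exact: contC_coef.
  rewrite -meanD; try by apply: contCM; [exact: contC_cst|exact: contC_coef].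
  by apply: eq_mean => x; have [wm _] := wa x; rewrite (wm M C D k b c)//; ring.
- rewrite /coef -[RHS](mean_cst B); apply: eq_mean => x.
  by have [_ wl] := wa x; rewrite (wl M k l)// mul0r.
Qed.

Lemma coefD p (w w' : pform R n p) u v : forms L w -> forms L w' ->
  coef u (w + w' : pform R n p) v = coef u w v + coef u w' v.
Proof.
move=> fw fw'; rewrite /coef -meanD; try exact: contC_coef.
by apply: eq_mean => x; rewrite !fctE mulrDl.
Qed.

Lemma coefZ p (a : R[i]) (w : pform R n p) u v : forms L w ->
  coef u (a *: w : pform R n p) v = a * coef u w v.
Proof.
move=> fw; rewrite /coef -meanZ; last exact: contC_coef.
by apply: eq_mean => x; rewrite !fctE [a *: _]/(a * _) mulrA.
Qed.

Lemma coef_sum p I (r : seq I) (F : I -> pform R n p) u v : (forall i, forms L (F i)) ->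
  coef u (\sum_(i <- r) F i : pform R n p) v = \sum_(i <- r) coef u (F i) v.
Proof.
move=> fF; elim: r => [|i r IH].
  rewrite !big_nil /coef -[RHS](mean_cst B); apply: eq_mean => x.
  exact: mul0r.
by rewrite !big_cons coefD ?IH//; exact: forms_sum.
Qed.

Lemma form_eq p (w w' : pform R n p) : forms L w -> forms L w' ->
  (forall u, dual L u -> forall v, coef u w v = coef u w' v) -> w = w'.
Proof.
move=> fw fw' H; apply/eqP; rewrite -subr_eq0; apply/eqP.
have fd := formsB fw fw'; have /formsP[_ _ dp] := fd.
apply/funext => x; apply/funext => v.
apply: (mean_fourier Bu (f := fun x => (w - w') x v)) x => [||u du].
- exact: (contC_form _ fd).
- by move=> l x Ll; rewrite dp.
have := H _ (dualN du) v; rewrite /coef opprK => E.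
have -> : mean (fun x => (w - w') x v * chi u x) =
    mean (fun x => w x v * chi u x + (-1) * (w' x v * chi u x)).
  by apply: eq_mean => x; rewrite !fctE mulrBl mulN1r.
rewrite meanD; last 2 first.
- exact: contC_coef.
- by apply: contCM; [exact: contC_cst|exact: contC_coef].
by rewrite meanZ ?E ?mulN1r ?subrr//; exact: contC_coef.
Qed.

Lemma coef_partial p (w : pform R n p) u e v : dual L u -> forms L w ->
  coef u (partial w e) v = (0 +i* (2 * pi * dot u e)) * coef u w v.
Proof.
move=> du fw; have /formsP[_ ws wp] := fw; have fdw := forms_partial e fw.
have := @mean_deriveC _ _ _ Bu (fun x => w x v * chi (- u) x) e _ _.
have E x : deriveC e (fun x => w x v * chi (- u) x) x =
    partial w e x v * chi (- u) x + (- (0 +i* (2 * pi * dot u e))) * (w x v * chi (- u) x).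
  rewrite deriveCM//; last exact: smoothC_chi.
  rewrite deriveC_chi dotNl mulrN (_ : 0 +i* (- _) = - (0 +i* (2 * pi * dot u e))).
    by rewrite /partial; ring.
  by apply: eq_ReIm; rewrite /= ?oppr0.
rewrite (eq_mean B E) meanD; last 2 first.
- exact: contC_coef.
- by apply: contCM; [exact: contC_cst|exact: contC_coef].
rewrite meanZ; last exact: contC_coef.
move=> H; apply/eqP; rewrite -subr_eq0 -mulNr; apply/eqP; apply: H.
- by apply: smoothCM => //; exact: smoothC_chi.
- by move=> l x Ll; rewrite wp// (chi_periodic (dualN du)).
Qed.

(** [2 pi i]. *)
Definition twopii : R[i] := 0 +i* (2 * pi).

Lemma twopiiE a : 0 +i* (2 * pi * a) = twopii * a%:C.
Proof. by apply: eq_ReIm; rewrite ?Re_mulc ?Im_mulc /= ?mulr0 ?mul0r ?subr0 ?add0r. Qed.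

Lemma twopii2 : twopii * - twopii = (4 * pi ^+ 2)%:C.
Proof. by apply: eq_ReIm; rewrite ?Re_mulc ?Im_mulc /=; ring. Qed.

Lemma coef_ext_der p (w : pform R n p) u v : dual L u -> forms L w ->
  coef u (ext_der w) v = twopii * wedge1 u (coef u w) v.
Proof.
move=> du fw; rewrite /coef /ext_der /wedge1 mulr_sumr.
under eq_mean do rewrite mulr_suml.
have cP k : contC (fun x => partial w (row k v) x (row' k v) * chi (- u) x).
  by apply: contC_coef; exact: forms_partial.
rewrite mean_sum => [|k _]; last first.
  by under eq_fun do rewrite -mulrA; apply: contCM; [exact: contC_cst|exact: cP].
apply: eq_bigr => k _; under eq_mean do rewrite -mulrA.
rewrite meanZ; last exact: cP.
have := coef_partial (row k v) (row' k v) du fw; rewrite /coef /partial => ->.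
by rewrite twopiiE; ring.
Qed.

Lemma coef_cod p (w : pform R n p.+1) u v : dual L u -> forms L w ->
  coef u (cod w) v = - twopii * coef u w (mcons u v).
Proof.
move=> du fw; rewrite /coef /cod.
have cP (j : 'I_n) :
    contC (fun x => partial w (delta_mx 0 j) x (mcons (delta_mx 0 j) v) * chi (- u) x).
  by apply: contC_coef; exact: forms_partial.
transitivity (mean (fun x =>
    -1 * \sum_j (partial w (delta_mx 0 j) x (mcons (delta_mx 0 j) v) * chi (- u) x))).
  by apply: eq_mean => x; rewrite mulN1r mulNr mulr_suml.
rewrite meanZ; last by apply: contC_sum => j _; exact: cP.
rewrite mean_sum => [|j _]; last exact: cP.
rewrite -/(coef u w _).
have [am _] := altmap_coef u fw.
have mE x : mcons x v = set_row ord0 x (mcons 0 v).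
  apply/matrixP => i j; rewrite [RHS]mxE; case: (unliftP ord0 i) => [k ->|->].
  - by rewrite !mconsSE eq_sym (negbTE (neq_lift _ _)).
  - by rewrite mcons0E eqxx.
rewrite (mE u); have -> : set_row ord0 u (mcons 0 v) =
    set_row ord0 (\sum_j u 0 j *: delta_mx 0 j) (mcons 0 v) by rewrite -row_sum_delta.
rewrite set_row_sum// mulN1r mulNr mulr_sumr; congr (- _).
apply: eq_bigr => j _; rewrite -(mE (delta_mx 0 j)).
have := coef_partial (delta_mx 0 j) (mcons (delta_mx 0 j) v) du fw.
rewrite twopiiE dotC dotE (bigD1 j)//= big1 ?addr0 => [|i ij]; last first.
  by rewrite mxE (negbTE ij) andbF mul0r.
by rewrite mxE !eqxx mul1r -mulrA.
Qed.

(** By [F_opE], this is [F_op] on smooth periodic forms. *)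
Definition flatF p (alpha beta : R) (w : pform R n p.+1) : pform R n p.+1 :=
  alpha%:C *: ext_der (cod w) + beta%:C *: cod (ext_der w).

Lemma forms_flatF p alpha beta (w : pform R n p.+1) : forms L w -> forms L (flatF alpha beta w).
Proof.
move=> fw; apply: formsD; apply: formsZ.
- exact/forms_ext_der/forms_cod.
- exact/forms_cod/forms_ext_der.
Qed.

(** On Fourier coefficients, d is the exterior product with [u] and delta minus the
  interior product, both times [2 pi i]; [wedge1_mcons] computes the interior product
  of an exterior product. *)
Lemma coef_flatF p alpha beta (w : pform R n p.+1) u v : dual L u -> forms L w ->
  coef u (flatF alpha beta w) v =
  (4 * pi ^+ 2)%:C * (alpha%:C * parallel u (coef u w) v +
    beta%:C * ((dot u u)%:C * coef u w v - parallel u (coef u w) v)).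
Proof.
move=> du fw; have fc := forms_cod fw; have fe := forms_ext_der fw.
rewrite coefD; [|exact/formsZ/forms_ext_der|exact/formsZ/forms_cod].
rewrite !coefZ; [|exact: forms_cod|exact: forms_ext_der].
rewrite coef_ext_der// coef_cod// coef_ext_der// wedge1_mcons -twopii2.
have -> : wedge1 u (coef u (cod w)) v = - twopii * parallel u (coef u w) v.
  rewrite /parallel /wedge1 mulr_sumr; apply: eq_bigr => k _.
  by rewrite coef_cod//; ring.
ring.
Qed.

End FourierCoefficients.

(** * Plane waves as eigenforms *)

Section Modes.
Context {R : realType} {m q : nat}.
Local Notation n := m.+1.
Local Notation p := q.+1.

(** For nonzero [u], the columns form a coframe whose first covector is parallel to [u].
  As the square of this matrix is 1, its rows form the dual frame. *)
Definition frame (u : 'rV[R]_n) : 'M[R]_n := projT1 (cid (householder ord0 u)).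

Lemma frameP u : exists c : R,
  [/\ frame u *m frame u = 1%:M, u *m frame u = c *: delta_mx 0 ord0,
      (forall v, dot u v = c * (v *m frame u) 0 ord0) & c ^+ 2 = dot u u].
Proof. by rewrite /frame; case: (cid _). Qed.

Lemma frameK u : frame u *m frame u = 1%:M.
Proof. by have [c []] := frameP u. Qed.

(** A plane wave whose covector is a monomial in the coframe adapted to [u], which makes
  it an eigenform. *)
Definition mode (u : 'rV[R]_n) (f : 'I_p -> 'I_n) : pform R n p :=
  fun x v => chi u x * eps f (v *m frame u).

(** If the monomial [eps f] contains the covector parallel to [u], then [mode u f] is
  annihilated by d, and otherwise by delta. *)
Definition eigen_coef (alpha beta : R) (f : 'I_p -> 'I_n) : R :=
  if f ord0 == ord0 then alpha else beta.

(** The eigenvalue of [mode u f], for [a = eigen_coef alpha beta f]. *)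
Definition torus_eigenvalue (a : R) (u : 'rV[R]_n) : R[i] := (4 * pi ^+ 2 * (a * dot u u))%:C.

Lemma parallel_frame u (f : 'I_p -> 'I_n) v : incr f ->
  parallel u (fun A => eps f (A *m frame u)) v =
  (f ord0 == ord0)%:R * ((dot u u)%:C * eps f (v *m frame u)).
Proof.
move=> fi; have [c [_ uQ dQ <-]] := frameP u.
by apply: (@parallel_eps _ _ _ f ord0 _ u c).
Qed.

Lemma parallel_basis u (a : 'M[R]_(p, n) -> R[i]) (g : {ffun 'I_p -> 'I_n}) :
  altmap a -> incr g ->
  parallel u a (rowsub g (frame u)) =
  (g ord0 == ord0)%:R * ((dot u u)%:C * a (rowsub g (frame u))).
Proof.
move=> aa gi; have aE := altmap_expand aa (frameK u).
transitivity (\sum_(f : {ffun 'I_p -> 'I_n} | incr f) a (rowsub f (frame u)) *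
    parallel u (fun A => eps f (A *m frame u)) (rowsub g (frame u))).
  rewrite /parallel /wedge1; under [RHS]eq_bigr do rewrite mulr_sumr.
  rewrite exchange_big/=; apply: eq_bigr => k _.
  by rewrite [in LHS]aE !mulr_sumr; apply: eq_bigr => f _; ring.
rewrite (bigD1 g)//= big1 ?addr0 => [|f /andP[fi fg]].
  rewrite parallel_frame// mul_rowsub_mx frameK eps_basis// eqxx mulr1; ring.
rewrite parallel_frame// mul_rowsub_mx frameK eps_basis// (negbTE fg).
by rewrite !mulr0.
Qed.

Context (B : 'M[R]_n).
Hypothesis Bu : B \in unitmx.
Local Notation L := (zspan B).

Lemma forms_mode u f : dual L u -> forms L (mode u f).
Proof.
move=> du; apply/formsP; split=> [x|v|l x Ll].
- by apply: altmapZ; exact: altmap_eps.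
- by apply: smoothCM; [exact: smoothC_chi|exact: smoothC_cst].
- by apply/funext => v; rewrite /mode (chi_periodic du).
Qed.

Lemma coef_mode u u' f v : dual L u -> dual L u' ->
  coef B u (mode u' f) v = (u == u')%:R * eps f (v *m frame u').
Proof.
move=> du du'; rewrite /coef /mode.
transitivity (mean B (fun x => eps f (v *m frame u') * chi (u' - u) x)).
  by apply: eq_mean => x; rewrite chiDl; ring.
rewrite meanZ; last exact: contC_chi.
rewrite mulrC; congr (_ * _); have [->|uu'] := eqVneq u u'.
  rewrite subrr -[RHS](mean_cst B); apply: eq_mean => x; exact: chi0.
apply: (mean_chi Bu); first by apply: dualD => //; exact: dualN.
by rewrite subr_eq0 eq_sym.
Qed.

Lemma flatF_mode alpha beta u (f : {ffun 'I_p -> 'I_n}) : dual L u -> incr f ->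
  flatF alpha beta (mode u f) = torus_eigenvalue (eigen_coef alpha beta f) u *: mode u f.
Proof.
move=> du fi; have fm := forms_mode f du.
apply: (form_eq Bu) => [||u' du' v]; [exact: forms_flatF|exact: formsZ|].
rewrite coef_flatF// coefZ// !coef_mode//; have [E|ne] := eqVneq u' u; last first.
  rewrite (_ : parallel _ _ _ = 0) ?(mul0r, mulr0, subrr, addr0)//.
  rewrite /parallel /wedge1 big1// => k _; rewrite coef_mode// (negbTE ne).
  by rewrite mul0r !mulr0.
rewrite -E in fm *; rewrite mul1r.
have -> : parallel u' (coef B u' (mode u' f)) v = parallel u' (fun A => eps f (A *m frame u')) v.
  by congr (parallel u' _ v); apply/funext => A; rewrite coef_mode// eqxx mul1r.
rewrite parallel_frame// /torus_eigenvalue /eigen_coef.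
by case: (f ord0 == ord0); rewrite !rmorphM ?mul1r ?mul0r; ring.
Qed.

(** The value of a covector on [rowsub g (frame u)] is its component along the monomial
  [g] of the coframe at [u]. *)
Lemma eigen_coefs alpha beta (lambda : R[i]) (w : pform R n p) u (g : {ffun 'I_p -> 'I_n}) :
  forms L w -> flatF alpha beta w = lambda *: w -> dual L u -> incr g ->
  (torus_eigenvalue (eigen_coef alpha beta g) u - lambda) * coef B u w (rowsub g (frame u)) = 0.
Proof.
move=> fw Fw du gi; have aw := altmap_coef u fw.
have := coef_flatF Bu alpha beta (rowsub g (frame u)) du fw.
rewrite Fw coefZ// parallel_basis// mulrBl => ->.
rewrite /torus_eigenvalue /eigen_coef.
by case: (g ord0 == ord0); rewrite !rmorphM ?mul1r ?mul0r; ring.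
Qed.

(** [T] enumerates the modes with eigenvalue [lambda]. They are linearly independent
  since each has a single nonzero component among its Fourier coefficients. By
  [eigen_coefs], an eigenform has no other components, so it is the combination of
  these modes with the same Fourier coefficients. *)
Lemma dimension_eigenspace alpha beta (lambda : R[i]) (T : finType)
    (U : T -> 'rV[R]_n) (G : T -> {ffun 'I_p -> 'I_n}) :
  (forall t, [/\ dual L (U t), incr (G t) & torus_eigenvalue (eigen_coef alpha beta (G t)) (U t) = lambda]) ->
  injective (fun t => (U t, G t)) ->
  (forall u (g : {ffun 'I_p -> 'I_n}), dual L u -> incr g ->
    torus_eigenvalue (eigen_coef alpha beta g) u = lambda -> exists t, (U t, G t) = (u, g)) ->
  dimension [set w : pform R n p | forms L w /\ flatF alpha beta w = lambda *: w] = Some #|T|.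
Proof.
move=> HT UGinj UGsurj; pose e t := mode (U t) (G t).
have fe t : forms L (e t) by have [du _ _] := HT t; exact: forms_mode.
have coef_comb (a : T -> R[i]) u v : dual L u ->
    coef B u (\sum_t a t *: e t) v = \sum_t a t * ((u == U t)%:R * eps (G t) (v *m frame (U t))).
  move=> du; rewrite coef_sum => [|t]; last exact: formsZ.
  apply: eq_bigr => t _; rewrite coefZ// coef_mode//.
  by have [] := HT t.
have coef_at (a : T -> R[i]) t :
    coef B (U t) (\sum_s a s *: e s) (rowsub (G t) (frame (U t))) = a t.
  have [du gi _] := HT t; rewrite coef_comb// (bigD1 t)//= big1 ?addr0 => [|s st].
    by rewrite mul_rowsub_mx frameK eps_basis// !eqxx !mulr1.
  case: eqP => [E|]; last by rewrite mul0r mulr0.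
  rewrite -E mul_rowsub_mx frameK eps_basis//; last by have [] := HT s.
  case: eqP => [E'|]; last by rewrite !mulr0.
  by case/eqP: st; apply: UGinj; rewrite /= E E'.
apply: (dimension_fin (e := e)) => [t|a a0 t|w [fw Fw]].
- split=> //; have [du gi <-] := HT t; exact: flatF_mode.
- rewrite -(coef_at a t) a0 /coef -[RHS](mean_cst B); apply: eq_mean => x.
  exact: mul0r.
exists (fun t => coef B (U t) w (rowsub (G t) (frame (U t)))).
apply: (form_eq Bu) => // [|u du v]; first by apply: forms_sum => t _; exact: formsZ.
rewrite coef_comb// (altmap_expand (altmap_coef u fw) (frameK u)).
rewrite [RHS](bigID (fun t => U t == u))/= [X in _ + X]big1 ?addr0; last first.
  by move=> t; rewrite eq_sym => /negbTE ->; rewrite mul0r mulr0.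
rewrite (bigID (fun f => torus_eigenvalue (eigen_coef alpha beta (f : {ffun _ -> _})) u == lambda))/=.
rewrite [X in _ + X]big1 ?addr0; last first.
  move=> f /andP[fi fl]; have /eqP := eigen_coefs fw Fw du fi.
  by rewrite mulf_eq0 subr_eq0 (negbTE fl) => /eqP ->; rewrite mul0r.
rewrite (partition_big G
  (fun f => incr f && (torus_eigenvalue (eigen_coef alpha beta f) u == lambda)))/=; last first.
  by move=> t /eqP <-; have [_ -> ->] := HT t; rewrite eqxx.
apply: eq_bigr => f /andP[fi /eqP fl].
have [t [Ut Gt]] := UGsurj u f du fi fl.
rewrite (bigD1 t)/=; last by rewrite Ut Gt !eqxx.
rewrite big1 ?addr0 => [|s /andP[/andP[/eqP Us /eqP Gs] st]]; last first.
  by case/eqP: st; apply: UGinj; rewrite /= Us Gs Ut Gt.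
by rewrite Ut Gt eqxx mul1r.
Qed.

End Modes.

(** * Recovering dilation factors from multiplicities *)

Section MinimalNorm.
Context {R : realType}.
Variables (m : R -> nat) (r0 : R).
Hypotheses (r0_gt0 : 0 < r0) (m_r0 : (0 < m r0)%N).
Hypothesis m_small : forall r : R, 0 < r -> r < r0 -> m r = 0%N.

(** The smallest [s > 0] such that [m (s / a) > 0] is [r0 * a]. *)
Lemma dilation_inj (a a' : R) : 0 < a -> 0 < a' ->
  (forall s, 0 < s -> m (s / a) = m (s / a')) -> a = a'.
Proof.
wlog aa' : a a' / a < a' => [hw a0 a'0 H|a0 a'0 H].
  have [aa'|aa'|//] := ltgtP a a'; first exact: hw.
  by apply/esym/hw => // s s0; rewrite H.
have := H (r0 * a) (mulr_gt0 r0_gt0 a0).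
rewrite mulfK ?gt_eqF// => E; move: m_r0; rewrite E m_small ?divr_gt0 ?mulr_gt0//.
by rewrite ltr_pdivrMr// ltr_pM2l.
Qed.

(** The first positive argument at which a sum does not vanish is [r0] times its smallest
  dilation factor, so [a] is [a'] or [b']. Cancelling the terms with this factor
  leaves a case of [dilation_inj], unless they have different coefficients; but the
  values at [r0 * a] show that the coefficients agree when [a < b]. *)
Lemma dilation_pair_le A B (a b a' b' : R) : (0 < A)%N -> (0 < B)%N ->
  0 < a -> 0 < b -> 0 < a' -> 0 < b' -> a <= b ->
  (forall s, 0 < s -> 
     (A * m (s / a)%R + B * m (s / b)%R = A * m (s / a')%R + B * m (s / b')%R)%N) ->
  (a = a' /\ b = b') \/ [/\ A = B, a = b' & b = a'].
Proof.
move=> A0 B0 a0 b0 a'0 b'0 ab H.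
have small x y : 0 < x -> 0 < y -> x < y -> m (r0 * x / y) = 0%N.
  by move=> x0 y0 xy; rewrite m_small ?divr_gt0 ?mulr_gt0// ltr_pdivrMr// ltr_pM2l.
have peak x : 0 < x -> m (r0 * x / x) = m r0 by move=> x0; rewrite mulfK ?gt_eqF.
have cancelB : b = b' -> a = a'.
  move=> bb'; apply: dilation_inj => // s s0; have /eqP := H s s0.
  by rewrite bb' eqn_add2r eqn_pmul2l// => /eqP.
have cancelA : a = a' -> b = b'.
  move=> aa'; apply: dilation_inj => // s s0; have /eqP := H s s0.
  by rewrite aa' eqn_add2l eqn_pmul2l// => /eqP.
have Am : (0 < A * m r0)%N by rewrite muln_gt0 A0.
have Bm : (0 < B * m r0)%N by rewrite muln_gt0 B0.
have [aa'|aa'|/esym/[dup] aa' /cancelA] := ltgtP a' a; last by left.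
  have := H (r0 * a') (mulr_gt0 r0_gt0 a'0).
  rewrite peak// (small a' a)// (small a' b)// ?(lt_le_trans aa')// !muln0 => E.
  by exfalso; move: Am E; clear; lia.
have ra0 := mulr_gt0 r0_gt0 a0.
have [b'a|ab'|b'a] := ltgtP b' a.
- have := H (r0 * b') (mulr_gt0 r0_gt0 b'0).
  rewrite peak// (small b' a)// (small b' b)// ?(lt_le_trans b'a)// !muln0 => E.
  by exfalso; move: Bm E; clear; lia.
- have := H (r0 * a) ra0.
  rewrite peak// (small a a')// (small a b')// !muln0 => E.
  by exfalso; move: Am E; clear; lia.
- have [E|ab'] := eqVneq a b.
    by have := cancelB (etrans (esym E) (esym b'a)); move: aa' => /[swap] ->; rewrite ltxx.
  have {}ab : a < b by rewrite lt_neqAle ab'.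
  have AB : A = B.
    have := H (r0 * a) ra0; rewrite b'a !peak// (small a b)// (small a a')// !muln0 addn0 add0n => /eqP.
    by rewrite eqn_pmul2r// => /eqP.
  right; split=> //; apply: dilation_inj => // s s0; have /eqP := H s s0.
  by rewrite b'a AB addnC eqn_add2r eqn_pmul2l// => /eqP.
Qed.

Lemma dilation_pair A B (a b a' b' : R) : (0 < A)%N -> (0 < B)%N ->
  0 < a -> 0 < b -> 0 < a' -> 0 < b' ->
  (forall s, 0 < s -> 
     (A * m (s / a)%R + B * m (s / b)%R = A * m (s / a')%R + B * m (s / b')%R)%N) ->
  (a = a' /\ b = b') \/ [/\ A = B, a = b' & b = a'].
Proof.
move=> A0 B0 a0 b0 a'0 b'0 H; have [ab|/ltW ba] := leP a b.
  exact: dilation_pair_le.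
have H' s : 0 < s -> (B * m (s / b)%R + A * m (s / a)%R = B * m (s / b')%R + A * m (s / a')%R)%N.
  by move=> s0; rewrite addnC H// addnC.
by have [[-> ->]|[-> -> ->]] := dilation_pair_le B0 A0 b0 a0 b'0 a'0 ba H'; [left|right].
Qed.

End MinimalNorm.

(** * The dual lattice *)

Section DualLattice.
Context {R : realType} {n : nat}.

(** Short dual vectors have bounded integral coordinates. *)
Lemma dual_ball_finite (L : set 'rV[R]_n) (r : R) : is_lattice L ->
  finite_set [set u : 'rV[R]_n | dual L u /\ dot u u <= r].
Proof.
move=> [B Bu ->].
pose M := (\sum_j \sum_i `|B j i|) * (r + 1).
pose N := Num.bound M.
pose T := {ffun 'I_n -> 'I_(N + N).+1}.
pose h (g : T) := map_mx (fun k : int => k%:~R) (\row_j ((g j)%:Z - N%:Z)) *m (invmx B)^T : 'rV[R]_n.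
apply: (@sub_finite_set _ _ (h @` [set: T])); last exact/finite_image/finite_finset.
move=> u [du ur]; have [z uE] := dualP Bu du.
have zE j : (z 0 j)%:~R = \sum_i u 0 i * B j i :> R.
  transitivity ((u *m B^T) 0 j).
    by rewrite uE -mulmxA -trmx_mul mulmxV// trmx1 mulmx1 mxE.
  by rewrite mxE; apply: eq_bigr => i _; rewrite mxE.
have r0 : 0 <= r by apply: le_trans ur; exact: dot_ge0.
have u1 i : `|u 0 i| <= r + 1.
  have : u 0 i ^+ 2 <= r.
    apply: le_trans ur; rewrite dotE (bigD1 i)//= expr2 lerDl sumr_ge0// => k _.
    by rewrite -expr2 sqr_ge0.
  rewrite -real_normK ?num_real//; move: (normr_ge0 (u 0 i)); move: `|_| => x x0 xr.
  by nra.
have M0 : 0 <= M by rewrite mulr_ge0 ?addr_ge0// sumr_ge0// => i _; exact: sumr_ge0.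
have zM j : `|z 0 j| < N%:Z.
  rewrite -(ltr_int R) intr_norm zE; apply: le_lt_trans (archi_boundP M0).
  apply: (@le_trans _ _ (\sum_i `|B j i| * (r + 1))).
    apply: le_trans (ler_norm_sum _ _ _) _; apply: ler_sum => i _.
    by rewrite normrM mulrC ler_wpM2l.
  rewrite -mulr_suml /M ler_wpM2r ?addr_ge0// [leRHS](bigD1 j)//=.
  by rewrite lerDl sumr_ge0// => i _; exact: sumr_ge0.
exists [ffun j => inord (absz (z 0 j + N%:Z))] => //.
rewrite uE /h; congr (map_mx _ _ *m _); apply/rowP => j.
rewrite mxE ffunE inordK; last by move: (zM j); lia.
by move: (zM j); lia.
Qed.

Lemma scale_set_lattice (L : set 'rV[R]_n) (c : R) : c != 0 -> is_lattice L ->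
  is_lattice (scale_set c L).
Proof.
move=> c0 [B Bu ->]; exists (c *: B); first by rewrite unitmxZ// unitfE.
apply/seteqP; split=> x.
- by move=> [_ [z _ <-] <-]; exists z => //; rewrite -scalemxAr.
- by move=> [z _ <-]; exists (intv R z *m B); [exists z|rewrite -scalemxAr].
Qed.

Lemma dual_scale (L : set 'rV[R]_n) (c : R) u : c != 0 ->
  dual (scale_set c L) u <-> dual L (c *: u).
Proof.
move=> c0; split=> du l Ll.
- by have [|k E] := du (c *: l); [exists l|exists k; rewrite dotZl -dotZr].
- by case: Ll => x Lx <-; have [k E] := du x Lx; exists k; rewrite dotZr -dotZl.
Qed.

End DualLattice.

(** * The spectrum *)

Section Multiplicities.
Context {R : realType} {m q : nat}.
Local Notation n := m.+1.
Local Notation p := q.+1.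

Definition shell (L : set 'rV[R]_n) (a : R) (lambda : R[i]) : set 'rV[R]_n :=
  [set u | dual L u /\ torus_eigenvalue a u = lambda].

Definition mult (L : set 'rV[R]_n) (a : R) (lambda : R[i]) : nat :=
  #|` fset_set (shell L a lambda)|%fset.

Lemma shell_finite L a lambda : is_lattice L -> 0 < a -> finite_set (shell L a lambda).
Proof.
move=> hL a0; have k0 : 0 < 4 * pi ^+ 2 * a :> R by rewrite !mulr_gt0// ?exprn_gt0 ?pi_gt0.
apply: (sub_finite_set _ (@dual_ball_finite _ _ L (complex.Re lambda / (4 * pi ^+ 2 * a)) hL)).
move=> u [du E]; split=> //; rewrite -E /= ler_pdivlMr//.
by rewrite le_eqVlt; apply/orP; left; apply/eqP; ring.
Qed.

Lemma mult_scale L (c a : R) lambda : is_lattice L -> c != 0 -> 0 < a ->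
  mult (scale_set c L) (c ^+ 2 * a) lambda = mult L a lambda.
Proof.
move=> hL c0 a0; rewrite /mult.
have -> : shell (scale_set c L) (c ^+ 2 * a) lambda = (fun u => c^-1 *: u) @` shell L a lambda.
  apply/seteqP; split=> u.
  - move=> [/(dual_scale _ _ c0) du E]; exists (c *: u); last by rewrite scalerA mulVf// scale1r.
    split=> //; rewrite -E /torus_eigenvalue; congr (_%:C); rewrite dotZl dotZr; ring.
  - move=> [v [dv E] <-]; split.
      by apply/dual_scale => //; rewrite scalerA divff// scale1r.
    by rewrite -E /torus_eigenvalue; congr (_%:C); rewrite dotZl dotZr; field.
rewrite fset_set_image; last exact: shell_finite.
rewrite card_imfset//= => u v /(congr1 (fun x => c *: x)).
by rewrite !scalerA divff// !scale1r.
Qed.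

(** Each dual vector carries ['C(m, q)] monomials containing the covector parallel to it,
  with eigenvalue governed by [alpha], and ['C(m, p)] other ones, governed by [beta].
  The zero vector is no exception: any frame will do for it. *)
Lemma spectrumE L alpha beta lambda : is_lattice L -> 0 < alpha -> 0 < beta ->
  spectrum L (@F_op R n L alpha beta p) lambda =
  Some (mult L alpha lambda * 'C(m, q) + mult L beta lambda * 'C(m, p))%N.
Proof.
move=> hL a0 b0; have [Bu LE] := lattice_basisP hL.
have fa := shell_finite lambda hL a0; have fb := shell_finite lambda hL b0.
pose X := fset_set (shell L alpha lambda); pose Y := fset_set (shell L beta lambda).
pose G0 := {f : {ffun 'I_p -> 'I_n} | incr f && (f ord0 == ord0)}.
pose G1 := {f : {ffun 'I_p -> 'I_n} | incr f && (f ord0 != ord0)}.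
pose T : finType := (X * G0 + Y * G1)%type.
pose U (t : T) : 'rV[R]_n := match t with inl x => val x.1 | inr y => val y.1 end.
pose G (t : T) : {ffun 'I_p -> 'I_n} := match t with inl x => val x.2 | inr y => val y.2 end.
have cT : #|T| = (mult L alpha lambda * 'C(m, q) + mult L beta lambda * 'C(m, p))%N.
  rewrite card_sum !card_prod !card_sig /mult !cardfE -card_incr_zero -card_incr_pos.
  by congr (_ * _ + _ * _)%N; apply: eq_card => f; rewrite finset.in_set.
rewrite -cT /spectrum.
have -> : [set w : pform R n p | forms L w /\ F_op L alpha beta w = lambda *: w] =
    [set w : pform R n p | forms (zspan (lattice_basis L)) w /\ flatF alpha beta w = lambda *: w].
  apply/seteqP; split=> w [fw Fw]; (split; first by rewrite -LE in fw * || rewrite LE in fw).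
  - by rewrite -Fw (F_opE hL).
  - by rewrite (F_opE hL)// LE.
have inX x : x \in X -> dual (zspan (lattice_basis L)) x /\ torus_eigenvalue alpha x = lambda.
  by rewrite /X in_fset_set// in_setE -LE.
have inY y : y \in Y -> dual (zspan (lattice_basis L)) y /\ torus_eigenvalue beta y = lambda.
  by rewrite /Y in_fset_set// in_setE -LE.
apply: (@dimension_eigenspace _ _ _ _ Bu alpha beta lambda T U G).
- case=> [[x [f /= fP]]|[y [f /= fP]]] /=.
  + have /andP[fi f0] := fP; have [dx ex] := inX _ (valP x).
    by split=> //; rewrite /eigen_coef f0.
  + have /andP[fi f0] := fP; have [dy ey] := inY _ (valP y).
    by split=> //; rewrite /eigen_coef (negbTE f0).
- case=> [[x f]|[y f]] [[x' f']|[y' f']] /= [E1 E2].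
  + by congr (inl (_, _)); exact/val_inj.
  + by have /andP[_] := valP f; have /andP[_] := valP f'; rewrite /= -E2 => /negbTE ->.
  + by have /andP[_] := valP f; have /andP[_] := valP f'; rewrite /= -E2 => -> .
  + by congr (inr (_, _)); exact/val_inj.
- move=> u g du gi; rewrite /eigen_coef; case: ifPn => g0 E.
  + have uX : u \in X by rewrite /X in_fset_set// in_setE; split=> //; rewrite LE.
    have gP : incr g && (g ord0 == ord0) by rewrite gi.
    by exists (inl ([` uX]%fset, exist _ g gP)).
  + have uY : u \in Y by rewrite /Y in_fset_set// in_setE; split=> //; rewrite LE.
    have gP : incr g && (g ord0 != ord0) by rewrite gi.
    by exists (inr ([` uY]%fset, exist _ g gP)).
Qed.

Definition sphere_count (L : set 'rV[R]_n) (r : R) : nat :=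
  #|` fset_set [set u | dual L u /\ dot u u = r]|%fset.

Lemma mult_sphere L a s : 0 < a -> mult L a (4 * pi ^+ 2 * s)%:C = sphere_count L (s / a).
Proof.
move=> a0; rewrite /mult /sphere_count; congr (#|` fset_set _|%fset).
have k0 : 4 * pi ^+ 2 != 0 :> R by rewrite mulf_neq0// expf_neq0// gt_eqF// pi_gt0.
apply/seteqP; split=> u [du E]; split=> //.
- by move/complexI/(mulfI k0): E => <-; rewrite mulrAC mulfV ?mul1r// gt_eqF.
- by rewrite /torus_eigenvalue E; congr ((_ * _)%:C); rewrite mulrCA divff ?mulr1// gt_eqF.
Qed.

Lemma minimal_norm L : is_lattice L -> exists r0 : R,
  [/\ 0 < r0, (0 < sphere_count L r0)%N & forall r, 0 < r -> r < r0 -> sphere_count L r = 0%N].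
Proof.
move=> hL; have [B Bu LE] := hL.
pose u1 : 'rV[R]_n := intv R (delta_mx 0 ord0) *m (invmx B)^T.
have du1 : dual L u1 by rewrite LE; exact: dual_zspan.
have u10 : u1 != 0.
  apply/negP => /eqP /(congr1 (mulmx^~ B^T)); rewrite mul0mx -mulmxA -trmx_mul mulmxV//.
  rewrite trmx1 mulmx1 => /rowP /(_ ord0); rewrite !mxE !eqxx => /eqP.
  by rewrite oner_eq0.
have fin r := @dual_ball_finite _ _ L r hL.
pose S := fset_set [set u | dual L u /\ dot u u <= dot u1 u1].
have inS u : u \in S <-> dual L u /\ dot u u <= dot u1 u1.
  by rewrite /S in_fset_set ?in_setE.
have u1S : u1 \in S by apply/inS.
pose P (u : S) := val u != 0.
have P1 : P [` u1S]%fset by [].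
case: (@arg_minP _ _ _ [` u1S]%fset P (fun u => dot (val u) (val u)) P1) => u Pu umin.
have [du ule] := (inS (val u)).1 (valP u).
exists (dot (val u) (val u)); split=> [||r r0 ru].
- by rewrite lt_def dot_ge0 dot_eq0 andbT; exact: Pu.
- rewrite /sphere_count cardfs_gt0; apply/fset0Pn; exists (val u).
  rewrite in_fset_set ?in_setE//; apply: sub_finite_set (fin (dot (val u) (val u))) => v [dv E].
  by split=> //; rewrite E.
- rewrite /sphere_count (_ : [set v | _] = set0) ?fset_set0 ?cardfs0//.
  rewrite -subset0 => v [dv vr].
  have vS : v \in S by apply/inS; split=> //; rewrite vr (le_trans (ltW ru)).
  have : P [` vS]%fset by rewrite /P /= -dot_eq0 vr gt_eqF.
  by move/umin; rewrite /= vr leNgt ru.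
Qed.

End Multiplicities.

(** * The isospectrality criterion *)

Lemma bin_succ_eq m q : (q <= m)%N -> 'C(m, q) = 'C(m, q.+1) <-> m.+1 = (2 * q.+1)%N.
Proof.
move=> qm; have A0 : (0 < 'C(m, q))%N by rewrite bin_gt0.
have H := mul_bin_left m q; split=> [E|E].
  by move/eqP: H; rewrite -E eqn_pmul2r// => /eqP; lia.
have E' : (m - q = q.+1)%N by lia.
by apply/eqP; rewrite eq_sym -(eqn_pmul2l (ltn0Sn q)) H E'.
Qed.

Lemma pair_eq (T : Type) (x y u v : T) : x = u \/ x = v -> y = u \/ y = v ->
  u = x \/ u = y -> v = x \/ v = y -> (x = u /\ y = v) \/ (x = v /\ y = u).
Proof. by move=> [->|->] [->|->] [?|?] [?|?]; subst; auto. Qed.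

Section Isospectrality.
Context {R : realType} {m q : nat}.
Local Notation n := m.+1.
Local Notation p := q.+1.
Variables (L : set 'rV[R]_n) (c : R).
Hypotheses (hL : is_lattice L) (hc : c != 0).

Lemma c2_gt0 : 0 < c ^+ 2.
Proof. by rewrite lt_def sqr_ge0 sqrf_eq0 hc. Qed.

Lemma isospectral_mult alpha beta a b : 0 < alpha -> 0 < beta -> 0 < a -> 0 < b ->
  isospectral_F p L alpha beta (scale_set c L) (c ^+ 2 * a) (c ^+ 2 * b) <->
  forall lambda, (mult L alpha lambda * 'C(m, q) + mult L beta lambda * 'C(m, p) =
                  mult L a lambda * 'C(m, q) + mult L b lambda * 'C(m, p))%N.
Proof.
move=> al0 be0 a0 b0; have hcL := scale_set_lattice hc hL.
have c20 := c2_gt0.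
have SE lambda : spectrum (scale_set c L) (@F_op R n (scale_set c L) (c ^+ 2 * a) (c ^+ 2 * b) p) lambda =
    Some (mult L a lambda * 'C(m, q) + mult L b lambda * 'C(m, p))%N.
  by rewrite spectrumE//; [rewrite !mult_scale|exact: mulr_gt0|exact: mulr_gt0].
rewrite /isospectral_F; split=> [H lambda|H]; last first.
  by apply/funext => lambda; rewrite SE spectrumE// H.
by have := congr1 (fun f => f lambda) H; rewrite /= SE spectrumE// => -[].
Qed.

Lemma isospectral_spheres alpha beta a b : 0 < alpha -> 0 < beta -> 0 < a -> 0 < b ->
  isospectral_F p L alpha beta (scale_set c L) (c ^+ 2 * a) (c ^+ 2 * b) ->
  forall s, 0 < s ->
    ('C(m, q) * sphere_count L (s / alpha)%R + 'C(m, p) * sphere_count L (s / beta)%R =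
     'C(m, q) * sphere_count L (s / a)%R + 'C(m, p) * sphere_count L (s / b)%R)%N.
Proof.
move=> al0 be0 a0 b0 /(isospectral_mult al0 be0 a0 b0) H s s0.
by have := H (real_complex R (4 * pi ^+ 2 * s)); rewrite !mult_sphere// !(mulnC 'C(_, _)).
Qed.

End Isospectrality.

(* On forms of top degree p = n one has d = 0, so F does not involve beta and
   the first equivalence can only constrain alpha'; it is stated in full for
   p < n, and in its correct form for p = n. *)
Theorem corollary3p21 (R : realType) (n p : nat) (L : set 'rV[R]_n)
    (alpha alpha' beta beta' c : R)
    (hL : is_lattice L) (hp : (1 <= p <= n)%N)
    (halpha : 0 < alpha) (halpha' : 0 < alpha')
    (hbeta : 0 < beta) (hbeta' : 0 < beta') (hc : c != 0) :
  [/\ (n <> 2 * p)%N -> (p < n)%N ->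
        (isospectral_F p L alpha beta (scale_set c L) alpha' beta' <->
         (alpha', beta') = (c ^+ 2 * alpha, c ^+ 2 * beta)),
      p = n ->
        (isospectral_F p L alpha beta (scale_set c L) alpha' beta' <->
         alpha' = c ^+ 2 * alpha)
    & n = (2 * p)%N ->
        (isospectral_F p L alpha beta (scale_set c L) alpha' beta' <->
         [set alpha'; beta'] = [set c ^+ 2 * alpha; c ^+ 2 * beta])].
Proof.
case: p hp => [|q]; first by rewrite ltn0.
case: n L hL => [|m] L hL; first by rewrite ltn0 andbF.
rewrite /= ltnS => qm.
have c20 := c2_gt0 hc; have c20' : c ^+ 2 != 0 by rewrite gt_eqF.
pose a := alpha' / c ^+ 2; pose b := beta' / c ^+ 2.
have aE : alpha' = c ^+ 2 * a by rewrite mulrC divfK.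
have bE : beta' = c ^+ 2 * b by rewrite mulrC divfK.
have a0 : 0 < a by rewrite divr_gt0.
have b0 : 0 < b by rewrite divr_gt0.
have Aeq x y : c ^+ 2 * x = c ^+ 2 * y -> x = y := mulfI c20' (x1 := x) (x2 := y).
have [r0 [r0_gt0 mr0 mmin]] := minimal_norm hL.
have A0 : (0 < 'C(m, q))%N by rewrite bin_gt0.
have bin_eq := bin_succ_eq qm.
have iso_iff := isospectral_mult hL hc halpha hbeta a0 b0.
have iso_spheres := isospectral_spheres hL hc halpha hbeta a0 b0.
rewrite aE bE; split=> [npq qm'|[qm']|npq].
- have B0 : (0 < 'C(m, q.+1))%N by rewrite bin_gt0.
  split=> [/iso_spheres H|[/Aeq Ea /Aeq Eb]]; last by apply/iso_iff => lambda; rewrite Ea Eb.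
  have [[-> ->]//|[/bin_eq E]] := dilation_pair r0_gt0 mr0 mmin A0 B0 halpha hbeta a0 b0 H.
  by case: npq.
- have B0 : 'C(m, q.+1) = 0%N by rewrite bin_small// qm'.
  split=> [/iso_spheres H|/Aeq E]; last first.
    by apply/iso_iff => lambda; rewrite B0 E !muln0.
  congr (_ * _); apply/esym/(dilation_inj r0_gt0 mr0 mmin halpha a0) => s s0.
  by have /eqP := H s s0; rewrite B0 !mul0n !addn0 eqn_pmul2l// => /eqP.
- have AB : 'C(m, q) = 'C(m, q.+1) by exact/bin_eq.
  have B0 : (0 < 'C(m, q.+1))%N by rewrite -AB.
  split=> [/iso_spheres H|E].
    have [[-> ->]//|[_ -> ->]] := dilation_pair r0_gt0 mr0 mmin A0 B0 halpha hbeta a0 b0 H.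
    by rewrite setUC.
  have inE1 x : [set c ^+ 2 * a; c ^+ 2 * b] (c ^+ 2 * x) -> x = a \/ x = b.
    by case=> /Aeq ->; [left|right].
  have inE2 x : [set c ^+ 2 * alpha; c ^+ 2 * beta] (c ^+ 2 * x) -> x = alpha \/ x = beta.
    by case=> /Aeq ->; [left|right].
  have Ha : alpha = a \/ alpha = b by apply: inE1; rewrite E; left.
  have Hb : beta = a \/ beta = b by apply: inE1; rewrite E; right.
  have Ha' : a = alpha \/ a = beta by apply: inE2; rewrite -E; left.
  have Hb' : b = alpha \/ b = beta by apply: inE2; rewrite -E; right.
  apply/iso_iff => lambda; rewrite -AB.
  have [[-> ->]//|[-> ->]] := pair_eq Ha' Hb' Ha Hb.
  by rewrite addnC.
Qed.
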